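(* Let $r\in\mathbb{Z}_{\ge 2}$, $\mathbf{a}=(a_1,\ldots,a_r)\in\mathbb{Z}_{\ge1}^r$, $\mathbf{m}=(m_1,\ldots,m_r)\in\mathbb{Z}_{\ge1}^r$, $\mathbf{w}=(w_1,\ldots,w_r)\in\mathfrak{R}^r$, and $\mathbf{j}=(j_{\mathrm{I}},j_{\mathrm{II}})\in\mathbb{Z}_{\ge0}^2$ with $j_{\mathrm{I}}+j_{\mathrm{II}}=r$. Let $$\Phi^{(\mathbf{j})}(z;\mathbf{a},\mathbf{m},\mathbf{w}):=\prod_{l=1}^{r}a_l^{m_l}\varphi_{m_l}^{(\mathbf{j},l)}(a_lz-w_l).$$ Let $J=\mathrm{I}$ in Case I and $J=\mathrm{II}$ in Case II. Then, as meromorphic functions of $z\in\mathbb{C}$, $$\Phi^{(\mathbf{j})}(z;\mathbf{a},\mathbf{m},\mathbf{w})=\cos\left(\frac{\pi r}{2}\right)\pi^r\delta_{j_{\mathrm{II}},0}\prod_{l=1}^{r}a_l\delta_{m_l,1}+\sum_{n=1}^{|\mathbf{m}|}\sum_{\rho}\sum_{\Lambda\in R_\rho}\sum_{(\nu_k)_{k\in\Lambda^c}\in K_{n,\Lambda}^{-}}\ \prod_{l\in\Lambda}(-1)^{(a_l\rho-w_l)\delta_{\mathrm{II}}^{(\mathbf{j},l)}}\left\{\prod_{u\in\Lambda^c}A_{\nu_u}^{(\mathbf{j},u)}(\rho;a_u,m_u,w_u)\right\}\varphi_n^{(J)}(z-\rho),$$ where $\rho$ runs over all poles of $\Phi^{(\mathbf{j})}(z;\mathbf{a},\mathbf{m},\mathbf{w})$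 in $\mathfrak{R}$, and $|\mathbf{m}|:=m_1+\cdots+m_r$.
   Context: $\mathfrak{R}:=\{z\in\mathbb{C}\mid 0\le \mathrm{Re}\,z<1\}$. $\mathrm{I}$ and $\mathrm{II}$ are two formal labels; $\delta_{x,y}$ is the Kronecker delta; $\delta_{\mathbb{Z}}(z)=1$ if $z\in\mathbb{Z}$ and $0$ otherwise. Empty products are $1$ and empty sums are $0$. For $N\in\mathbb{Z}_{\ge1}$, $J\in\{\mathrm{I},\mathrm{II}\}$ and $z\in\mathbb{C}\setminus\mathbb{Z}$, $$\varphi_N^{(J)}(z):=\frac{1}{z^N}+\sum_{n=1}^{\infty}(-1)^{n\delta_{J,\mathrm{II}}}\left(\frac{1}{(z+n)^N}+\frac{1}{(z-n)^N}\right)$$ (so $\varphi_1^{(\mathrm{I})}(z)=\pi\cot(\pi z)$, $\varphi_1^{(\mathrm{II})}(z)=\pi\csc(\pi z)$). With $\zeta$ the Riemann zeta function and $\mu\ge1$: $\alpha_\mu^{(\mathrm{I})}:=2\zeta(\mu)$ and $\alpha_\mu^{(\mathrm{II})}:=-2(1-2^{1-\mu})\zeta(\mu)$ if $\mu$ is even; $\alpha_\mu^{(\mathrm{I})}=\alpha_\mu^{(\mathrm{II})}:=0$ if $\mu$ is odd. $(m)_\nu:=m(m+1)\cdots(m+\nu-1)$ for $\nu\ge1$, $(m)_0:=1$. For $z_0,w\in\mathbb{C}$, $a\in\mathbb{Z}_{\ge1}$: $\mathrm{sgn}^{(J)}(z_0;a,w):=(-1)^{(az_0-w)\delta_{J,\mathrm{II}}}$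 if $az_0-w\in\mathbb{Z}$, and $:=0$ otherwise. For $a,m\in\mathbb{Z}_{\ge1}$, $\nu\in\mathbb{Z}_{\ge0}$, $w,z_0\in\mathbb{C}$, $$A_\nu^{(J)}(z_0;a,m,w):=\begin{cases}(-1)^m\,\mathrm{sgn}^{(J)}(z_0;a,w)\binom{m+\nu-1}{m-1}\alpha_{m+\nu}^{(J)}a^{m+\nu}&(az_0-w\in\mathbb{Z}),\\ (-1)^\nu\frac{(m)_\nu}{\nu!}\varphi_{m+\nu}^{(J)}(az_0-w)\,a^{m+\nu}&(az_0-w\notin\mathbb{Z}).\end{cases}$$ Let $[r]:=\{1,\ldots,r\}$. Put $\delta_{\mathrm{II}}^{(\mathbf{j},l)}:=1$ if $j_{\mathrm{I}}+1\le l\le r$ and $:=0$ if $1\le l\le j_{\mathrm{I}}$. For $l\in[r]$, $\varphi_N^{(\mathbf{j},l)}$ and $A_\nu^{(\mathbf{j},l)}$ denote $\varphi_N^{(\mathrm{I})}$ and $A_\nu^{(\mathrm{I})}$ if $1\le l\le j_{\mathrm{I}}$, and $\varphi_N^{(\mathrm{II})}$ and $A_\nu^{(\mathrm{II})}$ if $j_{\mathrm{I}}+1\le l\le r$. For $\rho\in\mathbb{C}$, $R_\rho:=\{\Lambda\subset[r]\mid a_\lambda\rho-w_\lambda\in\mathbb{Z}\text{ for all }\lambda\in\Lambda\}$ (the empty set belongs to $R_\rho$). $\Lambda^c:=[r]\setminus\Lambda$, and $$K_{n,\Lambda}^{-}:=\left\{(\nu_k)_{k\in\Lambda^c}\in\mathbb{Z}_{\ge0}^{|\Lambda^c|}\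 \Big|\ n=\sum_{\lambda\in\Lambda}m_\lambda-\sum_{k\in\Lambda^c}\nu_k\right\};$$ if $\Lambda^c=\emptyset$, this set consists of the empty tuple when $n=\sum_{\lambda\in[r]} m_\lambda$ and is empty otherwise. Case I: $j_{\mathrm{II}}=0$ or $\sum_{l=j_{\mathrm{I}}+1}^{r}a_l$ is even. Case II: $\sum_{l=j_{\mathrm{I}}+1}^{r}a_l$ is odd. *)

(* Defs.v *)
From HB Require Import structures.
From mathcomp Require Export all_boot all_order all_algebra.
From mathcomp Require Export all_classical all_reals all_analysis.
From mathcomp Require Export complex.
Export Order.TTheory GRing.Theory Num.Theory.
Export numFieldNormedType.Exports.

Set Implicit Arguments.
Unset Strict Implicit.
Unset Printing Implicit Defensive.

Local Open Scope classical_set_scope.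
Local Open Scope complex_scope.
Local Open Scope ring_scope.

(* The complex numbers over R.  The norm topology of MathComp-Analysis is
   attached to abstract [numClosedFieldType]s and is not found on [R[i]]
   itself, whence this alias. *)
Definition cplx (R : realType) : numClosedFieldType := R[i].

Definition ofR (R : realType) (x : R) : cplx R := x%:C.

Definition strip (R : realType) : set (cplx R) :=
  [set z | 0 <= complex.Re z < 1].
Arguments strip R : clear implicits.

Inductive label := LI | LII.

Definition deltaII (J : label) : nat := if J is LII then 1 else 0.

Section Functions.
Variable R : realType.
Local Notation C := (cplx R).
Implicit Types (J : label) (z w : C).

Definition isint z : Prop := exists k : int, z = k%:~R.

(* [toint z] is the integer equal to z when [isint z] holds; it is only used
   in that case. *)
Definition toint z : int := Num.floor (complex.Re z).

(* A function of z in C \ Z; its values at integers are irrelevant. The series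
   is the limit of its partial sums, the terms +n and -n being grouped (so that
   it converges for N = 1 too). *)
Definition phi J (N : nat) z : C :=
  z ^- N +
  \big[+%R/0]_(1 <= n <oo)
    ((-1) ^+ (n * deltaII J)%N * ((z + n%:R) ^- N + (z - n%:R) ^- N)).

(* The Riemann zeta function at integers mu >= 2. *)
Definition zeta (mu : nat) : R := \big[+%R/0]_(1 <= n <oo) (n%:R ^- mu : R).

Definition alpha J (mu : nat) : R :=
  if odd mu then 0
  else if J is LI then 2 * zeta mu
  else - 2 * (1 - 2 ^ (1 - mu%:Z)) * zeta mu.

Definition rising (m nu : nat) : nat := (\prod_(i < nu) (m + i))%N.

(* (-1)^(z d) for z a complex number that is an integer. *)
Definition sgnpow z (d : nat) : C := (-1) ^ (toint z * d%:Z).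

Definition sgnJ J (z0 : C) (a : nat) w : C :=
  if `[< isint (a%:R * z0 - w) >] then sgnpow (a%:R * z0 - w) (deltaII J)
  else 0.

Definition coefA J (nu : nat) (z0 : C) (a m : nat) w : C :=
  if `[< isint (a%:R * z0 - w) >] then
    (-1) ^+ m * sgnJ J z0 a w * 'C((m + nu - 1)%N, (m - 1)%N)%:R
      * ofR (alpha J (m + nu)%N) * a%:R ^+ (m + nu)%N
  else
    (-1) ^+ nu * ((rising m nu)%:R / nu`!%:R)
      * phi J (m + nu)%N (a%:R * z0 - w) * a%:R ^+ (m + nu)%N.

(* |f(z)| tends to infinity as z tends to rho, z <> rho. This defines poles
   among isolated singularities, and is only meant for f holomorphic on a
   punctured neighbourhood of rho; the value f(rho) is irrelevant. *)
Definition is_pole (f : C -> C) (rho : C) : Prop :=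
  ComplexField.Normc.normc (f z) @[z --> rho^'] --> +oo.

End Functions.

Section Products.
Variables (R : realType) (r : nat).
Local Notation C := (cplx R).
Variables (a m : 'I_r -> nat) (w : 'I_r -> C) (jI : nat).

(* Indices l in {1,...,r} are represented by l - 1 : 'I_r. *)
Definition label_of (l : 'I_r) : label := if (l < jI)%N then LI else LII.

Definition Phi (z : C) : C :=
  \prod_(l < r)
    ((a l)%:R ^+ m l * phi (label_of l) (m l) ((a l)%:R * z - w l)).

(* The natural domain of definition of the meromorphic function Phi. *)
Definition Phi_dom : set C :=
  [set z | forall l : 'I_r, ~ isint ((a l)%:R * z - w l)].

Definition Phi_poles : set C := strip R `&` is_pole Phi.

Definition Rset (rho : C) : set {set 'I_r} :=
  [set Lam : {set 'I_r} | forall l : 'I_r, l \in Lam -> isint ((a l)%:R * rho - w l)].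

(* Tuples are indexed by the subtype of the complement of Lam; the equation
   n = \sum m - \sum nu is written without truncated subtraction. *)
Definition Kminus (n : nat) (Lam : {set 'I_r}) :
    set {ffun {k : 'I_r | k \in ~: Lam} -> nat} :=
  [set nu | (n + \sum_k nu k = \sum_(l in Lam) m l)%N].

End Products.
Arguments Kminus {r} m n Lam.

(* Main.v *)
Require Import Defs.
From mathcomp Require Import ring lra zify.

(* Set T = e^(i pi z).  Herglotz' trick gives phi_1^I = pi cot(pi z), hence
   phi_1^II = pi csc(pi z), as rational functions of T.  Since phi_(N+1) is
   -phi_N'/N, comparing first order Taylor coefficients shows that phi_N^I and
   phi_N^II / phi_1^II are polynomials in phi_1^I.  So Phi minus its principal
   parts and minus the constant is a rational function of T.  It is bounded near
   every point, by local expansion in the strip and by (anti)periodicity outside,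
   and bounded at +i infinity and -i infinity.  A rational function of T with
   these properties is constant, which replaces Liouville's theorem.  The
   constant is the average of the limits at +i infinity and -i infinity, and
   these cancel because phi_1^I tends there to -i pi and i pi, and every other
   phi_N^J to 0.

   The sum over poles is exchanged for the sum over the finite set of the rho in
   the strip at which some a_l rho - w_l is an integer: where Phi has no pole,
   all coefficients of its principal part vanish. *)

Set Implicit Arguments.
Unset Strict Implicit.
Unset Printing Implicit Defensive.

Local Open Scope classical_set_scope.
Local Open Scope complex_scope.
Local Open Scope ring_scope.

(** * Modulus and convergence in C *)

(** [phi] and [Phi] are total functions with meaningless values at their poles. Local statements
    therefore concern only u with 0 < |u| < d, and Laurent expansions are replaced by polynomials:
    after multiplication by u^|m|, [Phi] near rho is a product of factors, each a constant (its
    polar term) plus u^(m_l) times a Taylor polynomial. The sums over Lambda and (nu_k) are the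
    expansion of this product, Lambda being the set of factors that contribute their polar term.
    Derivatives are likewise read off as coefficients of such polynomials.

    The label J is the one for which phi_n^J picks up the same sign as [Phi] under z -> z + 1. For J
    = II this antiperiodicity is compatible only with a zero constant, in accordance with the factor
    delta_{j_II,0}. If j_II = 0 and all m_l = 1, the constant is the product of the a_l times half
    of (-i pi)^r + (i pi)^r, whence cos(pi r / 2) pi^r. *)

Section Modulus.
Variable R : realType.
Local Notation C := (cplx R).
Implicit Types (z w : C) (e : R).

Definition nc (z : C) : R := ComplexField.Normc.normc z.

Lemma ncE z : `|z| = (nc z)%:C. Proof. by []. Qed.

Lemma nc_ge0 z : 0 <= nc z.
Proof. by case: z => x y; exact: sqrtr_ge0. Qed.

Lemma nc0 : nc 0 = 0. Proof. exact: ComplexField.Normc.normc0. Qed.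
Lemma nc1 : nc 1 = 1. Proof. exact: ComplexField.Normc.normc1. Qed.

Lemma nc_eq0 z : (nc z == 0) = (z == 0).
Proof.
apply/eqP/eqP => [|->]; last exact: nc0.
exact: ComplexField.Normc.eq0_normc.
Qed.

Lemma nc_gt0 z : (0 < nc z) = (z != 0).
Proof. by rewrite lt_def nc_eq0 nc_ge0 andbT. Qed.

Lemma ncM z w : nc (z * w) = nc z * nc w.
Proof. exact: ComplexField.Normc.normcM. Qed.

Lemma ncV z : nc z^-1 = (nc z)^-1.
Proof. exact: ComplexField.Normc.normcV. Qed.

Lemma ncN z : nc (- z) = nc z. Proof. exact: normcN. Qed.

Lemma ncD z w : nc (z + w) <= nc z + nc w. Proof. exact: le_normcD. Qed.

Lemma ncB z w : nc (z - w) <= nc z + nc w.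
Proof. by rewrite -(ncN w) ncD. Qed.

Lemma ncBC z w : nc (z - w) = nc (w - z).
Proof. by rewrite -ncN opprB. Qed.

Lemma ncBl z w : nc z - nc w <= nc (z - w).
Proof. by rewrite lerBlDr -{1}(subrK w z) ncD. Qed.

Lemma ncDl z w : nc z - nc w <= nc (z + w).
Proof. by rewrite -(ncN w) (le_trans (ncBl _ _))// opprK. Qed.

Lemma ncX z n : nc (z ^+ n) = nc z ^+ n.
Proof. by elim: n => [|n IH]; rewrite ?expr0 ?nc1// !exprS ncM IH. Qed.

Lemma nc_ofR (x : R) : nc (ofR x) = `|x|.
Proof. by rewrite /nc /ofR /= expr0n /= addr0 sqrtr_sqr. Qed.

Lemma nc_nat n : nc n%:R = n%:R.
Proof.
elim: n => [|n IH]; first exact: nc0.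
have -> : n.+1%:R = ofR n.+1%:R :> C.
  by rewrite /ofR rmorph_nat.
by rewrite nc_ofR ger0_norm.
Qed.

Lemma nc_sum (I : Type) (s : seq I) (P : pred I) (F : I -> C) :
  nc (\sum_(i <- s | P i) F i) <= \sum_(i <- s | P i) nc (F i).
Proof.
elim/big_rec2 : _ => [|i y x _ le]; first by rewrite nc0.
by rewrite (le_trans (ncD _ _))// lerD2l.
Qed.

Lemma nc_sign n : nc ((-1) ^+ n) = 1.
Proof. by rewrite ncX ncN nc1 expr1n. Qed.

Lemma nc_ge_Re z : `|complex.Re z| <= nc z.
Proof.
case: z => x y /=; rewrite -sqrtr_sqr ler_sqrt ?addr_ge0 ?sqr_ge0//.
by rewrite lerDl sqr_ge0.
Qed.

Lemma nc_ge_Im z : `|complex.Im z| <= nc z.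
Proof.
case: z => x y /=; rewrite -sqrtr_sqr ler_sqrt ?addr_ge0 ?sqr_ge0//.
by rewrite lerDr sqr_ge0.
Qed.

Lemma nc_le_ReIm z : nc z <= `|complex.Re z| + `|complex.Im z|.
Proof.
case: z => x y /=; rewrite -[leRHS]ger0_norm ?addr_ge0// -sqrtr_sqr.
rewrite ler_sqrt ?sqr_ge0// sqrrD !real_normK ?num_real//.
by rewrite lerD2r lerDl mulrn_wge0// mulr_ge0.
Qed.

Lemma cvgCP (T : Type) (F : set_system T) (FF : Filter F) (u : T -> C) (l : C) :
  (u @ F --> l) <-> (forall e, 0 < e -> \forall t \near F, nc (u t - l) < e).
Proof.
split=> [/cvgrPdist_lt h e e0|h].
  have e0' : (0 : C) < ofR e by rewrite /ofR ltcR.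
  near=> t; have : `|l - u t| < ofR e by near: t; exact: h.
  by rewrite ncE ncBC /ofR ltcR.
apply/cvgrPdist_lt => e e0.
(* Positivity in the partial order of [C] forces a zero imaginary part, so a complex tolerance is a
   real one. *)
have eE : e = ofR (complex.Re e).
  by move: e0; case: e => x y; rewrite ltcE/= => /andP[/eqP-> _].
have e0' : 0 < complex.Re e by move: e0; rewrite {1}eE /ofR ltcR.
near=> t; rewrite eE ncE ncBC /ofR ltcR; near: t; exact: h.
Unshelve. all: by end_near. Qed.

Lemma cvgC_nc (T : Type) (F : set_system T) (FF : Filter F) (u : T -> C) (l : C) :
  u @ F --> l -> (nc \o u) @ F --> nc l.
Proof.
move=> /cvgCP h; apply/cvgrPdist_lt => e e0.
near=> t; have : nc (u t - l) < e by near: t; exact: h.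
apply: le_lt_trans; rewrite /= ler_norml.
by have := ncBl (u t) l; have := ncBl l (u t); rewrite (ncBC l); lra.
Unshelve. all: by end_near. Qed.

Lemma cvgC_sum (T : Type) (F : set_system T) (FF : Filter F) (I : Type) (s : seq I)
  (f : I -> T -> C) (l : I -> C) : (forall i, f i t @[t --> F] --> l i) ->
  \sum_(i <- s) f i t @[t --> F] --> \sum_(i <- s) l i.
Proof.
move=> fl; elim: s => [|i s IH].
  have -> : (fun t => \sum_(j <- [::]) f j t) = cst 0.
    by apply/funext => t; rewrite big_nil.
  by rewrite big_nil; exact: cvg_cst.
have -> : (fun t => \sum_(j <- i :: s) f j t) = (fun t => f i t + \sum_(j <- s) f j t).
  by apply/funext => t; rewrite big_cons.
by rewrite big_cons; exact: cvgD (fl i) IH.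
Qed.

Lemma cvgC_prod (T : Type) (F : set_system T) (FF : Filter F) (I : Type) (s : seq I)
  (f : I -> T -> C) (l : I -> C) : (forall i, f i t @[t --> F] --> l i) ->
  \prod_(i <- s) f i t @[t --> F] --> \prod_(i <- s) l i.
Proof.
move=> fl; elim: s => [|i s IH].
  have -> : (fun t => \prod_(j <- [::]) f j t) = cst 1.
    by apply/funext => t; rewrite big_nil.
  by rewrite big_nil; exact: cvg_cst.
have -> : (fun t => \prod_(j <- i :: s) f j t) = (fun t => f i t * \prod_(j <- s) f j t).
  by apply/funext => t; rewrite big_cons.
by rewrite big_cons; exact: cvgM (fl i) IH.
Qed.

Lemma cvgC_le (u : nat -> C) (l : C) (b : R) :
  u @ \oo --> l -> (forall n, nc (u n) <= b) -> nc l <= b.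
Proof.
move=> /cvgC_nc/(_ _) ul ub.
rewrite -(cvg_lim (@Rhausdorff R) ul); apply: limr_le.
  by apply/cvg_ex; exists (nc l).
by near=> n; exact: ub.
Unshelve. all: by end_near. Qed.

Lemma cvgC_ReIm (u : nat -> C) (x y : R) :
  (fun n => complex.Re (u n)) @ \oo --> x ->
  (fun n => complex.Im (u n)) @ \oo --> y -> u @ \oo --> (x +i* y : C).
Proof.
move=> /cvgrPdist_lt hx /cvgrPdist_lt hy; apply/cvgCP => e e0.
near=> n; apply: (le_lt_trans (nc_le_ReIm _)).
have h1 : `|x - complex.Re (u n)| < e / 2.
  by near: n; apply: hx; rewrite divr_gt0.
have h2 : `|y - complex.Im (u n)| < e / 2.
  by near: n; apply: hy; rewrite divr_gt0.
rewrite [ltRHS](splitr e); case: (u n) h1 h2 => a b /= h1 h2.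
by rewrite ltrD// distrC.
Unshelve. all: by end_near. Qed.

Lemma Re_sum (I : Type) (s : seq I) (F : I -> C) :
  complex.Re (\sum_(i <- s) F i) = \sum_(i <- s) complex.Re (F i).
Proof. by apply: (big_morph (@complex.Re R)) => // -[a b] [c d]. Qed.

Lemma Im_sum (I : Type) (s : seq I) (F : I -> C) :
  complex.Im (\sum_(i <- s) F i) = \sum_(i <- s) complex.Im (F i).
Proof. by apply: (big_morph (@complex.Im R)) => // -[a b] [c d]. Qed.

Lemma sum_inv_sqr_le K : \sum_(1 <= n < K) (n%:R ^- 2 : R) <= 2.
Proof.
(* The sharper bound 2 - 1/(k+1) is inductive, because 1/x - 1/(x+1) exceeds 1/(x+1)^2. *)
have aux k : \sum_(1 <= n < k.+2) (n%:R ^- 2 : R) <= 2 - k.+1%:R^-1.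
  elim: k => [|k IH]; first by rewrite big_nat1 expr1n invr1; lra.
  rewrite big_nat_recr//=.
  apply: le_trans (lerD IH (lexx _)) _.
  rewrite -[k.+2%:R]natr1; have k1 : 1 <= k.+1%:R :> R by rewrite ler1n.
  move: k.+1%:R k1 => x x1; rewrite -subr_ge0.
  have -> : 2 - (x + 1)^-1 - (2 - x^-1 + (x + 1) ^- 2) = x^-1 * (x + 1) ^- 2.
    by field; lra.
  by rewrite mulr_ge0// invr_ge0 ?exprn_ge0; lra.
case: K => [|[|k]]; [by rewrite big_geq|by rewrite big_geq|].
by apply: le_trans (aux k) _; rewrite gerBl invr_ge0.
Qed.

(* Comparison with the squares is the only convergence criterion needed: pairing
   the terms of index n and -n makes the series for N = 1 of this size as well. *)
Lemma is_cvg_series_sqr (u : R^nat) (B : R) :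
  (forall n, (1 <= n)%N -> `|u n| <= B / n%:R ^+ 2) ->
  cvgn (fun K => \sum_(1 <= n < K) u n).
Proof.
move=> uB.
have B0 : 0 <= B by have := uB 1%N isT; rewrite expr1n divr1; exact: le_trans (normr_ge0 _).
have pos (v : R^nat) : (forall n, (1 <= n)%N -> 0 <= v n <= 2 * (B / n%:R ^+ 2)) ->
    cvgn (fun K => \sum_(1 <= n < K) v n).
  move=> vB; apply: nondecreasing_is_cvgn.
    apply/nondecreasing_seqP => -[|n]; first by rewrite !big_geq.
    rewrite (@big_nat_recr _ _ _ n.+1)//= lerDl.
    by case/andP: (vB n.+1 isT).
  exists (2 * (B * 2)) => _ [K _ <-].
  have : \sum_(1 <= n < K) v n <= \sum_(1 <= n < K) (2 * (B * n%:R ^- 2)).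
    by apply: ler_sum_nat => n /andP[n1 _]; case/andP: (vB n n1).
  move=> /le_trans; apply; rewrite -!mulr_sumr ler_wpM2l// ler_wpM2l//.
  exact: sum_inv_sqr_le.
(* Both u + |u| and |u| lie between 0 and 2B/n^2, so monotone convergence applies to each. *)
have -> : (fun K => \sum_(1 <= n < K) u n) =
    (fun K => \sum_(1 <= n < K) (u n + `|u n|)) \- (fun K => \sum_(1 <= n < K) `|u n|).
  apply/funext => K /=; rewrite -sumrB; apply: eq_bigr => n _; ring.
apply: is_cvgB; apply: pos => n n1; have := uB n n1.
  by have := ler_norm (u n); have := ler_norm (- u n); rewrite normrN; lra.
by have := normr_ge0 (u n); lra.
Qed.

Lemma is_cvg_seriesC_sqr (u : nat -> C) (B : R) :
  (forall n, (1 <= n)%N -> nc (u n) <= B / n%:R ^+ 2) ->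
  cvgn (fun K => \sum_(1 <= n < K) u n).
Proof.
move=> uB.
have /cvg_ex[x hx] : cvgn (fun K => \sum_(1 <= n < K) complex.Re (u n)).
  by apply: (@is_cvg_series_sqr _ B) => n n1; exact: le_trans (nc_ge_Re _) (uB n n1).
have /cvg_ex[y hy] : cvgn (fun K => \sum_(1 <= n < K) complex.Im (u n)).
  by apply: (@is_cvg_series_sqr _ B) => n n1; exact: le_trans (nc_ge_Im _) (uB n n1).
apply/cvg_ex; exists (x +i* y); apply: cvgC_ReIm.
  by apply: cvg_trans hx; apply: near_eq_cvg; near=> n; rewrite Re_sum.
by apply: cvg_trans hy; apply: near_eq_cvg; near=> n; rewrite Im_sum.
Unshelve. all: by end_near. Qed.

Lemma nc_sum_sqr_le (u : nat -> C) (B : R) K :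
  (forall n, (1 <= n)%N -> nc (u n) <= B / n%:R ^+ 2) ->
  nc (\sum_(1 <= n < K) u n) <= B * 2.
Proof.
move=> uB.
have B0 : 0 <= B.
  by have := uB 1%N isT; rewrite expr1n divr1; apply: le_trans (nc_ge0 _).
apply: le_trans (nc_sum _ _ _) _.
have : \sum_(1 <= n < K) nc (u n) <= \sum_(1 <= n < K) (B * n%:R ^- 2).
  by apply: ler_sum_nat => n /andP[n1 _]; exact: uB.
move=> /le_trans; apply; rewrite -mulr_sumr ler_wpM2l//.
exact: sum_inv_sqr_le.
Qed.

Lemma Re_mul2 z : complex.Re (2 * z) = 2 * complex.Re z.
Proof. by rewrite mulr_natl mulr2n; case: z => x y /=; ring. Qed.

Lemma Im_mul2 z : complex.Im (2 * z) = 2 * complex.Im z.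
Proof. by rewrite mulr_natl mulr2n; case: z => x y /=; ring. Qed.

Lemma ReD z w : complex.Re (z + w) = complex.Re z + complex.Re w.
Proof. by case: z w => [? ?] [? ?]. Qed.

Lemma ImD z w : complex.Im (z + w) = complex.Im z + complex.Im w.
Proof. by case: z w => [? ?] [? ?]. Qed.

Lemma ReN z : complex.Re (- z) = - complex.Re z.
Proof. by case: z => [? ?]. Qed.

Lemma ImN z : complex.Im (- z) = - complex.Im z.
Proof. by case: z => [? ?]. Qed.

Lemma natC n : (n%:R : C) = ofR n%:R.
Proof. by rewrite /ofR rmorph_nat. Qed.

Lemma Re_nat n : complex.Re (n%:R : C) = n%:R.
Proof. by rewrite natC. Qed.

Lemma Im_nat n : complex.Im (n%:R : C) = 0.
Proof. by rewrite natC. Qed.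

Lemma invnC n : (n%:R : C)^-1 = ofR n%:R^-1.
Proof. by rewrite natC /ofR fmorphV. Qed.

Lemma Re_ofRM (x : R) z : complex.Re (ofR x * z) = x * complex.Re z.
Proof. by case: z => a b /=; ring. Qed.

Lemma Im_ofRM (x : R) z : complex.Im (ofR x * z) = x * complex.Im z.
Proof. by case: z => a b /=; ring. Qed.

Lemma Re_divn z n : complex.Re (z / n%:R) = complex.Re z / n%:R.
Proof. by rewrite mulrC invnC Re_ofRM mulrC. Qed.

Lemma Im_divn z n : complex.Im (z / n%:R) = complex.Im z / n%:R.
Proof. by rewrite mulrC invnC Im_ofRM mulrC. Qed.

End Modulus.
Arguments nc {R} z : simpl never.

(** * Local expansions *)

Section Approx.
Variable R : realType.
Local Notation C := (cplx R).
Implicit Types (z w t u c : C) (f g : C -> C) (P Q : {poly C}).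

Lemma nc_horner P t : nc t <= 1 -> nc P.[t] <= \sum_(i < size P) nc P`_i.
Proof.
move=> t1; rewrite horner_coef; apply: le_trans (nc_sum _ _ _) _.
apply: ler_sum => i _; rewrite ncM ncX ler_piMr ?nc_ge0//.
by rewrite exprn_ile1 ?nc_ge0.
Qed.

(* f(u) = P(u) + O(u^M) as u tends to 0, u <> 0; only the coefficients of P of
   index less than M matter. *)
Definition approx f P (M : nat) := exists d B : R, [/\ 0 < d, 0 <= B &
  forall u, 0 < nc u < d -> nc (f u - P.[u]) <= B * nc u ^+ M].

Lemma approxP P M : approx (horner P) P M.
Proof.
by exists 1, 0; split => // u _; rewrite subrr nc0 mul0r.
Qed.

Lemma eq_approx f g P M (d : R) : 0 < d ->
  (forall u, 0 < nc u < d -> f u = g u) -> approx f P M -> approx g P M.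
Proof.
move=> d0 fg [d' [B [d'0 B0 fP]]].
exists (Num.min d d'), B; split => //; first by rewrite lt_min d0.
move=> u; rewrite lt_min => /and3P[u0 ud ud'].
by rewrite -fg ?u0// fP ?u0.
Qed.

Lemma approxW f P M M' : (M' <= M)%N -> approx f P M -> approx f P M'.
Proof.
move=> MM [d [B [d0 B0 fP]]].
exists (Num.min d 1), B; split => //; first by rewrite lt_min d0 ltr01.
move=> u; rewrite lt_min => /and3P[u0 ud u1].
rewrite (le_trans (fP u _)) ?u0// ler_wpM2l// ler_wiXn2l ?nc_ge0//.
exact: ltW.
Qed.

Lemma approxD f g P Q M : approx f P M -> approx g Q M ->
  approx (fun u => f u + g u) (P + Q) M.
Proof.
move=> [d [B [d0 B0 fP]]] [d' [B' [d'0 B'0 gQ]]].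
exists (Num.min d d'), (B + B'); split; rewrite ?addr_ge0//.
  by rewrite lt_min d0.
move=> u; rewrite lt_min => /and3P[u0 ud ud'].
rewrite hornerD opprD addrACA mulrDl (le_trans (ncD _ _))// lerD//.
  by rewrite fP ?u0.
by rewrite gQ ?u0.
Qed.

Lemma approxM f g P Q M : approx f P M -> approx g Q M ->
  approx (fun u => f u * g u) (P * Q) M.
Proof.
move=> [d [B [d0 B0 fP]]] [d' [B' [d'0 B'0 gQ]]].
pose bP := \sum_(i < size P) nc P`_i; pose bQ := \sum_(i < size Q) nc Q`_i.
have bP0 : 0 <= bP by apply: sumr_ge0 => i _; exact: nc_ge0.
have bQ0 : 0 <= bQ by apply: sumr_ge0 => i _; exact: nc_ge0.
exists (Num.min 1 (Num.min d d')), ((bP + B) * B' + B * bQ); split.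
- by rewrite !lt_min ltr01 d0.
- by rewrite addr_ge0 ?mulr_ge0 ?addr_ge0.
move=> u; rewrite !lt_min => /and4P[u0 u1 ud ud'].
have h1 := fP u; rewrite u0 ud in h1; have {}h1 := h1 isT.
have h2 := gQ u; rewrite u0 ud' in h2; have {}h2 := h2 isT.
have h3 := nc_horner P (ltW u1); have h4 := nc_horner Q (ltW u1).
have u0' := ltW u0; have uM : nc u ^+ M <= 1 by rewrite exprn_ile1// ltW.
have uM0 : 0 <= nc u ^+ M by rewrite exprn_ge0.
have -> : f u * g u - (P * Q).[u] = f u * (g u - Q.[u]) + (f u - P.[u]) * Q.[u].
  by rewrite hornerM; ring.
apply: le_trans (ncD _ _) _; rewrite !ncM mulrDl; apply: lerD.
  rewrite -mulrA ler_pM ?nc_ge0//.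
  rewrite -(subrK P.[u] (f u)) addrC (le_trans (ncD _ _))// lerD//.
  by rewrite (le_trans h1)// ler_piMr.
by rewrite mulrAC ler_pM ?nc_ge0.
Qed.

Lemma approx_cst c M : approx (fun=> c) c%:P M.
Proof. by apply: eq_approx ltr01 _ (approxP _ _) => u _; rewrite hornerC. Qed.

Lemma approxZ c f P M : approx f P M -> approx (fun u => c * f u) (c *: P) M.
Proof.
move=> fP; rewrite -mul_polyC; exact: approxM (approx_cst c M) fP.
Qed.

Lemma approxB f g P Q M : approx f P M -> approx g Q M ->
  approx (fun u => f u - g u) (P - Q) M.
Proof.
move=> fP gQ; rewrite -[- Q]scaleN1r.
apply: eq_approx ltr01 _ (approxD fP (approxZ (-1) gQ)) => u _.
by rewrite mulN1r.
Qed.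

Lemma approx_prod (I : Type) (s : seq I) (F : I -> C -> C) (G : I -> {poly C}) M :
  (forall i, approx (F i) (G i) M) ->
  approx (fun u => \prod_(i <- s) F i u) (\prod_(i <- s) G i) M.
Proof.
move=> FG; elim: s => [|i s IH].
  rewrite big_nil -polyC1.
  by apply: eq_approx ltr01 _ (approx_cst 1 M) => u _; rewrite big_nil.
rewrite big_cons; apply: eq_approx ltr01 _ (approxM (FG i) IH) => u _.
by rewrite big_cons.
Qed.

Lemma approx_sum (I : Type) (s : seq I) (F : I -> C -> C) (G : I -> {poly C}) M :
  (forall i, approx (F i) (G i) M) ->
  approx (fun u => \sum_(i <- s) F i u) (\sum_(i <- s) G i) M.
Proof.
move=> FG; elim: s => [|i s IH].
  rewrite big_nil -polyC0.
  by apply: eq_approx ltr01 _ (approx_cst 0 M) => u _; rewrite big_nil.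
rewrite big_cons; apply: eq_approx ltr01 _ (approxD (FG i) IH) => u _.
by rewrite big_cons.
Qed.

Lemma approx_mulX f P M k : approx f P M ->
  approx (fun u => u ^+ k * f u) ('X^k * P) (k + M).
Proof.
move=> [d [B [d0 B0 fP]]]; exists d, B; split => // u ud.
rewrite hornerM hornerXn -mulrBr ncM ncX exprD mulrCA ler_wpM2l ?exprn_ge0 ?nc_ge0//.
exact: fP.
Qed.

Lemma approx_scale f P M (a : C) : a != 0 -> approx f P M ->
  approx (fun u => f (a * u)) (P \Po (a *: 'X)) M.
Proof.
rewrite -nc_gt0 => a0 [d [B [d0 B0 fP]]].
exists (d / nc a), (B * nc a ^+ M); split.
- by rewrite divr_gt0.
- by rewrite mulr_ge0// exprn_ge0// ltW.
move=> u /andP[u0 ud]; rewrite horner_comp hornerZ hornerX.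
rewrite -mulrA -exprMn -ncM fP// ncM mulr_gt0//=.
by rewrite mulrC -ltr_pdivlMr.
Qed.

Lemma approx_small f P M : approx f P M -> (0 < M)%N ->
  forall e : R, 0 < e -> exists2 d : R, 0 < d &
  forall u, 0 < nc u < d -> nc (f u - P`_0) <= e.
Proof.
move=> [d [B [d0 B0 fP]]] M0 e e0.
pose Q := P - (P`_0)%:P.
have [q qE] : exists q, Q = q * 'X.
  have /factor_theorem[q] : root Q 0.
    by rewrite /root horner_coef0 coefB coefC subrr.
  by rewrite subr0 => ->; exists q.
pose b := \sum_(i < size q) nc q`_i.
have b0 : 0 <= b by apply: sumr_ge0 => i _; exact: nc_ge0.
exists (Num.min d (Num.min 1 (e / (B + b + 1)))).
  by rewrite !lt_min d0 ltr01 divr_gt0//; lra.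
move=> u; rewrite !lt_min => /and4P[u0 ud u1 ue].
have h1 := fP u; rewrite u0 ud in h1; have {}h1 := h1 isT.
have -> : f u - P`_0 = (f u - P.[u]) + q.[u] * u.
  have -> : q.[u] * u = P.[u] - P`_0.
    by rewrite -hornerMX -qE /Q hornerD hornerN hornerC.
  by ring.
apply: le_trans (ncD _ _) _; rewrite ncM.
have h2 := nc_horner q (ltW u1).
have h3 : B * nc u ^+ M <= B * nc u.
  rewrite ler_wpM2l// -[leRHS]expr1 ler_wiXn2l ?nc_ge0//; exact: ltW.
have h4 : nc q.[u] * nc u <= b * nc u by rewrite ler_wpM2r// ltW.
move: ue; rewrite ltr_pdivlMr; last lra.
by have := ltW u0; lra.
Qed.

(** The substitute for differentiation: two expansions of one function, found in different ways, are
    compared coefficient by coefficient. The difference expands the zero function; its constant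
    coefficient is the limit 0, and division by u, which is nonzero, lowers the order by one. *)
Lemma approx_uniq f P Q M : approx f P M -> approx f Q M ->
  forall i, (i < M)%N -> P`_i = Q`_i.
Proof.
move=> fP fQ.
have : approx (fun=> 0) (P - Q) M.
  by apply: eq_approx ltr01 _ (approxB fP fQ) => u _; rewrite subrr.
suff H : forall M P, approx (fun=> 0) P M -> forall i, (i < M)%N -> P`_i = 0.
  by move=> /H PQ i iM; have := PQ i iM; rewrite coefB => /eqP; rewrite subr_eq0 => /eqP.
move=> {M f P Q fP fQ}; elim=> // M IH P h.
have P00 : P`_0 = 0.
  apply/eqP; rewrite -nc_eq0; apply/negPn/negP => n0.
  have e0 : 0 < nc P`_0 / 2 by rewrite divr_gt0// lt_def n0 nc_ge0.
  have [d d0 H] := approx_small h isT e0.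
  have := H (ofR (d / 2)); rewrite nc_ofR ger0_norm; last lra.
  by rewrite sub0r ncN => {}H; have := H ltac:(apply/andP; split; lra); lra.
have [q qE] : exists q, P = q * 'X.
  have /factor_theorem[q] : root P 0 by rewrite /root horner_coef0 P00.
  by rewrite subr0 => ->; exists q.
have hq : approx (fun=> 0) q M.
  case: h => d [B [d0 B0 hP]]; exists d, B; split => // u ud.
  have /andP[u0 _] := ud.
  rewrite -(ler_pM2r u0) -mulrA -exprSr; apply: le_trans (hP u ud).
  by rewrite !sub0r !ncN qE hornerMX ncM.
move=> [|i]//; rewrite ltnS => iM; rewrite qE coefMX/=; exact: IH.
Qed.

End Approx.

(** * Taylor expansion of phi *)

Section Taylor.
Variable R : realType.
Local Notation C := (cplx R).
Implicit Types (z w t u c x : C) (J : label).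

(* Truncated binomial series of (1 + t)^(-N-1), in polynomial form. *)
Lemma binomial_inverse N M : exists q : {poly C}, forall t : C,
  (1 + t) ^+ N.+1 * (\sum_(k < M) 'C(N + k, N)%:R * (- t) ^+ k) = 1 + t ^+ M * q.[t].
Proof.
elim: N => [|N [q IH]].
  exists (- (-1) ^+ M)%:P => t; rewrite hornerC.
  under eq_bigr do rewrite bin0 mul1r.
  have := subrX1 (- t) M => h.
  have -> : (1 + t) ^+ 1 * (\sum_(i < M) (- t) ^+ i) =
    - ((- t - 1) * (\sum_(i < M) (- t) ^+ i)) by rewrite expr1; ring.
  by rewrite -h [in LHS]exprNn; ring.
(* Pascal's rule: multiplication by 1 + t lowers N by one and leaves a single boundary term of
   degree M, to be absorbed in the cofactor. *)
have step t : (1 + t) * (\sum_(k < M) 'C(N.+1 + k, N.+1)%:R * (- t) ^+ k) =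
    \sum_(k < M) 'C(N + k, N)%:R * (- t) ^+ k - 'C(N + M, N.+1)%:R * (- t) ^+ M.
  elim: M {q IH} => [|M IH]; first by rewrite !big_ord0 addn0 bin_small// mul0r mulr0 subr0.
  rewrite !big_ord_recr/= mulrDr IH addSn addnS !binS !natrD exprS; ring.
exists (q - (1%:P + 'X) ^+ N.+1 * ((-1) ^+ M * 'C(N + M, N.+1)%:R)%:P) => t.
set S := \sum_(k < M) _.
have -> : (1 + t) ^+ N.+2 * S = (1 + t) ^+ N.+1 * ((1 + t) * S) by rewrite exprS; ring.
rewrite step mulrBr IH hornerD hornerN hornerM horner_exp hornerD hornerX !hornerC.
have -> : (- t) ^+ M = (-1) ^+ M * t ^+ M by exact: exprNn.
ring.
Qed.

Lemma inverse_power_taylor0 N M : exists2 K : R, 0 <= K & forall t, nc t <= 1/2 ->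
  nc ((1 + t) ^- N.+1 - \sum_(k < M) 'C(N + k, N)%:R * (- t) ^+ k) <= K * nc t ^+ M.
Proof.
have [q qE] := binomial_inverse N M.
pose b := \sum_(i < size q) nc q`_i.
have b0 : 0 <= b by apply: sumr_ge0 => i _; exact: nc_ge0.
exists (2 ^+ N.+1 * b) => [|t t2]; first by rewrite mulr_ge0// exprn_ge0.
have t1 : 1 / 2 <= nc (1 + t).
  by have := ncDl 1 t; rewrite nc1; lra.
have t0 : (1 + t) ^+ N.+1 != 0 by rewrite expf_neq0// -nc_gt0; lra.
set S := \sum_(k < M) _ in qE *.
have -> : (1 + t) ^- N.+1 - S = - (t ^+ M * q.[t] / (1 + t) ^+ N.+1).
  apply: (mulfI t0); rewrite mulrBr qE; field.
  by move: t0; rewrite expf_eq0.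
rewrite ncN !ncM ncV !ncX.
have h1 : (nc (1 + t) ^+ N.+1)^-1 <= 2 ^+ N.+1.
  rewrite -[leRHS]invrK lef_pV2 ?posrE ?exprn_gt0 ?invr_gt0 ?exprn_gt0//; last lra.
  by rewrite -exprVn lerXn2r ?nnegrE ?nc_ge0//; lra.
have h2 : nc q.[t] <= b by apply: nc_horner; lra.
have -> : 2 ^+ N.+1 * b * nc t ^+ M = nc t ^+ M * b * 2 ^+ N.+1 by ring.
apply: ler_pM => //; rewrite ?invr_ge0 ?mulr_ge0 ?exprn_ge0 ?nc_ge0//.
by rewrite ler_wpM2l ?exprn_ge0 ?nc_ge0.
Qed.

(** Homogeneity reduces this to x = 1. The constant does not depend on x, which is what permits
    summation over x = c + n and x = c - n. *)
Lemma inverse_power_taylor N M : exists2 K : R, 0 <= K & forall x u, x != 0 ->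
  nc u <= nc x / 2 ->
  nc ((x + u) ^- N.+1 - \sum_(k < M) (-1) ^+ k * 'C(N + k, N)%:R * x ^- (N.+1 + k) * u ^+ k)
  <= K * nc u ^+ M / nc x ^+ (N.+1 + M).
Proof.
have [K K0 H] := inverse_power_taylor0 N M; exists K => // x u x0 ux.
have nx : 0 < nc x by rewrite nc_gt0.
have {}H := H (u / x); have ux2 : nc (u / x) <= 1 / 2 by rewrite ncM ncV ler_pdivrMr//; lra.
have {ux2} := H ux2; rewrite ncM ncV.
have -> : (x + u) ^- N.+1 - \sum_(k < M) (-1) ^+ k * 'C(N + k, N)%:R * x ^- (N.+1 + k) * u ^+ k =
  x ^- N.+1 * ((1 + u / x) ^- N.+1 - \sum_(k < M) 'C(N + k, N)%:R * (- (u / x)) ^+ k).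
  rewrite mulrBr -invfM -exprMn mulrDr mulr1 mulrCA divff// mulr1; congr (_ - _).
  rewrite mulr_sumr; apply: eq_bigr => k _.
  have -> : (- (u / x)) ^+ k = (-1) ^+ k * (u ^+ k * x ^- k).
    by rewrite [LHS]exprNn exprMn exprVn.
  by rewrite exprD invfM; ring.
rewrite ncM ncV ncX => h.
have -> : K * nc u ^+ M / nc x ^+ (N.+1 + M) = (nc x ^+ N.+1)^-1 * (K * (nc u / nc x) ^+ M).
  by rewrite exprD invfM [(nc u / _) ^+ M]exprMn exprVn; ring.
by rewrite ler_wpM2l// invr_ge0 exprn_ge0 ?nc_ge0.
Qed.

(* [tail] is phi without its polar term at 0, so that its value at 0 carries the
   Laurent coefficients of phi at the integers. *)
Definition tailK J N z K : C :=
  \sum_(1 <= n < K) (-1) ^+ (n * deltaII J)%N * ((z + n%:R) ^- N + (z - n%:R) ^- N).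

Definition tail J N z : C := limn (tailK J N z).

Lemma phiE J N z : phi J N z = z ^- N + tail J N z. Proof. by []. Qed.

(** Quantitative form of [away]: the distance grows linearly in n, as domination by 1/n^2
    requires. *)
Definition sep z (d : R) := forall n, (1 <= n)%N ->
  d * n%:R <= nc (z + n%:R) /\ d * n%:R <= nc (z - n%:R).

(** The point 0 is allowed, so that [tail] can be expanded at the pole of [phi] itself. *)
Definition away z := forall n, (1 <= n)%N -> z + n%:R != 0 /\ z - n%:R != 0.

Lemma away_sep z : away z -> exists2 d : R, 0 < d <= 1 & sep z d.
Proof.
move=> zN.
have H n0 : exists2 d : R, 0 < d <= 1 & forall n, (1 <= n < n0)%N ->
    d * n%:R <= nc (z + n%:R) /\ d * n%:R <= nc (z - n%:R).
  elim: n0 => [|n0 [d /andP[d0 d1] IH]].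
    by exists 1 => [|n]; [rewrite ltr01 lexx|rewrite ltn0 andbF].
  have [->|n0N] := posnP n0.
    by exists 1 => [|n /andP[]]; [rewrite ltr01 lexx|case: n].
  have [z1 z2] := zN _ n0N.
  have n0R : 0 < n0%:R :> R by rewrite ltr0n.
  pose e := Num.min d (Num.min (nc (z + n0%:R) / n0%:R) (nc (z - n0%:R) / n0%:R)).
  have ed : e <= d by rewrite /e ge_min lexx.
  have e1 : e <= nc (z + n0%:R) / n0%:R by rewrite /e !ge_min lexx orbT.
  have e2 : e <= nc (z - n0%:R) / n0%:R by rewrite /e !ge_min lexx !orbT.
  exists e.
    by rewrite (le_trans ed)// /e !lt_min d0 !divr_gt0 ?nc_gt0.
  move=> n /andP[n1]; rewrite ltnS leq_eqVlt => /orP[/eqP->|nn0].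
    by rewrite -!ler_pdivlMr.
  have /IH[h1 h2] : (1 <= n < n0)%N by rewrite n1.
  by split; [apply: le_trans h1|apply: le_trans h2]; rewrite ler_wpM2r.
(* From 2|z| on, the triangle inequality gives distance at least n/2; only the finitely many smaller
   n require the minimum taken in [H]. *)
pose n0 := (Num.trunc (2 * nc z)).+1.
have [d /andP[d0 d1] Hd] := H n0.
exists (Num.min d (1 / 2)).
  by rewrite lt_min d0 divr_gt0//= ge_min d1.
move=> n n1; have [nn0|nn0] := ltnP n n0.
  have /Hd[h1 h2] : (1 <= n < n0)%N by rewrite n1.
  by split; [apply: le_trans h1|apply: le_trans h2]; rewrite ler_wpM2r// ge_min lexx.
have zn : 2 * nc z <= n%:R.
  have h : 2 * nc z < n0%:R by rewrite /n0 truncnS_gt.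
  by apply: le_trans (ltW h) _; rewrite ler_nat.
have e2 : Num.min d (1 / 2) * n%:R <= n%:R / 2.
  by rewrite mulrC ler_wpM2l// ge_min div1r lexx orbT.
split; apply: le_trans e2 _.
  by rewrite [z + _]addrC; have := ncDl n%:R z; rewrite nc_nat; lra.
by rewrite ncBC; have := ncBl n%:R z; rewrite nc_nat; lra.
Qed.

Lemma tail_cvg J N z : away z -> tailK J N.+1 z @ \oo --> tail J N.+1 z.
Proof.
move=> zN; have [d /andP[d0 d1] zd] := away_sep zN.
(* The bound adds two cases: for exponent 1 the pair collapses to 2z/((z+n)(z-n)), for larger
   exponents each term is small by itself. *)
apply: (@is_cvg_seriesC_sqr _ _ (2 * nc z / d ^+ 2 + 2 / d ^+ N.+1)) => n n1.
have [h1 h2] := zd _ n1; have [z1 z2] := zN _ n1.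
have n0 : 0 < n%:R :> R by rewrite ltr0n.
have nR : 1 <= n%:R :> R by rewrite ler1n.
have dn : 0 < d * n%:R by rewrite mulr_gt0.
rewrite ncM nc_sign mul1r.
case: N => [|N].
  have -> : (z + n%:R) ^- 1 + (z - n%:R) ^- 1 = 2 * z / ((z + n%:R) * (z - n%:R)).
    by field; rewrite z1 z2.
  rewrite [leRHS]mulrDl; apply: ler_wpDr.
    by rewrite !mulr_ge0// ?invr_ge0 ?exprn_ge0 ?ltW.
  rewrite !ncM nc_nat ncV ncM -!mulrA ler_wpM2l// ler_wpM2l ?nc_ge0//.
  rewrite -invfM lef_pV2 ?posrE ?mulr_gt0 ?nc_gt0 ?exprn_gt0//.
  by rewrite -exprMn expr2 ler_pM// ltW.
have H x : d * n%:R <= nc x -> nc (x ^- N.+2) <= d ^- N.+2 * n%:R ^- 2.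
  move=> hx; have x0 := lt_le_trans dn hx.
  have n2 : 0 < n%:R ^+ 2 :> R := exprn_gt0 2 n0.
  have p1 := exprn_gt0 N.+2 x0; have p2 := mulr_gt0 (exprn_gt0 N.+2 d0) n2.
  rewrite ncV ncX -invfM lef_pV2//.
  apply: le_trans (_ : (d * n%:R) ^+ N.+2 <= _).
    by rewrite exprMn ler_wpM2l ?exprn_ge0 ?(ltW d0)// ler_weXn2l.
  by rewrite lerXn2r ?nnegrE ?nc_ge0// ltW.
apply: le_trans (ncD _ _) _; rewrite [leRHS]mulrDl; apply: ler_wpDl.
  by rewrite !mulr_ge0 ?nc_ge0// ?invr_ge0 ?exprn_ge0 ?ltW.
by have := H _ h1; have := H _ h2; lra.
Qed.

Definition taylor_coef J N k c : C := (-1) ^+ k * 'C(N + k, N)%:R * tail J (N.+1 + k) c.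

(** With at least one Taylor term the error decays in n with exponent N.+1 + M.+1 >= 2, so even for
    N = 0 the two terms of a pair can be bounded separately. The bound is uniform in the length of
    the partial sum and passes to the limit. *)
Lemma tail_taylor J N M c : away c ->
  approx (fun u => tail J N.+1 (c + u)) (\poly_(k < M.+1) taylor_coef J N k c) M.+1.
Proof.
move=> cN; have [d /andP[d0 d1] cd] := away_sep cN.
have [K K0 HK] := inverse_power_taylor N M.+1.
exists (d / 2), (2 * K / d ^+ (N.+1 + M.+1) * 2); split.
- by rewrite divr_gt0.
- by rewrite !mulr_ge0// invr_ge0 ?exprn_ge0// ltW.
move=> u /andP[u0 ud].
have un n : (1 <= n)%N -> nc u <= d * n%:R / 2.
  move=> n1; apply: le_trans (ltW ud) _; rewrite ler_wpM2r//.
  by rewrite ler_peMr ?(ltW d0) ?ler1n.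
have dn n : (1 <= n)%N -> 0 < d * n%:R by move=> n1; rewrite mulr_gt0 ?ltr0n.
have cuN : away (c + u).
  move=> n n1; have [h1 h2] := cd _ n1; have h3 := un _ n1; have h4 := dn _ n1.
  split; rewrite -nc_gt0 addrAC.
    by have := ncDl (c + n%:R) u; lra.
  by have := ncDl (c - n%:R) u; lra.
pose b k : C := (-1) ^+ k * 'C(N + k, N)%:R.
have cv : (fun L => tailK J N.+1 (c + u) L -
    \sum_(k < M.+1) b k * tailK J (N.+1 + k) c L * u ^+ k) @ \oo -->
    tail J N.+1 (c + u) - (\poly_(k < M.+1) taylor_coef J N k c).[u].
  rewrite horner_poly; apply: cvgB; first exact: tail_cvg.
  apply: cvgC_sum => k; apply: cvgMr_tmp; apply: cvgMl_tmp; exact: tail_cvg.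
apply: (cvgC_le cv) => L.
have -> : tailK J N.+1 (c + u) L - \sum_(k < M.+1) b k * tailK J (N.+1 + k) c L * u ^+ k =
  \sum_(1 <= n < L) (-1) ^+ (n * deltaII J) *
   (((c + n%:R + u) ^- N.+1 - \sum_(k < M.+1) b k * (c + n%:R) ^- (N.+1 + k) * u ^+ k) +
    ((c - n%:R + u) ^- N.+1 - \sum_(k < M.+1) b k * (c - n%:R) ^- (N.+1 + k) * u ^+ k)).
  under [in LHS]eq_bigr do rewrite /tailK mulr_sumr mulr_suml.
  rewrite exchange_big /= /tailK -sumrB; apply: eq_bigr => n _.
  rewrite addrACA -opprD -big_split/= mulrBr mulr_sumr -[c + u + _]addrAC -[c + u - _]addrAC.
  by congr (_ - _); apply: eq_bigr => k _; ring.
rewrite mulrAC.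
apply: nc_sum_sqr_le => n n1.
rewrite ncM nc_sign mul1r.
have H x : d * n%:R <= nc x ->
    nc ((x + u) ^- N.+1 - \sum_(k < M.+1) b k * x ^- (N.+1 + k) * u ^+ k) <=
    K / d ^+ (N.+1 + M.+1) * nc u ^+ M.+1 / n%:R ^+ 2.
  move=> hx; have x0 : 0 < nc x by apply: lt_le_trans hx; exact: dn.
  apply: le_trans (HK x u _ _) _; first by rewrite -nc_gt0.
    by have := un _ n1; lra.
  rewrite -!mulrA ler_wpM2l// [leRHS]mulrCA ler_wpM2l ?exprn_ge0 ?nc_ge0//.
  rewrite -invfM lef_pV2 ?posrE ?exprn_gt0 ?mulr_gt0 ?exprn_gt0 ?ltr0n//.
  apply: le_trans (_ : (d * n%:R) ^+ (N.+1 + M.+1) <= _).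
    rewrite exprMn ler_wpM2l ?exprn_ge0 ?(ltW d0)// ler_weXn2l ?ler1n//.
    by rewrite addnS addSn.
  by rewrite lerXn2r ?nnegrE ?nc_ge0// ltW// dn.
have [h1 h2] := cd _ n1.
by apply: le_trans (ncD _ _) _; have := H _ h1; have := H _ h2; lra.
Qed.

End Taylor.

(** * Functional equations *)

Section FunctionalEquations.
Variable R : realType.
Local Notation C := (cplx R).
Implicit Types (z w t u c x : C) (J : label).

Lemma isint_int (k : int) : isint (k%:~R : C). Proof. by exists k. Qed.

Lemma isint_nat (n : nat) : isint (n%:R : C). Proof. by exists n%:Z. Qed.

Lemma isintD z w : isint z -> isint w -> isint (z + w).
Proof. by move=> [k ->] [l ->]; exists (k + l); rewrite intrD. Qed.

Lemma isintN z : isint z -> isint (- z).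
Proof. by move=> [k ->]; exists (- k); rewrite mulrNz. Qed.

Lemma isintM z w : isint z -> isint w -> isint (z * w).
Proof. by move=> [k ->] [l ->]; exists (k * l); rewrite intrM. Qed.

Lemma isintDr z w : isint w -> isint (z + w) <-> isint z.
Proof.
move=> iw; split=> [h|/isintD]; last exact.
by rewrite -(addrK w z); apply: isintD => //; exact: isintN.
Qed.

Lemma nonint_away z : ~ isint z -> away z.
Proof.
move=> zi n n1; split; apply/eqP => h; apply: zi.
  by rewrite -(addrK n%:R z) h sub0r; apply: isintN; exact: isint_nat.
by rewrite -(subrK n%:R z) h add0r; exact: isint_nat.
Qed.

Lemma nonint_neq0 z : ~ isint z -> z != 0.
Proof. by move=> zi; apply/eqP => z0; apply: zi; rewrite z0; exact: (isint_nat 0). Qed.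

Lemma nat_neq0C n : (1 <= n)%N -> (n%:R : C) != 0.
Proof. by move=> n1; rewrite pnatr_eq0 -lt0n. Qed.

Lemma away0 : away (0 : C).
Proof. by move=> n n1; rewrite add0r sub0r oppr_eq0 nat_neq0C. Qed.

Lemma nc_int_ge1 (k : int) : k != 0 -> 1 <= nc (k%:~R : C).
Proof.
case: k => [n|n] k0.
  by rewrite nc_nat ler1n lt0n; exact: k0.
by rewrite NegzE mulrNz ncN nc_nat ler1n.
Qed.

Lemma nonint_near z : exists2 d : R, 0 < d &
  forall u, 0 < nc u < d -> ~ isint (z + u).
Proof.
have int_case z' : isint z' -> exists2 d : R, 0 < d & forall u, 0 < nc u < d -> ~ isint (z' + u).
  move=> z'i; exists 1 => // u /andP[u0 u1]; rewrite addrC isintDr// => -[k uk].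
  move: u0 u1; rewrite uk nc_gt0 intr_eq0 => k0.
  by rewrite ltNge nc_int_ge1.
have [zi|zi] := pselect (isint z); first exact: int_case.
have zA := nonint_away zi; have z0 := nonint_neq0 zi.
have [d /andP[d0 d1] zd] := away_sep zA.
exists (Num.min d (nc z)); first by rewrite lt_min d0 nc_gt0.
move=> u; rewrite lt_min => /and3P[u0 ud uz] [k].
have H n : (1 <= n)%N -> d <= d * n%:R by move=> n1; rewrite ler_peMr ?(ltW d0) ?ler1n.
case: k => [[|n]|n] /eqP.
- rewrite addr_eq0 => /eqP zu; by move: uz; rewrite zu ncN ltxx.
- have [_] := zd n.+1 isT; have := H n.+1 isT.
  rewrite -subr_eq0 => h1 h2 /eqP h3.
  by move: ud; rewrite -(ncN u) -[- u]add0r -h3; rewrite (_ : _ - u = z - n.+1%:R);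
    [lra|rewrite -[_%:~R]/(n.+1%:R); ring].
- have [+ _] := zd n.+1 isT; have := H n.+1 isT.
  rewrite -subr_eq0 NegzE => h1 h2 /eqP h3.
  by move: ud; rewrite -(ncN u) -[- u]add0r -h3; rewrite (_ : _ - u = z + n.+1%:R);
    [lra|rewrite mulrNz -[_%:~R]/(n.+1%:R); ring].
Qed.

(** Symmetric partial sum over the shifts -K, ..., K; [tailK] stops before its bound, hence
    [K.+1]. *)
Definition phiK J N z K : C := z ^- N + tailK J N z K.+1.

Lemma phi_cvg J N z : ~ isint z -> phiK J N.+1 z @ \oo --> phi J N.+1 z.
Proof.
move=> zi; rewrite phiE; apply: cvgD; first exact: cvg_cst.
have := @tail_cvg R J N z (nonint_away zi).
by rewrite -cvg_shiftS.
Qed.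

Lemma phi_taylor J N M z : ~ isint z ->
  approx (fun u => phi J N.+1 (z + u))
   (\poly_(k < M.+1) ((-1) ^+ k * 'C(N + k, N)%:R * phi J (N.+1 + k) z)) M.+1.
Proof.
move=> zi; have zA := nonint_away zi; have z0 := nonint_neq0 zi.
have [K K0 HK] := @inverse_power_taylor R N M.+1.
have h : approx (fun u => (z + u) ^- N.+1)
    (\poly_(k < M.+1) ((-1) ^+ k * 'C(N + k, N)%:R * z ^- (N.+1 + k))) M.+1.
  exists (nc z / 2), (K / nc z ^+ (N.+1 + M.+1)); split.
  - by rewrite divr_gt0// nc_gt0.
  - by rewrite divr_ge0// exprn_ge0// nc_ge0.
  by move=> u /andP[_ uz]; rewrite mulrAC horner_poly; apply: HK => //; exact: ltW.
have := approxD h (tail_taylor J N M zA).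
congr (approx _ _ _); apply/polyP => k; rewrite coefD !coef_poly; case: ifP => _.
  by rewrite /taylor_coef -mulrDr phiE.
by rewrite addr0.
Qed.

Definition sg J : C := (-1) ^+ deltaII J.

Lemma sgX J n : (-1) ^+ (n * deltaII J) = sg J ^+ n.
Proof. by rewrite mulnC exprM. Qed.

Lemma sgM J : sg J * sg J = 1.
Proof. by case: J; rewrite /sg /= ?expr0 ?expr1; ring. Qed.

Lemma cvgC_uniq (v : nat -> C) (a b : C) : v @ \oo --> a -> v @ \oo --> b -> a = b.
Proof. exact: (cvg_unique (@norm_hausdorff _ _)). Qed.

Lemma cvgC0_inv (v : nat -> C) (B : R) :
  (forall n, (1 <= n)%N -> nc (v n) <= B / n%:R) -> v @ \oo --> (0 : C).
Proof.
move=> vB.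
have B0 : 0 <= B by have := vB 1%N isT; rewrite divr1; apply: le_trans (nc_ge0 _).
apply/cvgCP => e e0.
near=> n.
have n1 : (1 <= n)%N by near: n; exact: nbhs_infty_gt.
have hn : B / e < n%:R by near: n; exact: nbhs_infty_gtr.
rewrite subr0; apply: (le_lt_trans (vB n n1)).
by rewrite ltr_pdivrMr ?ltr0n// mulrC -ltr_pdivrMr.
Unshelve. all: by end_near. Qed.

Lemma cvg_invD N z : away z -> (fun n : nat => (z + n%:R) ^- N.+1) @ \oo --> (0 : C).
Proof.
move=> zA; have [d /andP[d0 d1] zd] := away_sep zA.
apply: (@cvgC0_inv _ (d ^- N.+1)) => n n1; have [h _] := zd n n1.
have n0 : 0 < n%:R :> R by rewrite ltr0n.
have x0 : 0 < nc (z + n%:R) by apply: lt_le_trans h; rewrite mulr_gt0.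
rewrite ncV ncX -invfM lef_pV2 ?posrE; last first.
- by apply: mulr_gt0 => //; exact: exprn_gt0.
- exact: exprn_gt0.
apply: le_trans (_ : (d * n%:R) ^+ N.+1 <= _); last first.
  by rewrite lerXn2r ?nnegrE ?nc_ge0// ltW// mulr_gt0.
rewrite exprMn ler_wpM2l ?exprn_ge0 ?(ltW d0)//.
by rewrite -[leLHS]expr1 ler_weXn2l ?ler1n.
Qed.

Lemma cvg_invB N z : away z -> (fun n : nat => (z - n%:R) ^- N.+1) @ \oo --> (0 : C).
Proof.
move=> zA.
have NA : away (- z).
  move=> n n1; have [h1 h2] := zA n n1; split.
    by rewrite addrC -oppr_eq0 opprB.
  by rewrite -opprD oppr_eq0.
have -> : (fun n : nat => (z - n%:R) ^- N.+1) =
    (fun n => (-1) ^+ N.+1 * (- z + n%:R) ^- N.+1).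
  apply/funext => n; rewrite -[z - _]opprK opprB [n%:R - z]addrC [(- (_ + _)) ^+ _]exprNn invfM.
  by rewrite -exprVn invrN1.
rewrite -[0](mulr0 ((-1) ^+ N.+1)); apply: cvgMl_tmp; exact: cvg_invD.
Qed.

Lemma phiK0 J N z : phiK J N z 0 = z ^- N.
Proof. by rewrite /phiK /tailK big_geq// addr0. Qed.

Lemma phiKS J N z K : phiK J N z K.+1 =
  phiK J N z K + sg J ^+ K.+1 * ((z + K.+1%:R) ^- N + (z - K.+1%:R) ^- N).
Proof. by rewrite /phiK /tailK (@big_nat_recr _ _ _ K.+1)//= sgX addrA. Qed.

Lemma cvgC0_sg J (b : nat) (v : nat -> C) :
  v @ \oo --> (0 : C) -> (fun n => sg J ^+ (n + b) * v n) @ \oo --> (0 : C).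
Proof.
move=> /cvgCP h; apply/cvgCP => e e0; near=> n.
by rewrite subr0 ncM -sgX nc_sign mul1r -[v n]subr0; near: n; exact: h.
Unshelve. all: by end_near. Qed.

Lemma cvg_double (v : nat -> C) (l : C) : v @ \oo --> l -> (fun n => v n.*2) @ \oo --> l.
Proof.
move=> h; have hd : double @ \oo --> \oo.
  by apply/cvgnyPge => A; near=> n; rewrite (@leq_trans n)//; [near: n; exact: nbhs_infty_ge|lia].
exact: (@cvg_comp _ _ _ double v _ _ _ hd h).
Unshelve. all: by end_near. Qed.

(** Translating the symmetric partial sum by 1 gains one term at one end and loses one at the other;
    both tend to 0. *)
Lemma phi_shift1 J N z : ~ isint z -> phi J N.+1 (z + 1) = sg J * phi J N.+1 z.
Proof.
move=> zi; have z1i : ~ isint (z + 1) by rewrite isintDr//; exact: (isint_nat 1).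
have E K : phiK J N.+1 (z + 1) K = sg J * (phiK J N.+1 z K +
    (sg J ^+ (K + 1) * (z + 1 + K%:R) ^- N.+1 - sg J ^+ (K + 0) * (z - K%:R) ^- N.+1)).
  elim: K => [|K IH].
    rewrite !phiK0 addr0 subr0 add0n expr1 expr0 mul1r [X in sg J * X]addrC subrK.
    by rewrite mulrA sgM mul1r.
  rewrite !phiKS IH !addn1 !addn0.
  have -> : z + 1 + K.+1%:R = z + K.+2%:R by rewrite -[K.+2%:R]natr1; ring.
  have -> : z + 1 - K.+1%:R = z - K%:R by rewrite -[K.+1%:R]natr1; ring.
  have -> : z + 1 + K%:R = z + K.+1%:R by rewrite -[K.+1%:R]natr1; ring.
  by case: J {IH}; rewrite /sg/= ?expr0 ?expr1 ?expr1n ?[(-1) ^+ _.+1]exprS; ring.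
have h := @phi_cvg J N _ z1i.
apply: (cvgC_uniq h); rewrite (funext E).
apply: cvgMl_tmp; rewrite -[phi J N.+1 z]addr0; apply: cvgD; first exact: phi_cvg.
rewrite -[X in _ --> X]subr0; apply: cvgB; apply: cvgC0_sg.
  by apply: cvg_invD; exact: nonint_away.
by apply: cvg_invB; exact: nonint_away.
Qed.

Lemma phi_shift_nat J N z (k : nat) : ~ isint z ->
  phi J N.+1 (z + k%:R) = sg J ^+ k * phi J N.+1 z.
Proof.
move=> zi; elim: k => [|k IH]; first by rewrite addr0 expr0 mul1r.
rewrite -natr1 addrA phi_shift1 ?IH ?exprS ?mulrA//.
by rewrite isintDr//; exact: isint_nat.
Qed.

Lemma phi_shift J N z (k : int) : ~ isint z ->
  phi J N.+1 (z + k%:~R) = (-1) ^ (k * (deltaII J)%:Z) * phi J N.+1 z.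
Proof.
move=> zi; case: k => k; first by rewrite phi_shift_nat// -sgX -PoszM.
rewrite NegzE mulrNz; set n := k.+1.
have h : ~ isint (z - n%:R) by rewrite isintDr//; apply: isintN; exact: isint_nat.
have := @phi_shift_nat J N _ n h; rewrite subrK => ->.
by rewrite mulNr -PoszM -exprnN -exprVn invrN1 sgX mulrA -exprMn sgM expr1n mul1r.
Qed.

Lemma phiN J N z : ~ isint z -> phi J N.+1 (- z) = (-1) ^+ N.+1 * phi J N.+1 z.
Proof.
move=> zi; have Nzi : ~ isint (- z) by move=> /isintN; rewrite opprK.
have E x : (- x) ^- N.+1 = (-1) ^+ N.+1 * x ^- N.+1 :> C.
  by rewrite [(- x) ^+ _]exprNn invfM -exprVn invrN1.
apply: (cvgC_uniq (@phi_cvg J N _ Nzi)).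
have -> : phiK J N.+1 (- z) = (fun K => (-1) ^+ N.+1 * phiK J N.+1 z K).
  apply/funext; elim=> [|K IH]; first by rewrite !phiK0 E.
  rewrite !phiKS IH -opprD E -[- z + _]opprK opprD opprK E; ring.
by apply: cvgMl_tmp; exact: phi_cvg.
Qed.

Lemma half_nonint z : ~ isint z -> ~ isint (z / 2) /\ ~ isint ((z + 1) / 2).
Proof.
move=> zi; split=> h; apply: zi.
  by rewrite -[z](@divfK _ 2)//; apply: isintM => //; exact: (isint_nat 2).
rewrite -[z](addrK 1) -[z + 1](@divfK _ 2)//; apply: isintD; last first.
  by apply: isintN; exact: (isint_nat 1).
by apply: isintM => //; exact: (isint_nat 2).
Qed.

(** The sum at z/2 runs over z plus the even shifts -2K, ..., 2K, the one at (z+1)/2 over z plus the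
    odd shifts 1-2K, ..., 2K+1. Together they form the symmetric sum of length 2K and one extra
    term, which tends to 0. *)
Lemma phi_dup z : ~ isint z ->
  phi LI 1 (z / 2) + phi LI 1 ((z + 1) / 2) = 2 * phi LI 1 z.
Proof.
move=> zi; have [h1 h2] := half_nonint zi.
have i2 (x : C) : (x / 2) ^- 1 = 2 * x ^- 1 by rewrite !expr1 invfM invrK mulrC.
have E K : phiK LI 1 (z / 2) K + phiK LI 1 ((z + 1) / 2) K =
    2 * (phiK LI 1 z K.*2 + (z + 1 + (K.*2)%:R) ^- 1).
  elim: K => [|K IH]; first by rewrite !phiK0 !i2 addr0; ring.
  rewrite doubleS !phiKS /sg/= expr0 !expr1n !mul1r addrACA IH.
  have e (x : C) n : x / 2 + n%:R = (x + (n.*2)%:R) / 2 by rewrite -muln2 natrM; field.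
  have e' (x : C) n : x / 2 - n%:R = (x - (n.*2)%:R) / 2 by rewrite -muln2 natrM; field.
  rewrite !e !e' !i2 doubleS.
  have -> : z + 1 + K.*2.+2%:R = z + 1 + K.*2%:R + 2 by rewrite -!natr1; ring.
  have -> : z + 1 - K.*2.+2%:R = z - K.*2.+1%:R by rewrite -!natr1; ring.
  have -> : z + 1 + K.*2%:R = z + K.*2.+1%:R by rewrite -!natr1; ring.
  by ring.
have c1 : (fun K => phiK LI 1 (z / 2) K + phiK LI 1 ((z + 1) / 2) K) @ \oo -->
    (phi LI 1 (z / 2) + phi LI 1 ((z + 1) / 2)).
  by apply: cvgD; exact: phi_cvg.
apply: (cvgC_uniq c1); rewrite (funext E).
apply: cvgMl_tmp; rewrite -[phi LI 1 z]addr0; apply: cvgD.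
  by apply: cvg_double; exact: phi_cvg.
apply: (@cvg_double (fun n => (z + 1 + n%:R) ^- 1)); apply: cvg_invD.
by apply: nonint_away; rewrite isintDr//; exact: (isint_nat 1).
Qed.

(** Subtraction gives the odd shifts the sign -1 and so produces the alternating series; this is the
    passage from cotangent to cosecant. *)
Lemma phi_dupB z : ~ isint z ->
  phi LI 1 (z / 2) - phi LI 1 ((z + 1) / 2) = 2 * phi LII 1 z.
Proof.
move=> zi; have [h1 h2] := half_nonint zi.
have i2 (x : C) : (x / 2) ^- 1 = 2 * x ^- 1 by rewrite !expr1 invfM invrK mulrC.
have E K : phiK LI 1 (z / 2) K - phiK LI 1 ((z + 1) / 2) K =
    2 * (phiK LII 1 z K.*2 - (z + 1 + (K.*2)%:R) ^- 1).
  elim: K => [|K IH]; first by rewrite !phiK0 !i2 addr0; ring.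
  rewrite doubleS !phiKS [sg LI]expr0 !expr1n !mul1r opprD addrACA IH.
  have e (x : C) n : x / 2 + n%:R = (x + (n.*2)%:R) / 2 by rewrite -muln2 natrM; field.
  have e' (x : C) n : x / 2 - n%:R = (x - (n.*2)%:R) / 2 by rewrite -muln2 natrM; field.
  rewrite !e !e' !i2 doubleS.
  have -> : z + 1 + K.*2.+2%:R = z + 1 + K.*2%:R + 2 by rewrite -!natr1; ring.
  have -> : z + 1 - K.*2.+2%:R = z - K.*2.+1%:R by rewrite -!natr1; ring.
  have -> : z + 1 + K.*2%:R = z + K.*2.+1%:R by rewrite -!natr1; ring.
  have p : sg LII ^+ K.*2 = 1 by rewrite -mul2n exprM expr2 sgM expr1n.
  have -> : sg LII ^+ K.*2.+1 = -1 by rewrite exprS p mulr1.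
  have -> : sg LII ^+ K.*2.+2 = 1 by rewrite !exprS p mulr1 sgM.
  by ring.
have c1 : (fun K => phiK LI 1 (z / 2) K - phiK LI 1 ((z + 1) / 2) K) @ \oo -->
    (phi LI 1 (z / 2) - phi LI 1 ((z + 1) / 2)).
  by apply: cvgB; exact: phi_cvg.
apply: (cvgC_uniq c1); rewrite (funext E).
apply: cvgMl_tmp; rewrite -[phi LII 1 z]subr0; apply: cvgB.
  by apply: cvg_double; exact: phi_cvg.
apply: (@cvg_double (fun n => (z + 1 + n%:R) ^- 1)); apply: cvg_invD.
by apply: nonint_away; rewrite isintDr//; exact: (isint_nat 1).
Qed.

End FunctionalEquations.

(** * The complex exponential *)

Section Exponential.
Variable R : realType.
Local Notation C := (cplx R).
Implicit Types (x y : R) (z w t u v : C).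

Lemma MVT_from0 (f df : R -> R) y : (forall x, is_derive x 1 f (df x)) -> 0 <= y ->
  exists2 c, 0 <= c <= y & f y - f 0 = df c * y.
Proof.
move=> fd y0; have [] := @MVT_segment R f df 0 y y0 (fun x _ => fd x).
  by apply: derivable_within_continuous => x _; exact: ex_derive.
by move=> c; rewrite in_itv/= subr0 => cy ->; exists c.
Qed.

Lemma sin_ge0_le y : 0 <= y -> `|sin y| <= y.
Proof.
move=> y0; have [c _] := @MVT_from0 sin cos y (fun x => is_derive_sin x) y0.
by rewrite sin0 subr0 => ->; rewrite normrM (ger0_norm y0) ler_piMl ?cos_max.
Qed.

Lemma normr_sin_le y : `|sin y| <= `|y|.
Proof.
case: (leP 0 y) => y0; first by rewrite (ger0_norm y0) sin_ge0_le.
by rewrite -(normrN (sin y)) -sinN (ltr0_norm y0) sin_ge0_le// oppr_ge0 ltW.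
Qed.

Lemma normr_cosB1_le y : `|cos y - 1| <= `|y|.
Proof.
wlog y0 : y / 0 <= y => [H|].
  by case: (leP 0 y) => [/H//|y0]; rewrite -(cosN y) -(normrN y) H// oppr_ge0 ltW.
have [c _] := @MVT_from0 cos (fun x => - sin x) y (fun x => is_derive_cos x) y0.
by rewrite cos0 => ->; rewrite normrM normrN ler_piMl ?sin_max.
Qed.

Lemma normr_sinB_le y : `|sin y - y| <= y ^+ 2.
Proof.
wlog y0 : y / 0 <= y => [H|].
  case: (leP 0 y) => [/H//|y0].
  have := H (- y); rewrite sinN sqrrN opprK -normrN opprD !opprK; apply.
  by rewrite oppr_ge0 ltW.
have d x : is_derive x 1 (fun x => sin x - x) (cos x - 1).
  exact: is_deriveB.
have [c /andP[c0 cy]] := @MVT_from0 _ _ y d y0.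
rewrite sin0 !subr0 => ->; rewrite normrM (ger0_norm y0) expr2 ler_wpM2r//.
by apply: le_trans (normr_cosB1_le c) _; rewrite ger0_norm.
Qed.

Lemma oneB_cos y : 1 - cos y = 2 * sin (y / 2) ^+ 2.
Proof.
have -> : cos y = cos (y / 2 + y / 2) by congr cos; field.
by rewrite cosD; have := cos2Dsin2 (y / 2); lra.
Qed.

Lemma normr_cosB1_le_sqr y : `|cos y - 1| <= y ^+ 2.
Proof.
rewrite distrC oneB_cos ger0_norm; last by rewrite mulr_ge0 ?sqr_ge0.
have : `|sin (y / 2)| ^+ 2 <= `|y / 2| ^+ 2 by rewrite lerXn2r ?nnegrE// normr_sin_le.
by rewrite !real_normK ?num_real// expr_div_n; have := sqr_ge0 y; lra.
Qed.

(** If cos y <= 0, then 1 - cos y >= 1 and y <= pi < 4 give the constant 16. Otherwise 1 - cos y = 2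
    sin(y/2)^2 with sin(y/2) >= (y/2) cos(y/2) and cos(y/2)^2 >= 1/2. *)
Lemma oneB_cos_ge y : 0 <= y <= pi -> y ^+ 2 / 16 <= 1 - cos y.
Proof.
move=> /andP[y0 yp].
have p4 : pi < 4 :> R by have := @pihalf_lt2 R; lra.
case: (leP (cos y) 0) => cy.
  suff : y ^+ 2 <= 16 by lra.
  have -> : 16 = 4 ^+ 2 :> R by lra.
  by rewrite lerXn2r ?nnegrE//; lra.
have y2 : 0 <= y / 2 by lra.
have [c /andP[c0 cy2]] := @MVT_from0 sin cos (y / 2) (fun x => is_derive_sin x) y2.
rewrite sin0 subr0 => sE.
have cc : cos (y / 2) <= cos c.
  move: cy2; rewrite le_eqVlt => /orP[/eqP->//|cy2].
  by apply: ltW; rewrite ltr_cos// in_itv/=; apply/andP; split; lra.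
have c20 : 0 <= cos (y / 2) by apply: cos_ge0_pihalf; apply/andP; split; lra.
have s1 : cos (y / 2) * (y / 2) <= sin (y / 2) by rewrite sE ler_wpM2r.
have s0 : 0 <= cos (y / 2) * (y / 2) by rewrite mulr_ge0.
have : (cos (y / 2) * (y / 2)) ^+ 2 <= sin (y / 2) ^+ 2 by rewrite lerXn2r ?nnegrE//; lra.
have h := oneB_cos y; have h2 := cos2Dsin2 (y / 2).
have c2 : 1 / 2 <= cos (y / 2) ^+ 2 by lra.
rewrite exprMn => h3.
have : 1 / 2 * (y / 2) ^+ 2 <= cos (y / 2) ^+ 2 * (y / 2) ^+ 2 by rewrite ler_wpM2r ?sqr_ge0.
by rewrite expr_div_n in h3 *; have := sqr_ge0 y; lra.
Qed.

Lemma expRB1_bounds x : x <= expR x - 1 <= x * expR x.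
Proof.
have h1 := expR_ge1Dx x; have h2 := expR_ge1Dx (- x); have h3 := expRxMexpNx_1 x.
have e0 := expR_gt0 x; apply/andP; split; first by lra.
have : expR x * (1 - x) <= expR x * expR (- x) by rewrite ler_pM2l.
by rewrite h3; lra.
Qed.

Lemma expR_bounds (X x : R) : `|x| <= X ->
  [/\ expR x <= expR X, expR (- X) <= expR x,
   `|expR x - 1| <= expR X * `|x|, expR (- X) * `|x| <= `|expR x - 1| &
   `|expR x - 1 - x| <= expR X * x ^+ 2].
Proof.
move=> xX; have /andP[h1 h2] := expRB1_bounds x.
have X0 : 0 <= X by apply: le_trans xX.
have xX' : x <= X by apply: le_trans xX; exact: ler_norm.
have Xx : - X <= x by rewrite lerNl; apply: le_trans xX; rewrite -normrN ler_norm.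
have e1 : expR x <= expR X by rewrite ler_expR.
have e2 : expR (- X) <= expR x by rewrite ler_expR.
have e3 : 1 <= expR X by have := expR_ge1Dx X; lra.
have e4 : expR (- X) <= 1 by rewrite -expR0 ler_expR; lra.
have e5 := expR_gt0 (- X); have e6 := expR_gt0 x.
split => //.
- case: (leP 0 x) => x0.
    by rewrite (ger0_norm x0) ger0_norm; nra.
  by rewrite (ltr0_norm x0) ler0_norm; nra.
- case: (leP 0 x) => x0.
    by rewrite (ger0_norm x0) ger0_norm; nra.
  by rewrite (ltr0_norm x0) ler0_norm; nra.
rewrite ger0_norm; last lra.
case: (leP 0 x) => x0; nra.
Qed.

Definition Ec (v : C) : C :=
  (expR (complex.Re v) * cos (complex.Im v)) +i* (expR (complex.Re v) * sin (complex.Im v)).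

Lemma EcD u v : Ec (u + v) = Ec u * Ec v.
Proof.
case: u v => [a b] [c d]; rewrite /Ec /= expRD cosD sinD.
by apply/eqP; rewrite eq_complex/=; apply/andP; split; apply/eqP; ring.
Qed.

Lemma Ec0 : Ec 0 = 1.
Proof. by rewrite /Ec /= expR0 cos0 sin0 mulr1 mulr0. Qed.

Lemma ncE2 (z : C) : nc z ^+ 2 = complex.Re z ^+ 2 + complex.Im z ^+ 2.
Proof. by case: z => a b; rewrite /nc /= sqr_sqrtr// addr_ge0 ?sqr_ge0. Qed.

Lemma nc_Ec v : nc (Ec v) = expR (complex.Re v).
Proof.
apply/eqP; rewrite -(@eqrXn2 _ 2) ?nc_ge0 ?expR_ge0// ncE2 /=; apply/eqP.
by rewrite !exprMn -mulrDr cos2Dsin2 mulr1.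
Qed.

Lemma Ec_neq0 v : Ec v != 0.
Proof. by rewrite -nc_gt0 nc_Ec expR_gt0. Qed.

Lemma EcN v : Ec (- v) = (Ec v)^-1.
Proof.
apply: (mulfI (Ec_neq0 v)); rewrite -EcD subrr Ec0 divff//; exact: Ec_neq0.
Qed.

Lemma EcM_nat v n : Ec (n%:R * v) = Ec v ^+ n.
Proof.
elim: n => [|n IH]; first by rewrite mul0r Ec0 expr0.
by rewrite -natr1 mulrDl mul1r EcD IH exprSr.
Qed.

Lemma Ec_taylor2 X : 0 <= X -> exists2 K : R, 0 <= K & forall v, `|complex.Re v| <= X ->
  nc (Ec v - 1 - v) <= K * nc v ^+ 2.
Proof.
move=> X0; pose e := expR X; exists (4 * e + 1); first by rewrite /e; have := expR_ge0 X; lra.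
move=> [x y] /= /expR_bounds[h1 h2 h3 h4 h5].
have e0 := expR_ge0 x.
rewrite ncE2 /=; apply: le_trans (nc_le_ReIm _) _; rewrite /= !subr0.
have k1 := normr_cosB1_le_sqr y; have k2 := normr_sinB_le y; have k3 := normr_sin_le y.
have a1 : `|expR x * cos y - 1 - x| <= e * x ^+ 2 + e * y ^+ 2.
  have -> : expR x * cos y - 1 - x = (expR x - 1 - x) + expR x * (cos y - 1) by ring.
  apply: le_trans (ler_normD _ _) _; apply: lerD => //.
  by rewrite normrM (ger0_norm e0) ler_pM.
have a2 : `|expR x * sin y - y| <= e * `|x| * `|y| + y ^+ 2.
  have -> : expR x * sin y - y = (expR x - 1) * sin y + (sin y - y) by ring.
  apply: le_trans (ler_normD _ _) _; apply: lerD => //.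
  by rewrite normrM ler_pM.
have a3 : `|x| * `|y| <= x ^+ 2 + y ^+ 2.
  have := sqr_ge0 (`|x| - `|y|); rewrite sqrrB !real_normK ?num_real// -normrM.
  have := sqr_ge0 x; have := sqr_ge0 y; lra.
have ee : 0 <= e := expR_ge0 X.
have a4 : e * `|x| * `|y| <= e * (x ^+ 2 + y ^+ 2) by rewrite -mulrA ler_wpM2l.
have x2 := sqr_ge0 x; have y2 := sqr_ge0 y.
have p1 := mulr_ge0 ee x2; have p2 := mulr_ge0 ee y2.
lra.
Qed.

Lemma Ec_lip X : 0 <= X -> exists2 K : R, 0 <= K & forall v, nc v <= X ->
  nc (Ec v - 1) <= K * nc v.
Proof.
move=> X0; have [K K0 HK] := Ec_taylor2 X0.
exists (1 + K * X) => [|v vX]; first by rewrite addr_ge0 ?mulr_ge0.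
have h := HK v (le_trans (nc_ge_Re v) vX).
rewrite -(subrK v (Ec v - 1)) (le_trans (ncD _ _))// mulrDl mul1r addrC lerD2l.
by rewrite (le_trans h)// expr2 mulrA ler_wpM2r ?nc_ge0// ler_wpM2l.
Qed.

Lemma EcB1_sqr x y : nc (Ec (x +i* y) - 1) ^+ 2 =
  (expR x - 1) ^+ 2 + 2 * expR x * (1 - cos y).
Proof.
rewrite ncE2 /= subr0 exprMn sin2cos2; ring.
Qed.

(** For 0 <= Im v <= pi the only zero of e^v - 1 is v = 0, the others being multiples of 2 i pi. The
    bound comes from |e^(x+iy) - 1|^2 = (e^x - 1)^2 + 2 e^x (1 - cos y), estimating each summand
    from below. *)
Lemma EcB1_ge X : 0 <= X -> exists2 k : R, 0 < k & forall v,
  `|complex.Re v| <= X -> 0 <= complex.Im v <= pi -> k * nc v <= nc (Ec v - 1).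
Proof.
move=> X0; pose e := expR (- X); have e0 : 0 < e := expR_gt0 _.
exists (e / 4) => [|[x y] /= /expR_bounds[h1 h2 h3 h4 h5] yp]; first by lra.
rewrite -(@ler_pXn2r _ 2)// ?nnegrE ?nc_ge0//; last by rewrite mulr_ge0 ?nc_ge0 ?divr_ge0 ?(ltW e0).
rewrite EcB1_sqr [(e / 4 * _) ^+ 2]exprMn ncE2 /=.
have -> : (e / 4) ^+ 2 = e ^+ 2 / 16 by field.
have h6 : (e * `|x|) ^+ 2 <= (expR x - 1) ^+ 2.
  rewrite -[leRHS]real_normK ?num_real// lerXn2r ?nnegrE// mulr_ge0//; exact: ltW.
rewrite exprMn real_normK ?num_real// in h6.
have h7 := oneB_cos_ge yp.
have e1 : e <= 1 by rewrite -expR0 ler_expR; lra.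
have h8 : e * (y ^+ 2 / 16) <= expR x * (1 - cos y).
  by rewrite ler_pM// ?(ltW e0)// divr_ge0// sqr_ge0.
have y2 := sqr_ge0 y; have x2 := sqr_ge0 x.
have e2 : e ^+ 2 <= e by rewrite expr2 ler_piMr// ltW.
have h9 : e ^+ 2 * y ^+ 2 <= e * y ^+ 2 by rewrite ler_wpM2r.
have h10 : 0 <= e ^+ 2 * x ^+ 2 by rewrite mulr_ge0// sqr_ge0.
have h11 : 0 <= e * y ^+ 2 by rewrite mulr_ge0// ltW.
lra.
Qed.

Lemma Ec_eq1 v : Ec v = 1 -> complex.Re v = 0 /\ exists k : int, complex.Im v = k%:~R * (2 * pi).
Proof.
move=> E1; have x0 : complex.Re v = 0.
  by apply: expR_inj; rewrite expR0 -nc_Ec E1 nc1.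
split=> //; case: v x0 E1 => x y /= -> [].
rewrite expR0 !mul1r => cy _.
have p0 := @pi_gt0 R; have pp : 0 < 2 * pi :> R by lra.
(* Reduction modulo 2 pi: the remainder t lies in [0, 2 pi), where 1 - cos t = 2 sin(t/2)^2 vanishes
   only at t = 0. *)
pose k := Num.floor (y / (2 * pi)); exists k.
have /andP[k1 k2] := floor_itv (y / (2 * pi)).
rewrite -/k ler_pdivlMr// in k1; rewrite -/k ltr_pdivrMr// in k2.
rewrite intrD mulrDl mul1r in k2.
pose t := y - k%:~R * (2 * pi).
have ct (j : int) (u : R) : cos (u - j%:~R * (2 * pi)) = cos u :> R.
  have nat_case (n : nat) (w : R) : cos (w + n%:R * (2 * pi)) = cos w :> R.
    rewrite -[RHS](@periodicn _ _ (@cos R) _ (@cosD2pi R) n w).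
    by congr cos; congr (w + _); rewrite mulr_natl mulr_natl.
  case: j => n; first by rewrite -[in RHS](subrK (n%:R * (2 * pi)) u) nat_case.
  by rewrite NegzE mulrNz mulNr opprK nat_case.
have ct1 : cos t = 1 by rewrite /t ct.
have [t0|/eqP tN] := eqVneq t 0; first by apply/eqP; rewrite -subr_eq0 -/t t0.
have : 0 < sin (t / 2).
  apply: sin_gt0_pi; have tpos : 0 < t by rewrite lt_def; apply/andP; split; [apply/eqP|rewrite /t; lra].
  by apply/andP; split; rewrite /t in tpos *; lra.
have := oneB_cos t; rewrite ct1 subrr => /esym/eqP.
by rewrite mulf_eq0 pnatr_eq0/= sqrf_eq0 => /eqP ->; rewrite ltxx.
Qed.

Definition pii : C := 0 +i* pi.

Lemma Ec_pii : Ec pii = -1.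
Proof. by rewrite /Ec /= expR0 cospi sinpi; apply/eqP; rewrite eq_complex/= mulr0 mul1r oppr0 !eqxx. Qed.

Lemma nc_pii : nc pii = pi.
Proof. by rewrite /nc /= expr0n/= add0r sqrtr_sqr ger0_norm// pi_ge0. Qed.

Lemma pii_neq0 : pii != 0.
Proof. by rewrite -nc_gt0 nc_pii pi_gt0. Qed.

Lemma Re_pii z : complex.Re (pii * z) = - pi * complex.Im z.
Proof. by case: z => x y /=; ring. Qed.

Lemma Im_pii z : complex.Im (pii * z) = pi * complex.Re z.
Proof. by case: z => x y /=; ring. Qed.

Lemma Ec_2pii z : Ec (2 * (pii * z)) = Ec (pii * z) ^+ 2.
Proof. exact: EcM_nat. Qed.

Lemma Ec_pii_sqr_neq1 z : ~ isint z -> Ec (pii * z) ^+ 2 != 1.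
Proof.
move=> zi; apply/eqP; rewrite -Ec_2pii => /Ec_eq1[].
have -> : 2 * (pii * z) = pii * (2 * z) by ring.
rewrite Re_pii Im_pii => + [k +]; move=> h2 h1; apply: zi; exists k.
move: h2 h1.
have p0 := @pi_gt0 R.
rewrite Re_mul2 Im_mul2; case: z => x y /= h2 h1.
have y0 : y = 0.
  by move/eqP: h2; rewrite mulNr oppr_eq0 !mulf_eq0 pnatr_eq0/= gt_eqF// => /eqP.
have xk : x = k%:~R.
  apply: (mulfI (lt0r_neq0 p0)); apply: (@mulfI _ 2) => //.
  by rewrite mulrCA h1; ring.
rewrite y0 xk; have -> : (k%:~R : C) = ofR k%:~R by rewrite /ofR rmorph_int.
by [].
Qed.

(** Makes every nonzero root of a denominator in T a value of T at some point, where local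
    boundedness can be used. *)
Lemma Ec_surj (x : C) : x != 0 -> exists z, Ec (pii * z) = x.
Proof.
move=> x0; have nx : 0 < nc x by rewrite nc_gt0.
have [s sE] := expR_total nx.
suff [t tE] : exists t : R, x = (nc x * cos t) +i* (nc x * sin t).
  exists (((s +i* t : C)) / pii); rewrite mulrCA divff ?pii_neq0// mulr1.
  by rewrite /Ec /= sE -tE.
have e2 := ncE2 x.
pose c := complex.Re x / nc x; pose d := complex.Im x / nc x.
have cd : c ^+ 2 + d ^+ 2 = 1.
  by rewrite /c /d !expr_div_n -mulrDl -e2 divff// sqrf_eq0 lt0r_neq0.
have c1 : -1 <= c <= 1.
  have : c ^+ 2 <= 1 by rewrite -cd lerDl sqr_ge0.
  by move=> c2; apply/andP; split; nra.
have [t [t1 t2]] : exists t : R, cos t = c /\ sin t = d.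
  have s1 : sin (acos c) ^+ 2 = d ^+ 2 by rewrite sin2cos2 acosK// -cd; ring.
  have s0 : 0 <= sin (acos c) by apply: sin_ge0_pi; rewrite acos_ge0// acos_lepi.
  have [d0|d0] := leP 0 d.
    exists (acos c); split; first by rewrite acosK.
    by apply/eqP; rewrite -(@eqrXn2 _ 2)// s1.
  exists (- acos c); rewrite cosN sinN acosK//; split => //.
  apply/eqP; rewrite eqr_oppLR -(@eqrXn2 _ 2)// ?oppr_ge0 ?ltW//.
  by rewrite sqrrN s1.
exists t; rewrite t1 t2 /c /d; case: x {e2 x0 s sE cd c1 t1 t2 c d} nx => x y /= nx.
by rewrite !(mulrC (nc _)) !divfK ?lt0r_neq0.
Qed.

End Exponential.

(** * Cotangent and cosecant *)

Section Herglotz.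
Variable R : realType.
Local Notation C := (cplx R).
Implicit Types (z w t u v : C).

(** This is pi cot(pi z), with T = e^(i pi z): i pi (T^2 + 1)/(T^2 - 1). *)
Definition cotE z : C := pii R * (Ec (pii R * z) ^+ 2 + 1) / (Ec (pii R * z) ^+ 2 - 1).

Definition herglotz z : C := phi LI 1 z - cotE z.

Lemma Ec_pii_shift z : Ec (pii R * (z + 1)) = - Ec (pii R * z).
Proof. by rewrite mulrDr mulr1 EcD Ec_pii mulrN1. Qed.

Lemma Ec_piiN z : Ec (pii R * - z) = (Ec (pii R * z))^-1.
Proof. by rewrite mulrN EcN. Qed.

Lemma cotE_shift z : cotE (z + 1) = cotE z.
Proof. by rewrite /cotE Ec_pii_shift sqrrN. Qed.

Lemma EcB1_neq0 z : ~ isint z -> Ec (pii R * z) ^+ 2 - 1 != 0.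
Proof. by move=> zi; rewrite subr_eq0; exact: Ec_pii_sqr_neq1. Qed.

Lemma cotEN z : ~ isint z -> cotE (- z) = - cotE z.
Proof.
move=> zi; rewrite /cotE Ec_piiN; have := EcB1_neq0 zi; have := Ec_neq0 (pii R * z).
move: (Ec _) => T T0 T1.
have T2 : 1 - T ^+ 2 != 0 by rewrite -oppr_eq0 opprB.
by field; rewrite T0 T1 mulN1r T2.
Qed.

Lemma cotE_dup z : ~ isint z -> cotE (z / 2) + cotE ((z + 1) / 2) = 2 * cotE z.
Proof.
move=> zi; have := EcB1_neq0 zi; rewrite /cotE.
have -> : Ec (pii R * ((z + 1) / 2)) ^+ 2 = - Ec (pii R * z).
  by rewrite -Ec_2pii mulrCA [2 * _]mulrC divfK// Ec_pii_shift.
have -> : Ec (pii R * (z / 2)) ^+ 2 = Ec (pii R * z).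
  by rewrite -Ec_2pii mulrCA [2 * _]mulrC divfK.
move: (Ec _) => T T1.
have : (T - 1) * (T + 1) != 0 by rewrite -[_ * _]/(_ * _) (_ : _ * _ = T ^+ 2 - 1)//; ring.
rewrite mulf_eq0 negb_or => /andP[T2 T3].
have T4 : - T - 1 != 0 by rewrite -opprD oppr_eq0.
by field; rewrite T1 T2 T4.
Qed.

Lemma herglotz_shift z : ~ isint z -> herglotz (z + 1) = herglotz z.
Proof. by move=> zi; rewrite /herglotz phi_shift1// cotE_shift /sg/= expr0 mul1r. Qed.

Lemma herglotz_shift_nat z (n : nat) : ~ isint z -> herglotz (z + n%:R) = herglotz z.
Proof.
move=> zi; elim: n => [|n IH]; first by rewrite addr0.
by rewrite -natr1 addrA herglotz_shift ?IH// isintDr//; exact: isint_nat.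
Qed.

Lemma herglotz_shift_int z (k : int) : ~ isint z -> herglotz (z + k%:~R) = herglotz z.
Proof.
move=> zi; case: k => n; first exact: herglotz_shift_nat.
rewrite NegzE mulrNz; set m := n.+1; have h : ~ isint (z - m%:R).
  by rewrite isintDr//; apply: isintN; exact: isint_nat.
by have := @herglotz_shift_nat _ m h; rewrite subrK => ->.
Qed.

Lemma herglotzN z : ~ isint z -> herglotz (- z) = - herglotz z.
Proof.
by move=> zi; rewrite /herglotz phiN// cotEN// expr1; ring.
Qed.

Lemma herglotz_refl z : ~ isint z -> herglotz (1 - z) = - herglotz z.
Proof.
move=> zi; rewrite addrC herglotz_shift ?herglotzN//.
by move=> /isintN; rewrite opprK.
Qed.

Lemma herglotz_dup z : ~ isint z ->
  herglotz (z / 2) + herglotz ((z + 1) / 2) = 2 * herglotz z.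
Proof.
by move=> zi; rewrite /herglotz addrACA phi_dup// -opprD cotE_dup// -mulrBr.
Qed.

Lemma nonint_div z (k N : nat) : (0 < N)%N -> ~ isint z -> ~ isint ((z + k%:R) / N%:R).
Proof.
move=> N0 zi h; apply: zi; rewrite -(addrK k%:R z) -[z + _](@divfK _ N%:R) ?nat_neq0C//.
by apply: isintD; [apply: isintM => //; exact: isint_nat|apply: isintN; exact: isint_nat].
Qed.

Lemma herglotz_average j z : ~ isint z ->
  \sum_(0 <= k < 2 ^ j) herglotz ((z + k%:R) / (2 ^ j)%:R) = (2 ^ j)%:R * herglotz z.
Proof.
move=> zi; elim: j => [|j IH].
  by rewrite expn0 big_nat1 addr0 divr1 mul1r.
have N0 : (0 < 2 ^ j)%N by rewrite expn_gt0.
move: (2 ^ j)%N N0 IH (expnS 2 j) => N N0 IH ->.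
rewrite mul2n -addnn (@big_cat_nat _ _ _ N)//= ?leq_addr//.
(* The indices k and k + N are paired: their points are x/2 and (x+1)/2 for x = (z+k)/N, to which
   [herglotz_dup] applies. *)
have -> : \sum_(N <= k < N + N) herglotz ((z + k%:R) / (N + N)%:R) =
    \sum_(0 <= k < N) herglotz ((z + (k + N)%:R) / (N + N)%:R).
  by rewrite -{1}[N]add0n big_addn addnK.
rewrite -big_split/=.
have -> : (N + N)%:R * herglotz z = 2 * (N%:R * herglotz z) by rewrite natrD; ring.
rewrite -IH mulr_sumr.
apply: eq_bigr => k _; rewrite -herglotz_dup; last exact: nonint_div.
have NN : (N + N)%:R = N%:R * 2 :> C by rewrite addnn -muln2 natrM.
have NC : (N%:R : C) != 0 by rewrite nat_neq0C.
rewrite -[in RHS]mulrA -invfM -NN natrD; congr (_ + herglotz _).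
rewrite -natrD NN natrD; field.
exact: NC.
Qed.

Lemma nc_2piiM z : nc (2 * (pii R * z)) = 2 * pi * nc z.
Proof. by rewrite !ncM nc_nat nc_pii mulrA. Qed.

Lemma tail1_bounded (M : R) : 0 <= M -> exists2 B : R, 0 <= B & forall z, ~ isint z ->
  0 <= complex.Re z <= 1 / 2 -> `|complex.Im z| <= M -> nc (tail LI 1 z) <= B.
Proof.
move=> M0; exists (4 * (1 + M) * 2); first by lra.
move=> z zi /andP[x0 x1] yM; have zA := nonint_away zi.
apply: (cvgC_le (@tail_cvg R LI 0 z zA)) => K; apply: nc_sum_sqr_le => n n1.
have [z1 z2] := zA n n1.
have nR : 1 <= n%:R :> R by rewrite ler1n.
have n0 : 0 < n%:R :> R by rewrite ltr0n.
rewrite muln0 expr0 mul1r.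
have -> : (z + n%:R) ^- 1 + (z - n%:R) ^- 1 = 2 * z / ((z + n%:R) * (z - n%:R)).
  by field; rewrite z1 z2.
have h0 : nc z <= 1 + M.
  by have := nc_le_ReIm z; rewrite (ger0_norm x0); lra.
have h1 : n%:R <= nc (z + n%:R).
  by have := nc_ge_Re (z + n%:R); rewrite ReD Re_nat ger0_norm; lra.
have h2 : n%:R / 2 <= nc (z - n%:R).
  by have := nc_ge_Re (z - n%:R); rewrite ReD ReN Re_nat ler0_norm; lra.
rewrite !ncM nc_nat ncV ncM.
have -> : 4 * (1 + M) / n%:R ^+ 2 = 2 * (1 + M) * (n%:R * (n%:R / 2))^-1 by field; lra.
have p : 0 < n%:R * (n%:R / 2) :> R by rewrite mulr_gt0//; lra.
have q : n%:R * (n%:R / 2) <= nc (z + n%:R) * nc (z - n%:R) by rewrite ler_pM//; lra.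
apply: ler_pM; rewrite ?invr_ge0 ?mulr_ge0 ?nc_ge0//; first by rewrite ler_wpM2l.
by rewrite lef_pV2 ?posrE//; exact: lt_le_trans q.
Qed.

(** With v = 2 i pi z and E = e^v, the difference is i pi (v(E-1) - 2(E-1-v)) / (v(E-1)). The
    numerator is O(|v|^2), and [EcB1_ge] bounds the denominator below by a multiple of |v|^2; Re z
    <= 1/2 is what keeps Im v <= pi. *)
Lemma cotE_bounded (M : R) : 0 <= M -> exists2 B : R, 0 <= B & forall z, ~ isint z ->
  0 <= complex.Re z <= 1 / 2 -> `|complex.Im z| <= M -> nc (cotE z - z^-1) <= B.
Proof.
move=> M0; have p0 := @pi_gt0 R.
pose V := 2 * pi * (1 + M).
have V0 : 0 <= V by rewrite /V !mulr_ge0//; lra.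
have [K K0 HK] := @Ec_taylor2 R V V0.
have [k k0 Hk] := @EcB1_ge R V V0.
exists (pi * (1 + K * V + 2 * K) / k).
  have KV := mulr_ge0 K0 V0; rewrite divr_ge0 ?mulr_ge0//; lra.
move=> z zi /andP[x0 x1] yM.
pose v := 2 * (pii R * z); pose E := Ec v.
have E1 : E - 1 != 0 by rewrite /E /v Ec_2pii; exact: EcB1_neq0.
have z0 := nonint_neq0 zi; have pi0 := pii_neq0 R.
have v0 : v != 0 by rewrite /v !mulf_neq0.
have hz : nc z <= 1 + M by have := nc_le_ReIm z; rewrite (ger0_norm x0); lra.
have nv : nc v <= V by rewrite /v nc_2piiM /V ler_wpM2l//; lra.
have Rv : `|complex.Re v| <= V := le_trans (nc_ge_Re v) nv.
have Iv : 0 <= complex.Im v <= pi.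
  rewrite /v Im_mul2 Im_pii; apply/andP; split; first by rewrite !mulr_ge0// ltW.
  have : pi * complex.Re z <= pi * (1 / 2) by rewrite ler_pM2l.
  by lra.
have h1 := HK v Rv; have h2 := Hk v Rv Iv; rewrite -/E in h1 h2.
have vp : 0 < nc v by rewrite nc_gt0.
have zv : z^-1 = 2 * pii R / v by rewrite /v; field; rewrite z0 pi0.
have cE : cotE z = pii R * (E + 1) / (E - 1) by rewrite /cotE -Ec_2pii.
clearbody E; clearbody v.
have -> : cotE z - z^-1 = pii R * (v * (E - 1) - 2 * (E - 1 - v)) / (v * (E - 1)).
  by rewrite cE zv; field; rewrite v0 E1.
rewrite !ncM ncV ncM nc_pii.
have h3 : nc (E - 1) <= (1 + K * V) * nc v.
  rewrite -(subrK v (E - 1)) (le_trans (ncD _ _))// mulrDl mul1r addrC lerD2l.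
  by rewrite (le_trans h1)// expr2 mulrA ler_wpM2r ?nc_ge0// ler_wpM2l.
have h4 : nc (v * (E - 1) - 2 * (E - 1 - v)) <= (1 + K * V + 2 * K) * nc v ^+ 2.
  have -> : (1 + K * V + 2 * K) * nc v ^+ 2 =
      nc v * ((1 + K * V) * nc v) + 2 * (K * nc v ^+ 2) by ring.
  apply: le_trans (ncB _ _) _; rewrite !ncM nc_nat.
  by apply: lerD; rewrite ler_wpM2l ?nc_ge0.
have kv : 0 < k * nc v by rewrite mulr_gt0.
have -> : pi * (1 + K * V + 2 * K) / k =
    pi * ((1 + K * V + 2 * K) * nc v ^+ 2) * (nc v * (k * nc v))^-1.
  by field; rewrite (lt0r_neq0 vp) (lt0r_neq0 k0).
apply: ler_pM; rewrite ?invr_ge0 ?mulr_ge0 ?nc_ge0 ?(ltW p0)//; first by rewrite ler_pM2l.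
have q : nc v * (k * nc v) <= nc v * nc (E - 1) by rewrite ler_pM2l.
by rewrite lef_pV2 ?posrE ?(lt_le_trans _ q)// mulr_gt0.
Qed.

(** The estimates cover the left half of the strip, where 0 is the only pole and 1/z cancels; the
    reflection z -> 1 - z, under which [herglotz] is odd, gives the right half. *)
Lemma herglotz_bounded (M : R) : 0 <= M -> exists2 B : R, 0 <= B & forall z, ~ isint z ->
  0 <= complex.Re z <= 1 -> `|complex.Im z| <= M -> nc (herglotz z) <= B.
Proof.
move=> M0; have [B B0 HB] := tail1_bounded M0; have [B' B'0 HB'] := cotE_bounded M0.
exists (B + B'); first exact: addr_ge0.
have half z : ~ isint z -> 0 <= complex.Re z <= 1 / 2 -> `|complex.Im z| <= M ->
    nc (herglotz z) <= B + B'.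
  move=> zi zx zy; have -> : herglotz z = tail LI 1 z - (cotE z - z^-1).
    by rewrite /herglotz phiE expr1; ring.
  by apply: le_trans (ncB _ _) _; rewrite lerD ?HB ?HB'.
move=> z zi /andP[x0 x1] zy; have [x2|x2] := leP (complex.Re z) (1 / 2).
  by apply: half => //; rewrite x0.
rewrite -ncN -herglotz_refl//; apply: half.
- move=> /isintN; rewrite opprB => h; apply: zi; rewrite -(subrK 1 z).
  by apply: isintD => //; exact: (isint_nat _ 1).
- by rewrite ReD ReN (Re_nat _ 1); apply/andP; split; lra.
- by rewrite ImD ImN (Im_nat _ 1) add0r normrN.
Qed.

Lemma cotE_lipschitz (M : R) : 0 <= M -> exists2 L : R, 0 <= L & forall a b : C,
  ~ isint a -> ~ isint b ->
  1 / 4 <= complex.Re a <= 3 / 4 -> `|complex.Im a| <= M ->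
  1 / 4 <= complex.Re b <= 3 / 4 -> `|complex.Im b| <= M ->
  nc (cotE a - cotE b) <= L * nc (a - b).
Proof.
move=> M0; have p0 := @pi_gt0 R.
pose V := 2 * pi * (2 + 2 * M).
have V0 : 0 <= V by rewrite /V !mulr_ge0//; lra.
have [K K0 HK] := @Ec_lip R V V0.
exists (pi * 2 * (expR V * (K * (2 * pi)))).
  by rewrite !mulr_ge0 ?expR_ge0//; lra.
move=> a b ai bi ax ay bx yb.
pose E z := Ec (2 * (pii R * z)).
(* Here 2 pi Re z lies in [pi/2, 3 pi/2], so the exponential has nonpositive real part and keeps
   distance at least 1 from 1. *)
have far z : 1 / 4 <= complex.Re z <= 3 / 4 -> 1 <= nc (E z - 1).
  move=> /andP[z1 z2]; have : complex.Re (E z) <= 0.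
    rewrite /E /Ec /= Im_mul2 Im_pii.
    have -> : 2 * (pi * complex.Re z) = (2 * (pi * complex.Re z) - pi) + pi by rewrite subrK.
    rewrite cosDpi mulrN oppr_le0 mulr_ge0 ?expR_ge0//; apply: cos_ge0_pihalf.
    have h1 : pi * (1 / 4) <= pi * complex.Re z by rewrite ler_pM2l.
    have h2 : pi * complex.Re z <= pi * (3 / 4) by rewrite ler_pM2l.
    by apply/andP; split; lra.
  have := nc_ge_Re (E z - 1); rewrite ReD ReN (Re_nat _ 1) => h1 h2.
  by apply: le_trans h1; rewrite ler0_norm; lra.
have h1 := far _ ax; have h2 := far _ bx.
have E1 z : ~ isint z -> E z - 1 != 0 by move=> zi; rewrite /E Ec_2pii; exact: EcB1_neq0.
have cE z : cotE z = pii R * (E z + 1) / (E z - 1) by rewrite /cotE -Ec_2pii.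
have -> : cotE a - cotE b = pii R * 2 * (E b - E a) / ((E a - 1) * (E b - 1)).
  by rewrite !cE; field; rewrite (E1 _ ai) (E1 _ bi).
have dab : nc (b - a) <= 2 + 2 * M.
  apply: le_trans (nc_le_ReIm _) _; rewrite ReD ReN ImD ImN.
  have d1 : `|complex.Re b - complex.Re a| <= 2.
    by move: ax bx => /andP[? ?] /andP[? ?]; rewrite ler_norml; apply/andP; split; lra.
  have d2 : `|complex.Im b - complex.Im a| <= 2 * M.
    by apply: le_trans (ler_normB _ _) _; lra.
  lra.
have hE : nc (E b - E a) <= expR V * (K * (2 * pi)) * nc (a - b).
  have -> : E b - E a = E a * (Ec (2 * (pii R * (b - a))) - 1).
    by rewrite mulrBr mulr1 /E -EcD; congr (Ec _ - _); ring.
  rewrite ncM -mulrA ler_pM ?nc_ge0//.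
    rewrite /E nc_Ec ler_expR Re_mul2 Re_pii.
    apply: le_trans (ler_norm _) _; rewrite !normrM normrN (ger0_norm (ltW p0)) ger0_norm//.
    by rewrite /V -mulrA ler_wpM2l// ler_wpM2l ?(ltW p0)//; lra.
  rewrite (ncBC a) -[leRHS]mulrA -nc_2piiM; apply: HK; rewrite nc_2piiM.
  by rewrite /V ler_wpM2l//; lra.
rewrite !ncM ncV ncM nc_pii nc_nat.
have D1 : 1 <= nc (E a - 1) * nc (E b - 1) by rewrite -[1]mulr1 ler_pM.
apply: le_trans (_ : pi * 2 * nc (E b - E a) <= _).
  by rewrite ler_piMr ?mulr_ge0 ?nc_ge0 ?(ltW p0)// invf_le1// (lt_le_trans _ D1).
by rewrite -[leRHS]mulrA ler_wpM2l// mulr_ge0// ltW.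
Qed.

(** Each difference of inverses is (b - a)/(x y). The constant is 50 = 16 + 2 * (1 + 16): in the
    middle of the strip the distance to 0 is at least 1/4, to -n at least n and to n at least n/4,
    and the inverse squares sum to at most 2. *)
Lemma phi1_lipschitz (a b : C) : ~ isint a -> ~ isint b ->
  1 / 4 <= complex.Re a <= 3 / 4 -> 1 / 4 <= complex.Re b <= 3 / 4 ->
  nc (phi LI 1 a - phi LI 1 b) <= 50 * nc (a - b).
Proof.
move=> ai bi /andP[a1 a2] /andP[b1 b2].
have aA := nonint_away ai; have bA := nonint_away bi.
have a0 := nonint_neq0 ai; have b0 := nonint_neq0 bi.
rewrite !phiE opprD addrACA.
have two (x y : C) (s t : R) : x != 0 -> y != 0 -> 0 < s -> s <= nc x -> s <= nc y -> s ^- 2 = t ->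
    nc ((x * y)^-1) <= t.
  move=> x0 y0 s0 sx sy <-; rewrite ncV ncM lef_pV2 ?posrE ?exprn_gt0//; last first.
    by rewrite mulr_gt0 ?nc_gt0.
  by rewrite expr2 ler_pM// ltW.
have nd : nc (a - b) = nc (b - a) := ncBC a b.
have h1 : nc (a ^- 1 - b ^- 1) <= 16 * nc (a - b).
  have -> : a ^- 1 - b ^- 1 = (b - a) * (a * b)^-1 by field; rewrite a0 b0.
  rewrite ncM mulrC nd ler_wpM2r ?nc_ge0//; apply: (@two _ _ (1 / 4)) => //; last by field.
    by apply: le_trans (nc_ge_Re _); rewrite ger0_norm; lra.
  by apply: le_trans (nc_ge_Re _); rewrite ger0_norm; lra.
suff h2 : nc (tail LI 1 a - tail LI 1 b) <= 34 * nc (a - b).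
  by apply: le_trans (ncD _ _) _; lra.
have cv : (fun K => tailK LI 1 a K - tailK LI 1 b K) @ \oo --> (tail LI 1 a - tail LI 1 b).
  by apply: cvgB; exact: tail_cvg.
apply: (cvgC_le cv) => K; rewrite /tailK -sumrB.
have -> : 34 * nc (a - b) = 17 * nc (a - b) * 2 by ring.
apply: nc_sum_sqr_le => n n1.
have [a3 a4] := aA n n1; have [b3 b4] := bA n n1.
have nR : 1 <= n%:R :> R by rewrite ler1n.
rewrite muln0 expr0 !mul1r.
have -> : (a + n%:R) ^- 1 + (a - n%:R) ^- 1 - ((b + n%:R) ^- 1 + (b - n%:R) ^- 1) =
    (b - a) * (((a + n%:R) * (b + n%:R))^-1 + ((a - n%:R) * (b - n%:R))^-1).
  by field; rewrite a3 a4 b3 b4.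
rewrite ncM nd [leRHS]mulrAC [leRHS]mulrC ler_wpM2l ?nc_ge0//.
apply: le_trans (ncD _ _) _.
have -> : 17 / n%:R ^+ 2 = n%:R ^- 2 + 16 / n%:R ^+ 2 :> R by field; lra.
apply: lerD.
  apply: (@two _ _ n%:R) => //; first lra.
    by apply: le_trans (nc_ge_Re _); rewrite ReD Re_nat ger0_norm; lra.
  by apply: le_trans (nc_ge_Re _); rewrite ReD Re_nat ger0_norm; lra.
apply: (@two _ _ (n%:R / 4)) => //; first lra; last by field; lra.
  by apply: le_trans (nc_ge_Re _); rewrite ReD ReN Re_nat ler0_norm; lra.
by apply: le_trans (nc_ge_Re _); rewrite ReD ReN Re_nat ler0_norm; lra.
Qed.

Lemma herglotz_lipschitz (M : R) : 0 <= M -> exists2 L : R, 0 <= L & forall a b : C,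
  ~ isint a -> ~ isint b ->
  1 / 4 <= complex.Re a <= 3 / 4 -> `|complex.Im a| <= M ->
  1 / 4 <= complex.Re b <= 3 / 4 -> `|complex.Im b| <= M ->
  nc (herglotz a - herglotz b) <= L * nc (a - b).
Proof.
move=> M0; have [L L0 HL] := cotE_lipschitz M0; exists (50 + L); first by lra.
move=> a b ai bi ax ay bx yb.
have -> : herglotz a - herglotz b = (phi LI 1 a - phi LI 1 b) - (cotE a - cotE b).
  by rewrite /herglotz; ring.
by apply: le_trans (ncB _ _) _; rewrite mulrDl lerD ?phi1_lipschitz ?HL.
Qed.

Lemma le_pow2_lim (x y c : R) : 0 <= c -> (forall j, x <= y + c / (2 ^ j)%:R) -> x <= y.
Proof.
move=> c0 H; rewrite leNgt; apply/negP => yx.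
pose j := Num.trunc (c / (x - y)).
have hj : c / (x - y) < j.+1%:R := truncnS_gt _.
have xy : 0 < x - y by lra.
have := H j.+1; apply/negP; rewrite -ltNge -ltrBrDl.
have p : 0 < (2 ^ j.+1)%:R :> R by rewrite ltr0n expn_gt0.
rewrite ltr_pdivrMr// mulrC -ltr_pdivrMr//; apply: lt_trans hj _.
by rewrite ltr_nat ltn_expl.
Qed.

Lemma quarters n N : N = (4 * n)%N ->
  [/\ (n <= N)%N, (n <= 3 * n)%N, (3 * n <= N)%N, (3 * n - n = 2 * n)%N & (N - 3 * n = n)%N].
Proof. by move=> ->; split; lia. Qed.

(* Averaging over N = 2^j translates and pairing z with 1 - z, where herglotz is
   odd, half of the pairs lie in the middle of the strip; there the Lipschitz bound
   makes them of size O(1/N), and only the other half keeps the bound 2 B. *)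
Lemma herglotz_contract (M B : R) : 0 <= M -> 0 <= B ->
  (forall z, ~ isint z -> 0 <= complex.Re z <= 1 -> `|complex.Im z| <= M -> nc (herglotz z) <= B) ->
  forall z, ~ isint z -> 0 <= complex.Re z <= 1 -> `|complex.Im z| <= M -> nc (herglotz z) <= B / 2.
Proof.
move=> M0 B0 HB z zi zx zy; have [L L0 HL] := herglotz_lipschitz M0.
(* The paired points (z+k)/N and (1-z+k)/N differ by (2z-1)/N. *)
pose c := L * nc (2 * z - 1).
have c0 : 0 <= c by rewrite mulr_ge0 ?nc_ge0.
apply: (@le_pow2_lim _ _ c c0) => j.
have wi : ~ isint (1 - z).
  move=> /isintN; rewrite opprB => h; apply: zi; rewrite -(subrK 1 z).
  by apply: isintD => //; exact: (isint_nat _ 1).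
have wx : 0 <= complex.Re (1 - z) <= 1.
  by rewrite ReD ReN (Re_nat _ 1); move: zx => /andP[? ?]; apply/andP; split; lra.
have wy : `|complex.Im (1 - z)| <= M by rewrite ImD ImN (Im_nat _ 1) add0r normrN.
(* N is a multiple of 4, so the indices whose points have real part in [1/4, 3/4] are exactly n <= k
   < 3n, half of all. *)
set n := (2 ^ j)%N; pose N := (2 ^ j.+2)%N.
have n0 : (0 < n)%N by rewrite expn_gt0.
have nN : N = (4 * n)%N by rewrite /N /n !expnS mulnA.
have N0 : (0 < N)%N by rewrite expn_gt0.
pose F k := herglotz ((z + k%:R) / N%:R) - herglotz ((1 - z + k%:R) / N%:R).
have E : N%:R * (2 * herglotz z) = \sum_(0 <= k < N) F k.
  have e1 := herglotz_average j.+2 zi; have e2 := herglotz_average j.+2 wi.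
  rewrite -/N herglotz_refl// in e1 e2.
  by rewrite /F sumrB e1 e2; ring.
clearbody N n.
have nR : 0 < n%:R :> R by rewrite ltr0n.
have NR : N%:R = 4 * n%:R :> R by rewrite nN natrM.
have ReP v k : 0 <= complex.Re v <= 1 ->
    k%:R / N%:R <= complex.Re ((v + k%:R) / N%:R) <= (k%:R + 1) / N%:R.
  move=> /andP[v0 v1]; rewrite Re_divn ReD Re_nat !ler_pM2r ?invr_gt0 ?ltr0n//.
  by apply/andP; split; lra.
have ImP v k : `|complex.Im v| <= M -> `|complex.Im ((v + k%:R) / N%:R)| <= M.
  move=> vM; rewrite Im_divn ImD Im_nat addr0 normrM normfV; apply: le_trans vM.
  rewrite ler_piMr// invf_le1 ?normr_gt0 ?pnatr_eq0 -?lt0n// ger0_norm// ler1n//.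
have crude k : (k < N)%N -> nc (F k) <= 2 * B.
  move=> kN; apply: le_trans (ncB _ _) _.
  have H v : ~ isint v -> 0 <= complex.Re v <= 1 -> `|complex.Im v| <= M ->
      nc (herglotz ((v + k%:R) / N%:R)) <= B.
    move=> vi vx vy; apply: HB; [exact: nonint_div| |exact: ImP].
    have /andP[h1 h2] := ReP v k vx; apply/andP; split.
      by apply: le_trans h1; rewrite divr_ge0.
    apply: le_trans h2 _; rewrite ler_pdivrMr ?ltr0n// mul1r.
    by rewrite natr1 ler_nat.
  by have := H _ zi zx zy; have := H _ wi wx wy; lra.
have fine k : (n <= k < 3 * n)%N -> nc (F k) <= c / N%:R.
  move=> /andP[k1 k2].
  have H v : 0 <= complex.Re v <= 1 -> 1 / 4 <= complex.Re ((v + k%:R) / N%:R) <= 3 / 4.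
    move=> vx; have /andP[h1 h2] := ReP v k vx.
    have k1R : n%:R <= k%:R :> R by rewrite ler_nat.
    have k2R : k%:R + 1 <= 3 * n%:R :> R by rewrite natr1 -natrM ler_nat.
    apply/andP; split.
      by apply: le_trans h1; rewrite ler_pdivlMr ?ltr0n// NR; lra.
    by apply: le_trans h2 _; rewrite ler_pdivrMr ?ltr0n// NR; lra.
  have := HL _ _ (nonint_div (k := k) N0 zi) (nonint_div (k := k) N0 wi)
    (H _ zx) (ImP _ _ zy) (H _ wx) (ImP _ _ wy).
  rewrite -mulrBl ncM ncV nc_nat /c -mulrA.
  by have -> : z + k%:R - (1 - z + k%:R) = 2 * z - 1 by ring.
have S (p q : nat) (b : R) : (p <= q)%N -> (forall k, (p <= k < q)%N -> nc (F k) <= b) ->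
    nc (\sum_(p <= k < q) F k) <= (q - p)%:R * b.
  move=> pq Fb; apply: le_trans (nc_sum _ _ _) _.
  apply: le_trans (ler_sum_nat Fb) _.
  by rewrite sumr_const_nat mulr_natl.
have : nc (N%:R * (2 * herglotz z)) <= n%:R * (2 * B) + 2 * n%:R * (c / N%:R) + n%:R * (2 * B).
  have [q1 q2 q3 q4 q5] := quarters nN.
  rewrite E (@big_cat_nat _ _ _ n)//= (@big_cat_nat _ _ _ (3 * n)%N n)//=.
  apply: le_trans (ncD _ _) _; rewrite -addrA; apply: lerD.
    rewrite -[n in n%:R]subn0; apply: S => // k /andP[_ kn]; apply: crude.
    exact: leq_trans kn q1.
  apply: le_trans (ncD _ _) _; apply: lerD; first by rewrite -natrM -q4; exact: S.
  rewrite -[n in n%:R]q5.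
  by apply: S => [|k /andP[_ kn]]; [exact: q3|exact: crude].
rewrite !ncM !nc_nat NR => h.
have : nc (herglotz z) <= B / 2 + c / (16 * n%:R).
  rewrite -(ler_pM2l (_ : 0 < 8 * n%:R)); last by lra.
  have -> : 8 * n%:R * (B / 2 + c / (16 * n%:R)) =
     n%:R * (2 * B) + 2 * n%:R * (c / (4 * n%:R)) + n%:R * (2 * B) by field; lra.
  lra.
move=> /le_trans; apply; rewrite lerD2l ler_wpM2l// lef_pV2 ?posrE; lra.
Qed.

(** On the rectangle of height |Im w| any bound for [herglotz] can be halved indefinitely, since
    averaging over translates divided by N never increases |Im|; so the value at w is 0. Periodicity
    carries this from the strip to the plane. *)
Lemma phi1_cot z : ~ isint z -> phi LI 1 z = cotE z.
Proof.
have strip_case w : ~ isint w -> 0 <= complex.Re w <= 1 -> herglotz w = 0.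
  move=> wi wx; have M0 : 0 <= `|complex.Im w| by [].
  have [B B0 HB] := herglotz_bounded M0.
  have H j : forall v, ~ isint v -> 0 <= complex.Re v <= 1 -> `|complex.Im v| <= `|complex.Im w| ->
      nc (herglotz v) <= B / (2 ^ j)%:R.
    elim: j => [|j IH]; first by rewrite expn0 divr1.
    have Bj : 0 <= B / (2 ^ j)%:R by rewrite divr_ge0.
    move=> v vi vx vy; have := herglotz_contract M0 Bj IH vi vx vy.
    by rewrite expnS natrM invfM mulrCA mulrC.
  apply/eqP; rewrite -nc_eq0 eq_le nc_ge0 andbT.
  by apply: (@le_pow2_lim _ _ B B0) => j; rewrite add0r; exact: H.
move=> zi; apply/eqP; rewrite -subr_eq0; apply/eqP.
pose k := Num.floor (complex.Re z).
have zk : ~ isint (z - k%:~R) by rewrite isintDr//; apply: isintN; exact: isint_int.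
have := herglotz_shift_int k zk; rewrite subrK => h; rewrite -[LHS]/(herglotz z) h.
apply: strip_case => //.
have /andP[k1 k2] := floor_itv (complex.Re z).
have kE : complex.Re (k%:~R : C) = k%:~R.
  have -> : (k%:~R : C) = ofR k%:~R by rewrite /ofR rmorph_int.
  by [].
rewrite ReD ReN kE; rewrite intrD in k2; apply/andP; split; rewrite /k in k1 k2 *; lra.
Qed.

Lemma phi1_csc z : ~ isint z ->
  phi LII 1 z = 2 * pii R * Ec (pii R * z) / (Ec (pii R * z) ^+ 2 - 1).
Proof.
move=> zi; have [h1 h2] := half_nonint zi.
apply: (@mulfI _ 2); first by rewrite pnatr_eq0.
rewrite -phi_dupB// !phi1_cot//; have := EcB1_neq0 zi; rewrite /cotE.
have -> : Ec (pii R * ((z + 1) / 2)) ^+ 2 = - Ec (pii R * z).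
  by rewrite -Ec_2pii mulrCA [2 * _]mulrC divfK// Ec_pii_shift.
have -> : Ec (pii R * (z / 2)) ^+ 2 = Ec (pii R * z).
  by rewrite -Ec_2pii mulrCA [2 * _]mulrC divfK.
move: (Ec _) => T T1.
have : (T - 1) * (T + 1) != 0 by rewrite (_ : _ * _ = T ^+ 2 - 1)//; ring.
rewrite mulf_eq0 negb_or => /andP[T2 T3].
have T4 : - T - 1 != 0 by rewrite -opprD oppr_eq0.
by field; rewrite T1 T2 T4.
Qed.

End Herglotz.

(** * Rational functions of the exponential *)

Section HigherPhi.
Variable R : realType.
Local Notation C := (cplx R).
Implicit Types (z w t u v : C).
Local Notation i_pi := (pii R).

Lemma approx_Ec (a : C) : approx (fun u => Ec (a * u)) (1 + a *: 'X) 2.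
Proof.
have [->|a0] := eqVneq a 0.
  rewrite scale0r addr0 -polyC1; apply: eq_approx ltr01 _ (approx_cst 1 2) => u _.
  by rewrite mul0r Ec0.
have [K K0 HK] := @Ec_taylor2 R 1 ler01.
have na : 0 < nc a by rewrite nc_gt0.
exists (nc a)^-1, (K * nc a ^+ 2); split; rewrite ?invr_gt0//.
  by rewrite mulr_ge0// exprn_ge0// nc_ge0.
move=> u /andP[u0 ua]; rewrite hornerD hornerZ hornerX hornerC opprD addrA.
rewrite -mulrA -exprMn -ncM; apply: HK; apply: le_trans (nc_ge_Re _) _.
by rewrite ncM mulrC -ler_pdivlMr// div1r ltW.
Qed.

Lemma approx_horner (f : C -> C) (P p : {poly C}) M : approx f P M ->
  approx (fun u => p.[f u]) (p \Po P) M.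
Proof.
move=> fP; elim/poly_ind: p => [|p c IH].
  rewrite comp_poly0 -polyC0; apply: eq_approx ltr01 _ (approx_cst 0 M) => u _.
  by rewrite horner0.
rewrite comp_poly_MXaddC; apply: eq_approx ltr01 _ (approxD (approxM IH fP) (approx_cst c M)) => u _.
by rewrite hornerMXaddC.
Qed.

Lemma coef1_deriv (P : {poly C}) : P`_1 = P^`().[0].
Proof. by rewrite horner_coef0 coef_deriv. Qed.

Lemma coef1_comp (p P : {poly C}) : (p \Po P)`_1 = p^`().[P`_0] * P`_1.
Proof. by rewrite !coef1_deriv deriv_comp hornerM horner_comp !horner_coef0. Qed.

Lemma coef1_mul (P Q : {poly C}) : (P * Q)`_1 = P`_1 * Q`_0 + P`_0 * Q`_1.
Proof. by rewrite !coef1_deriv derivM hornerD !hornerM !horner_coef0. Qed.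

(** The coefficient of u plays the part of the derivative: this is the relation phi_N' = -N
    phi_(N+1) in the form required by [approx_uniq]. *)
Lemma phi_taylor2 J N z : ~ isint z ->
  exists P : {poly C}, [/\ approx (fun u => phi J N.+1 (z + u)) P 2,
   P`_0 = phi J N.+1 z & P`_1 = - N.+1%:R * phi J N.+2 z].
Proof.
move=> zi; eexists; split; first exact: (@phi_taylor R J N 1 z zi).
  by rewrite coef_poly/= addn0 expr0 binn addn0 !mul1r.
by rewrite coef_poly/= expr1 !addn1 binSn mulN1r.
Qed.

(* Compare the coefficients of u in phi(z + u) (A e^(2 i pi u) - 1) = i pi (A e^(2 i pi u) + 1),
   where A = e^(2 i pi z). *)
Lemma phi2I z : ~ isint z -> phi LI 2 z = phi LI 1 z ^+ 2 - i_pi ^+ 2.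
Proof.
move=> zi; have [P [hP P0 P1]] := @phi_taylor2 LI 0 z zi.
pose A := Ec (i_pi * z) ^+ 2; have A1 : A - 1 != 0 := EcB1_neq0 zi.
have hE := approx_Ec (2 * i_pi).
have hA := approxZ A hE.
have [d d0 Hd] := nonint_near z.
have EA u : Ec (i_pi * (z + u)) ^+ 2 = A * Ec (2 * i_pi * u).
  by rewrite /A -!Ec_2pii -EcD; congr Ec; ring.
have L := approxM hP (approxB hA (approx_cst 1 2)).
have Rr := approxZ i_pi (approxD hA (approx_cst 1 2)).
have {L} L : approx (fun u => i_pi * (A * Ec (2 * i_pi * u) + 1))
    (P * (A *: (1 + 2 * i_pi *: 'X) - 1%:P)) 2.
  apply: eq_approx d0 _ L => u ud; have zu := Hd u ud.
  rewrite phi1_cot// /cotE EA divfK//.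
  by have := EcB1_neq0 zu; rewrite EA.
have := approx_uniq L Rr (isT : (1 < 2)%N).
rewrite coef1_mul P0 P1 !(coefD, coefN, coefZ, coefC, coefX, coef1)/=.
have -> : phi LI 1 z = i_pi * (A + 1) / (A - 1) by rewrite phi1_cot.
move=> h; apply: (mulIf A1); apply: oppr_inj.
have -> : - (phi LI 2 z * (A - 1)) = - 1 * phi LI 2 z * (A - 1) by ring.
move: h; rewrite !(mulr0, addr0, mulr1, subr0, oppr0, add0r) => h.
have {}h : - 1 * phi LI 2 z * (A - 1) = i_pi * (A * (2 * i_pi)) - i_pi * (A + 1) / (A - 1) * (A * (2 * i_pi)).
  by rewrite -h; ring.
by rewrite h; field.
Qed.

(** Same comparison as for [phi2I], now in phi(z + u) (A e^(2 i pi u) - 1) = 2 i pi T e^(i pi u),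
    where T = e^(i pi z) and A = T^2. *)
Lemma phi2II z : ~ isint z -> phi LII 2 z = phi LII 1 z * phi LI 1 z.
Proof.
move=> zi; have [P [hP P0 P1]] := @phi_taylor2 LII 0 z zi.
pose T := Ec (i_pi * z); pose A := T ^+ 2; have A1 : A - 1 != 0 := EcB1_neq0 zi.
have hA := approxZ A (approx_Ec (2 * i_pi)).
have hT := approxZ (2 * i_pi * T) (approx_Ec i_pi).
have [d d0 Hd] := nonint_near z.
have ET u : Ec (i_pi * (z + u)) = T * Ec (i_pi * u) by rewrite /T -EcD mulrDr.
have EA u : Ec (i_pi * (z + u)) ^+ 2 = A * Ec (2 * i_pi * u).
  by rewrite /A /T -!Ec_2pii -EcD; congr Ec; ring.
have L := approxM hP (approxB hA (approx_cst 1 2)).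
have {L} L : approx (fun u => 2 * i_pi * T * Ec (i_pi * u))
    (P * (A *: (1 + 2 * i_pi *: 'X) - 1%:P)) 2.
  apply: eq_approx d0 _ L => u ud; have zu := Hd u ud.
  rewrite phi1_csc// EA ET mulrA divfK//.
  by have := EcB1_neq0 zu; rewrite EA.
have := approx_uniq L hT (isT : (1 < 2)%N).
rewrite coef1_mul P0 P1 !(coefD, coefN, coefZ, coefC, coefX, coef1)/=.
have -> : phi LI 1 z = i_pi * (A + 1) / (A - 1) by rewrite phi1_cot.
have -> : phi LII 1 z = 2 * i_pi * T / (A - 1) by rewrite phi1_csc.
rewrite !(mulr0, addr0, mulr1, subr0, oppr0, add0r) => h.
apply: (mulIf A1); apply: oppr_inj.
have {}h : - (phi LII 2 z * (A - 1)) = 2 * i_pi * T * i_pi - 2 * i_pi * T / (A - 1) * (A * (2 * i_pi)).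
  by rewrite -h; ring.
by rewrite h; field.
Qed.

(** The chain rule: if phi_N = f(phi_1), then N phi_(N+1) = f'(phi_1) phi_2, which reproduces the
    factor phi_1^2 - (i pi)^2. This factor is kept visible because it vanishes where phi_1 takes its
    limits at the ends, namely -i pi and i pi. *)
Lemma phiI_poly n : exists p : {poly C}, forall z, ~ isint z ->
  phi LI n.+2 z = p.[phi LI 1 z] * (phi LI 1 z ^+ 2 - i_pi ^+ 2).
Proof.
elim: n => [|n [p IH]].
  by exists 1 => z zi; rewrite hornerC mul1r phi2I.
pose f := p * ('X^2 - (i_pi ^+ 2)%:P).
exists (n.+2%:R^-1 *: f^`()) => z zi.
have [P [hP P0 P1]] := @phi_taylor2 LI n.+1 z zi.
have [Q [hQ Q0 Q1]] := @phi_taylor2 LI 0 z zi.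
have [d d0 Hd] := nonint_near z.
have hf := approx_horner f hQ.
have {}hf : approx (fun u => phi LI n.+2 (z + u)) (f \Po Q) 2.
  apply: eq_approx d0 _ hf => u ud; rewrite IH; last exact: Hd.
  by rewrite /f hornerM hornerD hornerN hornerXn hornerC.
have := approx_uniq hP hf (isT : (1 < 2)%N); rewrite P1 coef1_comp Q0 Q1 phi2I// => h.
have n0 : (n.+2%:R : C) != 0 by rewrite pnatr_eq0.
rewrite hornerZ; apply: (mulfI n0); apply: oppr_inj.
rewrite -mulNr h; move: (_.+2%:R) n0 => k k0; by field.
Qed.

(** The product rule together with phi_2^II = phi_1^II phi_1^I: every differentiation leaves the
    factor phi_1^II in front. *)
Lemma phiII_poly n : exists q : {poly C}, forall z, ~ isint z ->
  phi LII n.+1 z = phi LII 1 z * q.[phi LI 1 z].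
Proof.
elim: n => [|n [q IH]].
  by exists 1 => z zi; rewrite hornerC mulr1.
exists (n.+1%:R^-1 *: (q * 'X + q^`() * ('X^2 - (i_pi ^+ 2)%:P))) => z zi.
have [P [hP P0 P1]] := @phi_taylor2 LII n z zi.
have [Q [hQ Q0 Q1]] := @phi_taylor2 LI 0 z zi.
have [S [hS S0 S1]] := @phi_taylor2 LII 0 z zi.
have [d d0 Hd] := nonint_near z.
have hf := approxM hS (approx_horner q hQ).
have {}hf : approx (fun u => phi LII n.+1 (z + u)) (S * (q \Po Q)) 2.
  by apply: eq_approx d0 _ hf => u ud; rewrite [in RHS]IH//; exact: Hd.
have := approx_uniq hP hf (isT : (1 < 2)%N).
rewrite P1 coef1_mul coef1_comp S0 S1 Q0 Q1 phi2I// phi2II//.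
have -> : (q \Po Q)`_0 = q.[phi LI 1 z] by rewrite -horner_coef0 horner_comp horner_coef0 Q0.
move=> h; have n0 : (n.+1%:R : C) != 0 by rewrite pnatr_eq0.
rewrite hornerZ hornerD !hornerM hornerX hornerD hornerN hornerXn hornerC.
apply: (mulfI n0); apply: oppr_inj.
rewrite -mulNr h; move: (_.+1%:R) n0 => k k0; by field.
Qed.

End HigherPhi.

Section TrigRational.
Variable R : realType.
Local Notation C := (cplx R).
Implicit Types (z w t u v : C) (f g : C -> C).
Local Notation i_pi := (pii R).
Variable dom : C -> Prop.
Local Notation T z := (Ec (i_pi * z)).

(* The degree condition says that f stays bounded as Im z tends to -infinity. *)
Definition trig_rational f := exists P Q : {poly C}, [/\ (size P <= size Q)%N, Q != 0,
  forall z, dom z -> Q.[T z] != 0 & forall z, dom z -> f z * Q.[T z] = P.[T z]].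

Lemma eq_trig_rational f g : (forall z, dom z -> f z = g z) ->
  trig_rational f -> trig_rational g.
Proof.
move=> fg [P [Q [sPQ Q0 Qd fP]]]; exists P, Q; split => // z zd.
by rewrite -fg// fP.
Qed.

Lemma trig_rational_cst c : trig_rational (fun=> c).
Proof.
exists c%:P, 1; split; rewrite ?oner_eq0 ?size_poly1 ?size_polyC ?leq_b1// => z _.
  by rewrite hornerC oner_eq0.
by rewrite !hornerC mulr1.
Qed.

Lemma size_mul_mono (P P' Q Q' : {poly C}) : (size P <= size Q)%N -> (size P' <= size Q')%N ->
  Q != 0 -> Q' != 0 -> (size (P * P')%R <= size (Q * Q')%R)%N.
Proof.
move=> h h' Q0 Q'0; rewrite (size_mul Q0 Q'0).
by apply: leq_trans (size_polyMleq _ _) _; rewrite -!subn1 leq_sub2r// leq_add.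
Qed.

Lemma trig_rationalM f g : trig_rational f -> trig_rational g ->
  trig_rational (fun z => f z * g z).
Proof.
move=> [P [Q [sPQ Q0 Qd fP]]] [P' [Q' [sPQ' Q'0 Q'd gP]]].
exists (P * P'), (Q * Q'); split; first exact: size_mul_mono.
- by rewrite mulf_neq0.
- by move=> z zd; rewrite hornerM mulf_neq0 ?Qd ?Q'd.
- by move=> z zd; rewrite !hornerM mulrACA fP// gP.
Qed.

Lemma trig_rationalD f g : trig_rational f -> trig_rational g ->
  trig_rational (fun z => f z + g z).
Proof.
move=> [P [Q [sPQ Q0 Qd fP]]] [P' [Q' [sPQ' Q'0 Q'd gP]]].
exists (P * Q' + Q * P'), (Q * Q'); split.
- by apply: leq_trans (size_polyD _ _) _; rewrite geq_max !size_mul_mono.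
- by rewrite mulf_neq0.
- by move=> z zd; rewrite hornerM mulf_neq0 ?Qd ?Q'd.
- by move=> z zd; rewrite hornerD !hornerM -fP// -gP//; ring.
Qed.

Lemma trig_rational_prod (I : Type) (s : seq I) (F : I -> C -> C) :
  (forall i, trig_rational (F i)) -> trig_rational (fun z => \prod_(i <- s) F i z).
Proof.
move=> FR; elim: s => [|i s IH].
  by apply: eq_trig_rational (trig_rational_cst 1) => z _; rewrite big_nil.
by apply: eq_trig_rational (trig_rationalM (FR i) IH) => z _; rewrite big_cons.
Qed.

Lemma trig_rational_sum (I : eqType) (s : seq I) (F : I -> C -> C) :
  (forall i, i \in s -> trig_rational (F i)) -> trig_rational (fun z => \sum_(i <- s) F i z).
Proof.
elim: s => [|i s IH] FR.
  by apply: eq_trig_rational (trig_rational_cst 0) => z _; rewrite big_nil.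
have Fi : trig_rational (F i) by apply: FR; rewrite mem_head.
have Fs : trig_rational (fun z => \sum_(i <- s) F i z).
  by apply: IH => j js; apply: FR; rewrite inE js orbT.
by apply: eq_trig_rational (trig_rationalD Fi Fs) => z _; rewrite big_cons.
Qed.

Lemma trig_rational_horner f (p : {poly C}) : trig_rational f ->
  trig_rational (fun z => p.[f z]).
Proof.
move=> fR; elim/poly_ind: p => [|p c IH].
  by apply: eq_trig_rational (trig_rational_cst 0) => z _; rewrite horner0.
apply: eq_trig_rational (trig_rationalD (trig_rationalM IH fR) (trig_rational_cst c)) => z _.
by rewrite hornerMXaddC.
Qed.

Variables (a : nat) (w : C).
Hypothesis a0 : (0 < a)%N.
Hypothesis daw : forall z, dom z -> ~ isint (a%:R * z - w).

Let W := T w.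

(** As a is a natural number, e^(i pi (a z - w)) is a monomial in T z up to a constant; this puts
    all factors into rational functions of the single variable T. *)
Lemma T_affine z : T (a%:R * z - w) = T z ^+ a / W.
Proof.
rewrite /W -EcM_nat -EcN -EcD; congr Ec; ring.
Qed.

Lemma T_affine_neq z : dom z -> T z ^+ (2 * a) - W ^+ 2 != 0.
Proof.
move=> zd; have := EcB1_neq0 (daw zd); rewrite T_affine; apply: contra => /eqP h.
have W0 : W != 0 := Ec_neq0 _.
have h' : T z ^+ a ^+ 2 = W ^+ 2.
  by apply/eqP; rewrite -subr_eq0 -exprM mulnC h.
by rewrite expr_div_n h' divff ?subrr// expf_neq0.
Qed.

Lemma trig_rational_phi1I : trig_rational (fun z => phi LI 1 (a%:R * z - w)).
Proof.
have W0 : W != 0 := Ec_neq0 _.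
exists (i_pi *: ('X^(2 * a) + (W ^+ 2)%:P)), ('X^(2 * a) - (W ^+ 2)%:P).
have sQ : size ('X^(2 * a) - (W ^+ 2)%:P) = (2 * a).+1 by rewrite size_XnsubC// muln_gt0.
split.
- rewrite sQ; apply: leq_trans (size_scale_leq _ _) _; apply: leq_trans (size_polyD _ _) _.
  by rewrite geq_max size_polyXn leqnn size_polyC (leq_trans (leq_b1 _)).
- by rewrite -size_poly_eq0 sQ.
- by move=> z zd; rewrite hornerD hornerN hornerXn hornerC T_affine_neq.
move=> z zd; have := T_affine_neq zd.
rewrite hornerZ !hornerD hornerN hornerXn hornerC => h.
rewrite phi1_cot; last exact: daw.
rewrite /cotE T_affine expr_div_n -exprM (mulnC a).
by field; rewrite W0 mulN1r h.
Qed.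

Lemma trig_rational_phi1II : trig_rational (fun z => phi LII 1 (a%:R * z - w)).
Proof.
have W0 : W != 0 := Ec_neq0 _.
exists ((2 * i_pi * W) *: 'X^a), ('X^(2 * a) - (W ^+ 2)%:P).
have sQ : size ('X^(2 * a) - (W ^+ 2)%:P) = (2 * a).+1 by rewrite size_XnsubC// muln_gt0.
split.
- rewrite sQ; apply: leq_trans (size_scale_leq _ _) _.
  by rewrite size_polyXn ltnS leq_pmull.
- by rewrite -size_poly_eq0 sQ.
- by move=> z zd; rewrite hornerD hornerN hornerXn hornerC T_affine_neq.
move=> z zd; have := T_affine_neq zd.
rewrite hornerZ hornerD hornerN !hornerXn hornerC mulnC exprM => h.
rewrite phi1_csc; last exact: daw.
rewrite T_affine; move: (T z ^+ a) h => t h.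
by field; rewrite W0 mulN1r h.
Qed.

Lemma trig_rational_phi J n : trig_rational (fun z => phi J n.+1 (a%:R * z - w)).
Proof.
case: J.
  case: n => [|n]; first exact: trig_rational_phi1I.
  have [p pE] := @phiI_poly R n.
  pose f := p * ('X^2 - (i_pi ^+ 2)%:P).
  apply: eq_trig_rational (trig_rational_horner f trig_rational_phi1I) => z zd.
  rewrite pE; last exact: daw.
  by rewrite /f hornerM hornerD hornerN hornerXn hornerC.
have [q qE] := @phiII_poly R n.
apply: eq_trig_rational (trig_rationalM trig_rational_phi1II (trig_rational_horner q trig_rational_phi1I)) => z zd.
by rewrite [RHS]qE//; exact: daw.
Qed.

End TrigRational.

(** * Boundedness implies constancy *)

Section Liouville.
Variable R : realType.
Local Notation C := (cplx R).
Implicit Types (z w t u v : C) (f g : C -> C).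
Local Notation i_pi := (pii R).
Local Notation T z := (Ec (i_pi * z)).

Definition iy (y : R) : C := 0 +i* y.

Lemma nc_T_iy y : nc (T (iy y)) = expR (- pi * y).
Proof. by rewrite nc_Ec Re_pii. Qed.

Lemma expRN_lt_inv (e t : R) : 0 < e -> e^-1 <= t -> expR (- t) < e.
Proof.
move=> e0 et; have e1 : 0 < e^-1 by rewrite invr_gt0.
have h1 := expR_ge1Dx t; have h2 := expRxMexpNx_1 t; have h3 := expR_gt0 (- t).
have h4 : e * e^-1 = 1 by rewrite divff// lt0r_neq0.
have h5 : e * e^-1 <= e * t by rewrite ler_pM2l.
have h6 : expR (- t) * (1 + t) <= expR (- t) * expR t by rewrite ler_pM2l.
by nra.
Qed.

Lemma horner_continuous (P : {poly C}) (x : C) (e : R) : 0 < e ->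
  exists2 d : R, 0 < d & forall t, nc (t - x) < d -> nc (P.[t] - P.[x]) <= e.
Proof.
move=> e0; have h := approxP (P \Po (x%:P + 'X)) 1.
have [d d0 Hd] := approx_small h isT e0.
exists d => // t tx; have [->|tn] := eqVneq t x; first by rewrite subrr nc0 ltW.
have := Hd (t - x); rewrite nc_gt0 subr_eq0 tn tx => /(_ isT).
rewrite -horner_coef0 !horner_comp !hornerD !hornerC !hornerX addr0.
by rewrite [x + _]addrC subrK.
Qed.

Variable dom : C -> Prop.

Lemma coprime_part (P Q : {poly C}) : Q != 0 -> (size P <= size Q)%N ->
  exists P' Q' g : {poly C}, [/\ P = P' * g, Q = Q' * g, (size P' <= size Q')%N & coprimep P' Q'].
Proof.
move=> Q0 sPQ; pose g := gcdp P Q.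
have g0 : g != 0 by rewrite gcdp_eq0 (negPf Q0) andbF.
exists (P %/ g), (Q %/ g), g; split.
- by rewrite divpK// dvdp_gcdl.
- by rewrite divpK// dvdp_gcdr.
- by rewrite !size_divp// leq_sub2r.
- by apply: coprimep_div_gcd; rewrite Q0 orbT.
Qed.

(* In lowest terms the denominator has no root e^(i pi z0), by boundedness near
   z0, and does not vanish at 0, by boundedness at +i infinity; so it is constant. *)
Lemma trig_rational_bounded_const f : trig_rational dom f ->
  (forall z0, exists d B : R, 0 < d /\ forall u, 0 < nc u < d -> dom (z0 + u) /\ nc (f (z0 + u)) <= B) ->
  (exists y0 B : R, forall y, y0 <= y -> dom (iy y) /\ nc (f (iy y)) <= B) ->
  exists k, forall z, dom z -> f z = k.
Proof.
move=> [P [Q [sPQ Q0 Qd fPQ]]] floc finf.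
have [P' [Q' [g [PE QE sPQ' cop]]]] := coprime_part Q0 sPQ.
have Q'd z : dom z -> Q'.[T z] != 0.
  by move=> /Qd; rewrite QE hornerM mulf_eq0 negb_or => /andP[].
have fPQ' z : dom z -> f z * Q'.[T z] = P'.[T z].
  move=> zd; have g0 : g.[T z] != 0.
    by have := Qd z zd; rewrite QE hornerM mulf_eq0 negb_or => /andP[].
  by apply: (mulIf g0); rewrite -mulrA -!hornerM -QE -PE fPQ.
(* With a constant denominator the size condition makes the numerator constant as well; this is
   where boundedness at -i infinity enters. *)
have [sQ|sQ] := leqP (size Q') 1.
  have [c cE] : exists c, Q' = c%:P by exists Q'`_0; exact: size1_polyC.
  have [b bE] : exists b, P' = b%:P.
    by exists P'`_0; apply: size1_polyC; exact: leq_trans sPQ' sQ.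
  exists (b / c) => z zd; have := fPQ' z zd; have := Q'd z zd.
  by rewrite cE bE !hornerC => c0 <-; rewrite mulfK.
have /closed_rootP[x /rootP Qx] : size Q' != 1%N by rewrite neq_ltn sQ orbT.
(* If T z comes arbitrarily close to the root x while f z stays bounded, then P'(T z) = f z Q'(T z)
   becomes arbitrarily small, so x is also a root of P', against coprimality. *)
suff [B HB] : exists B : R, forall d : R, 0 < d ->
    exists z, [/\ dom z, nc (f z) <= B & nc (T z - x) < d].
  suff Px : P'.[x] = 0.
    have : root (gcdp P' Q') x by rewrite root_gcd /root Px Qx !eqxx.
    rewrite /root => /eqP gx; move: cop; rewrite coprimep_def => /eqP sg1; have ge := size1_polyC (eq_leq sg1).
    have gn : gcdp P' Q' != 0.
      by rewrite gcdp_eq0 negb_and orbC -size_poly_eq0 -lt0n (ltnW sQ).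
    by move: gx gn; rewrite ge hornerC => ->; rewrite eqxx.
  apply/eqP; rewrite -nc_eq0 eq_le nc_ge0 andbT leNgt; apply/negP => Px.
  have B0 : 0 <= B by have [z [_ + _]] := HB _ ltr01; apply: le_trans (nc_ge0 _).
  (* Chosen so that |P'(x)| <= |P'(T z)| + e <= (1 + B) e = |P'(x)| / 2, a contradiction. *)
  pose e := nc P'.[x] / (2 * (1 + B)).
  have e0 : 0 < e by rewrite divr_gt0//; lra.
  have [d d0 Hd] := horner_continuous P' x e0.
  have [d' d'0 Hd'] := horner_continuous Q' x e0.
  have dd : 0 < Num.min d d' by rewrite lt_min d0.
  have [z [zd fB zx]] := HB _ dd.
  move: zx; rewrite lt_min => /andP[/Hd h1 /Hd' h2].
  rewrite Qx subr0 in h2.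
  have h3 : nc P'.[T z] <= B * e by rewrite -fPQ'// ncM ler_pM ?nc_ge0.
  have h4 := ncBl P'.[x] P'.[T z]; rewrite ncBC in h4.
  have h5 : nc P'.[x] <= (1 + B) * e by lra.
  have h6 : (1 + B) * e = nc P'.[x] / 2 by rewrite /e; field; apply: lt0r_neq0; lra.
  by have := h5; rewrite h6; lra.
have [x0|x0] := eqVneq x 0.
  have [y0 [B HB]] := finf; exists B => d d0.
  pose y := Num.max y0 (d^-1).
  have [yd fB] : dom (iy y) /\ nc (f (iy y)) <= B by apply: HB; rewrite /y le_max lexx.
  exists (iy y); split => //; rewrite x0 subr0 nc_T_iy mulNr; apply: expRN_lt_inv => //.
  have h : d^-1 <= y by rewrite /y le_max lexx orbT.
  have p2 := @pi_ge2 R; have di : 0 < d^-1 by rewrite invr_gt0.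
  by nra.
have [z0 z0E] := Ec_surj x0; have [d0 [B [d00 HB]]] := floc z0.
exists B => d dpos.
have nx : 0 < nc x by rewrite nc_gt0.
have e0 : 0 < d / (2 * nc x) by rewrite divr_gt0// mulr_gt0.
have [d1 d10 Hd1] := approx_small (approx_Ec i_pi) isT e0.
pose m := Num.min d0 d1; have m0 : 0 < m by rewrite lt_min d00.
have m1 : m <= d0 by rewrite ge_min lexx.
have m2 : m <= d1 by rewrite ge_min lexx orbT.
have nm : nc (ofR (m / 2) : C) = m / 2 by rewrite nc_ofR ger0_norm//; lra.
have [|h1 h2] := HB (ofR (m / 2)); first by rewrite nm; apply/andP; split; lra.
exists (z0 + ofR (m / 2)); split => //.
rewrite mulrDr EcD z0E -{2}[x]mulr1 -mulrBr ncM.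
have := Hd1 (ofR (m / 2)); rewrite nm !(coefD, coefZ, coefX, coef1)/= mulr0 addr0 => h3.
have {}h3 : nc (Ec (i_pi * ofR (m / 2)) - 1) <= d / (2 * nc x).
  by apply: h3; apply/andP; split; lra.
apply: (@le_lt_trans _ _ (nc x * (d / (2 * nc x)))); first by rewrite ler_wpM2l ?nc_ge0.
have -> : nc x * (d / (2 * nc x)) = d / 2 by field; exact: lt0r_neq0.
lra.
Qed.

End Liouville.

(** * Limits at the two ends of the imaginary axis *)

Section Limits.
Variable R : realType.
Local Notation C := (cplx R).
Implicit Types (z w t u v : C) (f g : C -> C).
Local Notation i_pi := (pii R).
Local Notation T z := (Ec (i_pi * z)).

Lemma isint_Im0 z : isint z -> complex.Im z = 0.
Proof.
move=> [k ->]; have -> : (k%:~R : C) = ofR k%:~R by rewrite /ofR rmorph_int.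
by [].
Qed.

Lemma Im_iyM (a : nat) y : complex.Im (a%:R * iy y : C) = a%:R * y.
Proof. by rewrite natC Im_ofRM. Qed.

Lemma near_nonint_iy (a : nat) w : (0 < a)%N ->
  \forall y \near +oo, ~ isint (a%:R * iy y - w).
Proof.
move=> a0; near=> y => /isint_Im0; rewrite ImD ImN Im_iyM => h.
have ay : a%:R * y = complex.Im w by lra.
have a0R : 0 < a%:R :> R by rewrite ltr0n.
have : complex.Im w / a%:R < y by near: y; apply: nbhs_pinfty_gt; exact: num_real.
by rewrite ltr_pdivrMr// mulrC ay ltxx.
Unshelve. all: by end_near. Qed.

Lemma T_limit (a : nat) w : (0 < a)%N -> T (a%:R * iy y - w) @[y --> +oo] --> (0 : C).
Proof.
move=> a0; apply/cvgCP => e e0; near=> y.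
rewrite subr0 nc_Ec Re_pii ImD ImN Im_iyM mulNr; apply: expRN_lt_inv => //.
have a1 : 1 <= a%:R :> R by rewrite ler1n.
have ei : 0 < e^-1 by rewrite invr_gt0.
have h : `|complex.Im w| + e^-1 < y by near: y; apply: nbhs_pinfty_gt; exact: num_real.
have h2 := ler_norm (complex.Im w); have h3 := normr_ge0 (complex.Im w).
have p2 := @pi_ge2 R.
have h4 : y <= a%:R * y by rewrite ler_peMl//; lra.
have h5 : 1 * (a%:R * y - complex.Im w) <= pi * (a%:R * y - complex.Im w).
  by apply: ler_wpM2r; lra.
by lra.
Unshelve. all: by end_near. Qed.

Lemma cvgyM (f g : R -> C) (l k : C) : f y @[y --> +oo] --> l -> g y @[y --> +oo] --> k ->
  f y * g y @[y --> +oo] --> l * k.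
Proof. by move=> fl gk; exact: cvgM fl gk. Qed.

Lemma cvgyD (f g : R -> C) (l k : C) : f y @[y --> +oo] --> l -> g y @[y --> +oo] --> k ->
  f y + g y @[y --> +oo] --> l + k.
Proof. by move=> fl gk; exact: cvgD fl gk. Qed.

Lemma cvgy_cst (c : C) : c @[_ --> (+oo : set_system R)] --> c.
Proof. exact: cvg_cst. Qed.

Lemma cvgyV (f : R -> C) (l : C) : l != 0 -> f y @[y --> +oo] --> l ->
  (f y)^-1 @[y --> +oo] --> l^-1.
Proof. by move=> l0 fl; exact: cvgV l0 fl. Qed.

Lemma horner_cvg (p : {poly C}) (f : R -> C) (l : C) :
  f y @[y --> +oo] --> l -> p.[f y] @[y --> +oo] --> p.[l].
Proof.
move=> fl; elim/poly_ind: p => [|p c IH].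
  have -> : (fun y => (0 : {poly C}).[f y]) = cst 0 by apply/funext => y; rewrite horner0.
  by rewrite horner0; exact: cvg_cst.
have -> : (fun y => (p * 'X + c%:P).[f y]) = (fun y => p.[f y] * f y + c).
  by apply/funext => y; rewrite hornerMXaddC.
rewrite hornerMXaddC; exact: cvgyD (cvgyM IH fl) (@cvgy_cst c).
Qed.

Lemma eq_cvgy (f g : R -> C) (l : C) : (\forall y \near +oo, f y = g y) ->
  f y @[y --> +oo] --> l -> g y @[y --> +oo] --> l.
Proof. by move=> fg; apply: cvg_trans; exact: near_eq_cvg. Qed.

Lemma phi1I_limit (a : nat) w : (0 < a)%N ->
  phi LI 1 (a%:R * iy y - w) @[y --> +oo] --> - i_pi.
Proof.
move=> a0; have hT := @T_limit a w a0.
apply: (@eq_cvgy (fun y => i_pi * (T (a%:R * iy y - w) * T (a%:R * iy y - w) + 1) *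
   (T (a%:R * iy y - w) * T (a%:R * iy y - w) - 1)^-1)).
  near=> y; rewrite phi1_cot /cotE ?expr2//; near: y; exact: near_nonint_iy.
have -> : - i_pi = i_pi * (0 * 0 + 1) * (0 * 0 - 1)^-1.
  by rewrite mul0r add0r sub0r invrN1 mulr1 mulrN1.
have den : (0 : C) * 0 - 1 != 0 by rewrite mul0r sub0r oppr_eq0 oner_eq0.
have hD := cvgyV den (cvgyD (cvgyM hT hT) (@cvgy_cst (- 1))).
exact: cvgyM (cvgyM (@cvgy_cst i_pi) (cvgyD (cvgyM hT hT) (@cvgy_cst 1))) hD.
Unshelve. all: by end_near. Qed.

Lemma phi1II_limit (a : nat) w : (0 < a)%N ->
  phi LII 1 (a%:R * iy y - w) @[y --> +oo] --> (0 : C).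
Proof.
move=> a0; have hT := @T_limit a w a0.
apply: (@eq_cvgy (fun y => 2 * i_pi * T (a%:R * iy y - w) *
   (T (a%:R * iy y - w) * T (a%:R * iy y - w) - 1)^-1)).
  near=> y; rewrite phi1_csc ?expr2//; near: y; exact: near_nonint_iy.
have -> : (0 : C) = 2 * i_pi * 0 * (0 * 0 - 1)^-1 by rewrite mulr0 mul0r.
have den : (0 : C) * 0 - 1 != 0 by rewrite mul0r sub0r oppr_eq0 oner_eq0.
have hD := cvgyV den (cvgyD (cvgyM hT hT) (@cvgy_cst (- 1))).
exact: cvgyM (cvgyM (@cvgy_cst (2 * i_pi)) hT) hD.
Unshelve. all: by end_near. Qed.

(** The limit at +i infinity; the one at -i infinity is its opposite. *)
Definition phi_end J (N : nat) : C := if J is LI then - i_pi * (N == 1)%N%:R else 0.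

Lemma phi_limit J n (a : nat) w : (0 < a)%N ->
  phi J n.+1 (a%:R * iy y - w) @[y --> +oo] --> phi_end J n.+1.
Proof.
move=> a0; case: J; rewrite /phi_end.
  case: n => [|n]; first by rewrite mulr1; exact: phi1I_limit.
  rewrite mulr0; have [p pE] := @phiI_poly R n.
  pose f : {poly C} := p * ('X^2 - (i_pi ^+ 2)%:P).
  have -> : (0 : C) = f.[- i_pi].
    by rewrite hornerM hornerD hornerN hornerXn hornerC sqrrN subrr mulr0.
  apply: (eq_cvgy _ (@horner_cvg f _ _ (@phi1I_limit a w a0))).
  near=> y; rewrite pE /f ?hornerM ?hornerD ?hornerN ?hornerXn ?hornerC//.
  by near: y; exact: near_nonint_iy.
have [q qE] := @phiII_poly R n.
rewrite -[0](mul0r q.[- i_pi]).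
apply: (eq_cvgy _ (cvgyM (@phi1II_limit a w a0) (@horner_cvg q _ _ (@phi1I_limit a w a0)))).
by near=> y; rewrite [RHS]qE//; near: y; exact: near_nonint_iy.
Unshelve. all: by end_near. Qed.

Lemma phi_limitN J n (a : nat) w : (0 < a)%N ->
  phi J n.+1 (a%:R * iy (- y) - w) @[y --> +oo] --> - phi_end J n.+1.
Proof.
move=> a0.
(* The parity sign of [phi] may replace -1, since the limit is nonzero only for N = 1, which is
   odd. *)
have -> : - phi_end J n.+1 = (-1) ^+ n.+1 * phi_end J n.+1.
  case: J; rewrite /phi_end ?mulr0 ?oppr0//.
  by case: n => [|n]; rewrite ?mulr0 ?oppr0// expr1 mulN1r.
apply: (@eq_cvgy (fun y => (-1) ^+ n.+1 * phi J n.+1 (a%:R * iy y - (- w)))).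
  near=> y; rewrite -phiN; last by near: y; exact: near_nonint_iy.
  congr (phi _ _ _); rewrite opprK opprD -mulrN; congr (_ * _ - _).
  by rewrite /iy; apply/eqP; rewrite eq_complex/= oppr0 !eqxx.
by apply: cvgMl_tmp; exact: phi_limit.
Unshelve. all: by end_near. Qed.

End Limits.

(** * The value of the tail at 0 in terms of zeta *)

Section Alpha.
Variable R : realType.
Local Notation C := (cplx R).

Lemma cvg_ofR (x : R^nat) (l : R) : x @ \oo --> l -> (fun n => ofR (x n)) @ \oo --> (ofR l : C).
Proof.
move=> /cvgrPdist_lt h; apply/cvgCP => e e0; near=> n.
have -> : ofR (x n) - ofR l = ofR (x n - l) :> C by rewrite /ofR rmorphB.
by rewrite nc_ofR distrC; near: n; exact: h.
Unshelve. all: by end_near. Qed.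

Lemma zeta_cvg mu : (2 <= mu)%N -> (fun K => \sum_(1 <= n < K) (n%:R ^- mu : R)) @ \oo --> zeta R mu.
Proof.
move=> mu2; apply: (@is_cvg_series_sqr _ _ 1) => n n1.
have nR : 1 <= n%:R :> R by rewrite ler1n.
have n0 : 0 < n%:R :> R by rewrite ltr0n.
rewrite ger0_norm ?invr_ge0 ?exprn_ge0// div1r lef_pV2 ?posrE ?exprn_gt0//.
by rewrite ler_weXn2l.
Qed.

Lemma sum_double (F : nat -> R) K : \sum_(1 <= n < (K.*2).+1) (-1) ^+ n * F n =
  2 * (\sum_(1 <= n < K.+1) F n.*2) - \sum_(1 <= n < (K.*2).+1) F n.
Proof.
elim: K => [|K IH]; first by rewrite !big_geq// mulr0 subr0.
rewrite doubleS (@big_nat_recr _ _ _ (K.*2).+2)//= (@big_nat_recr _ _ _ (K.*2).+1)//= IH.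
rewrite (@big_nat_recr _ _ _ K.+1)//= doubleS.
rewrite [X in _ = _ - X](@big_nat_recr _ _ _ (K.*2).+2)//= (@big_nat_recr _ _ _ (K.*2).+1)//=.
have -> : (-1) ^+ (K.*2).+1 = -1 :> R by rewrite -signr_odd /= odd_double.
have -> : (-1) ^+ (K.*2).+2 = 1 :> R by rewrite -signr_odd /= odd_double.
by ring.
Qed.

(** The terms n and -n cancel for odd mu and double for even mu. The alternating sum is twice its
    even-indexed part minus the whole, which gives the factor 2^(1-mu) - 1. *)
Lemma tail0 J mu : (0 < mu)%N -> tail J mu 0 = ofR (alpha R J mu).
Proof.
move=> mu0; have [m mE] : exists m, mu = m.+1 by case: mu mu0 => // m _; exists m.
have tc := @tail_cvg R J m 0 (@away0 R); rewrite -mE in tc.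
have tE K : tailK J mu (0 : C) K =
   \sum_(1 <= n < K) (-1) ^+ (n * deltaII J) * ((1 + (-1) ^+ mu) * n%:R ^- mu).
  apply: eq_bigr => n _; rewrite add0r sub0r [(- n%:R) ^+ mu]exprNn invfM.
  by rewrite -(exprVn (-1)) invrN1; ring.
rewrite /alpha; case: ifP => omu.
  apply: (cvgC_uniq tc).
  have -> : tailK J mu 0 = cst (0 : C).
    apply/funext => K; rewrite tE big1// => n _.
    by rewrite -(signr_odd _ mu) omu expr1 subrr mul0r mulr0.
  exact: cvg_cst.
have sE : (-1) ^+ mu = 1 :> C by rewrite -signr_odd omu.
have tR K : tailK J mu (0 : C) K =
   ofR (2 * \sum_(1 <= n < K) (-1) ^+ (n * deltaII J) * n%:R ^- mu).
  rewrite tE sE mulr_sumr /ofR rmorph_sum; apply: eq_bigr => n _.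
  by rewrite !rmorphM/= fmorphV !rmorphXn/= rmorphN1 !rmorph_nat; ring.
have mu2 : (2 <= mu)%N by move: mu0 omu; case: (mu) => [|[|]].
have zc := zeta_cvg mu2.
case: J tc tE tR => tc tE tR.
  apply: (cvgC_uniq tc); rewrite (funext tR); apply: cvg_ofR; apply: cvgMl_tmp.
  by under eq_fun do under eq_bigr do rewrite muln0 expr0 mul1r; exact: zc.
(* The limit is taken along partial sums ending at the even index 2K, for which [sum_double] splits
   off the even terms. *)
apply: (@cvgC_uniq _ (fun K => tailK LII mu 0 (K.*2).+1)).
  have := @cvg_double R (fun K => tailK LII mu 0 K.+1) (tail LII mu 0).
  by apply; rewrite cvg_shiftS.
have -> : (fun K => tailK LII mu (0 : C) (K.*2).+1) = (fun K =>
    ofR (2 * (2 * 2 ^- mu * (\sum_(1 <= n < K.+1) n%:R ^- mu) - \sum_(1 <= n < (K.*2).+1) n%:R ^- mu))).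
  apply/funext => K; rewrite tR; congr (ofR (2 * _)).
  under eq_bigr do rewrite muln1.
  rewrite (sum_double (fun n => n%:R ^- mu)); congr (_ - _).
  rewrite -mulrA; congr (2 * _); rewrite mulr_sumr.
  by apply: eq_bigr => n _; rewrite -muln2 natrM exprMn invfM mulrC.
apply: cvg_ofR.
have -> : - 2 * (1 - 2 ^ (1 - mu%:Z)) * zeta R mu = 2 * (2 * 2 ^- mu * zeta R mu - zeta R mu).
  have -> : (2 : R) ^ (1 - mu%:Z) = 2 * 2 ^- mu by rewrite expfzDr// expr1z -exprnN.
  by ring.
apply: cvgMl_tmp; apply: cvgB.
  by apply: cvgMl_tmp; have := zc; rewrite -cvg_shiftS.
have zc1 : (fun K => \sum_(1 <= n < K.+1) (n%:R ^- mu : R)) @ \oo --> zeta R mu by have := zc; rewrite -cvg_shiftS.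
have hd : double @ \oo --> \oo.
  by apply/cvgnyPge => A; near=> n; rewrite (@leq_trans n)//; [near: n; exact: nbhs_infty_ge|lia].
exact: (@cvg_comp _ _ _ double (fun K => \sum_(1 <= n < K.+1) (n%:R ^- mu : R)) _ _ _ hd zc1).
Unshelve. all: by end_near. Qed.

End Alpha.

(** * Laurent expansion of the factors *)

Section Local.
Variable R : realType.
Local Notation C := (cplx R).
Implicit Types (z w t u v rho : C) (J : label) (f : C -> C).

Lemma rising_bin m nu : (rising m.+1 nu)%:R / nu`!%:R = 'C(m + nu, m)%:R :> C.
Proof.
have h : (m`! * rising m.+1 nu = (m + nu)`!)%N.
  elim: nu => [|nu IH]; first by rewrite /rising big_ord0 muln1 addn0.
  rewrite /rising big_ord_recr/= -/(rising m.+1 nu) mulnA IH addnS factS mulnC.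
  by rewrite addSn.
have b := @bin_fact (m + nu) m (leq_addr _ _).
have e : (rising m.+1 nu = 'C(m + nu, m) * nu`!)%N.
  apply/eqP; rewrite -(eqn_pmul2l (fact_gt0 m)) h -b addKn; apply/eqP; ring.
by rewrite e natrM mulfK// pnatr_eq0 -lt0n fact_gt0.
Qed.

Lemma toint_int (k : int) : toint (k%:~R : C) = k.
Proof.
rewrite /toint; have -> : (k%:~R : C) = ofR k%:~R by rewrite /ofR rmorph_int.
exact: intrKfloor.
Qed.

Lemma comp_poly_scale n (E : nat -> C) (c : C) :
  (\poly_(k < n) E k) \Po (c *: 'X) = \poly_(k < n) (c ^+ k * E k).
Proof.
rewrite !poly_def raddf_sum; apply: eq_bigr => i _ /=.
by rewrite comp_polyZ comp_Xn_poly exprZn scalerA mulrC.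
Qed.

(* The coefficient of the polar term of a factor: the factor is (polar + u^m (Taylor
   polynomial with coefficients coefA)) / u^m near rho. *)
Definition polar J (a : nat) w rho : C :=
  if `[< isint (a%:R * rho - w) >] then sgnpow (a%:R * rho - w) (deltaII J) else 0.

(** If a rho - w is not an integer, this is the Taylor expansion of [phi]. If it is an integer k,
    the shift formula moves the argument to a u at the cost of the sign s, and [phi] splits into its
    polar term and the Taylor expansion of [tail] at 0. *)
Lemma factor_approx J a m w rho S : (0 < a)%N -> (0 < m)%N ->
  approx (fun u => u ^+ m * (a%:R ^+ m * phi J m (a%:R * (rho + u) - w)))
    ((polar J a w rho)%:P + 'X^m * \poly_(nu < S.+1) coefA J nu rho a m w) S.+1.
Proof.
case: m => // m a0 _; have aC : (a%:R : C) != 0 := nat_neq0C R a0.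
have arg u : a%:R * (rho + u) - w = (a%:R * rho - w) + a%:R * u by ring.
rewrite /polar; case: asboolP => ci; last first.
  rewrite polyC0 add0r.
  have h := approxZ (a%:R ^+ m.+1) (approx_scale aC (@phi_taylor R J m S _ ci)).
  have {}h := approxW (leq_addl m.+1 S.+1) (approx_mulX m.+1 h).
  have -> : \poly_(nu < S.+1) coefA J nu rho a m.+1 w = a%:R ^+ m.+1 *:
      ((\poly_(k < S.+1) ((-1) ^+ k * 'C(m + k, m)%:R * phi J (m.+1 + k) (a%:R * rho - w))) \Po (a%:R *: 'X)).
    rewrite comp_poly_scale; apply/polyP => k; rewrite coefZ !coef_poly.
    case: ifP => _; last by rewrite mulr0.
    rewrite /coefA; case: asboolP => // _.
    by rewrite rising_bin exprD; ring.
  by apply: eq_approx ltr01 _ h => u _; rewrite arg.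
have [k ck] := ci.
rewrite ck.
have [d d0 Hd] := nonint_near (0 : C).
pose s := sgnpow (k%:~R : C) (deltaII J).
have sE : s = (-1) ^ (k * (deltaII J)%:Z) by rewrite /s /sgnpow toint_int.
have h := approxZ (s * a%:R ^+ m.+1) (approx_scale aC (@tail_taylor R J m S _ (@away0 R))).
have {}h := approxD (approx_cst s _) (approxW (leq_addl m.+1 S.+1) (approx_mulX m.+1 h)).
have -> : \poly_(nu < S.+1) coefA J nu rho a m.+1 w = (s * a%:R ^+ m.+1) *:
    ((\poly_(k < S.+1) taylor_coef J m k (0 : C)) \Po (a%:R *: 'X)).
  rewrite comp_poly_scale; apply/polyP => nu; rewrite coefZ !coef_poly.
  case: ifP => _; last by rewrite mulr0.
  rewrite /coefA /sgnJ; case: asboolP => // _; rewrite ck -/s /taylor_coef tail0//.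
  have -> : (m.+1 + nu - 1)%N = (m + nu)%N by rewrite addSn subn1.
  have -> : (m.+1 - 1)%N = m by rewrite subn1.
  rewrite exprD.
  (* [coefA] carries (-1)^m where the Taylor coefficient has (-1)^nu; the two agree unless m + nu is
     odd, and then [alpha] is 0. *)
  have e : (-1) ^+ m.+1 * ofR (alpha R J (m.+1 + nu)) = (-1) ^+ nu * ofR (alpha R J (m.+1 + nu)).
    rewrite /alpha; case: ifP => o; first by rewrite /ofR !mulr0.
    have -> : (-1) ^+ m.+1 = (-1) ^+ nu :> C; last by [].
    rewrite -(signr_odd _ m.+1) -(signr_odd _ nu); congr (_ ^+ _).
    by move: o; rewrite /= oddD; case: (odd m); case: (odd nu).
  transitivity (s * a%:R ^+ m.+1 * a%:R ^+ nu * 'C(m + nu, m)%:R * ((-1) ^+ m.+1 * ofR (alpha R J (m.+1 + nu)))).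
    by ring.
  by rewrite e; ring.
have na : 0 < nc (a%:R : C) by rewrite nc_gt0.
have da : 0 < d / nc (a%:R : C) by rewrite divr_gt0.
apply: eq_approx da _ h => u /andP[u0 ud].
have aui : ~ isint (a%:R * u).
  have := Hd (a%:R * u); rewrite add0r; apply.
  by rewrite ncM mulr_gt0//= mulrC -ltr_pdivlMr.
have un : u != 0 by rewrite -nc_gt0.
rewrite arg ck [k%:~R + _]addrC phi_shift// -sE phiE !add0r.
have -> : (a%:R * u) ^- m.+1 = (a%:R ^+ m.+1 * u ^+ m.+1)^-1 by rewrite exprMn.
have aM : (a%:R : C) ^+ m.+1 != 0 by rewrite expf_neq0.
have uM : u ^+ m.+1 != 0 by rewrite expf_neq0.
move: (a%:R ^+ m.+1) (u ^+ m.+1) aM uM => x y x0 y0.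
by field; rewrite x0 y0.
Qed.

Lemma dnbhsC rho (P : C -> Prop) (d : R) : 0 < d ->
  (forall u, 0 < nc u < d -> P (rho + u)) -> \forall z \near rho^', P z.
Proof.
move=> d0 H; rewrite /dnbhs /within; apply/nbhs_ballP; exists (ofR d).
  by rewrite /= /ofR ltcR.
move=> z /=; rewrite -ball_normE /= ncE ncBC /ofR ltcR => zd zr.
rewrite -[z](subrK rho) addrC; apply: H.
by rewrite zd nc_gt0 subr_eq0 zr.
Qed.

(** The lowest nonzero coefficient, of index i < S, dominates: |f(rho + u)| is at least a constant
    times |u|^(i-S), hence tends to infinity. *)
Lemma is_pole_of_coef f rho (P : {poly C}) S :
  approx (fun u => u ^+ S * f (rho + u)) P S.+1 ->
  (exists2 i, (i < S)%N & P`_i != 0) -> is_pole f rho.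
Proof.
move=> h [i0 i0S Pi0].
have [i Pi imin] : exists2 i, P`_i != 0 & forall j, P`_j != 0 -> (i <= j)%N.
  have ex : exists i, P`_i != 0 by exists i0.
  by exists (ex_minn ex); case: ex_minnP.
have iS : (i < S)%N := leq_ltn_trans (imin _ Pi0) i0S.
have PE : P = 'X^i * drop_poly i P.
  rewrite -[LHS](poly_take_drop i) [take_poly i P](_ : _ = 0) ?add0r 1?mulrC//.
  apply/polyP => j; rewrite coef_take_poly coef0; case: ifP => // ji.
  by apply/eqP; apply: contraTT ji => /imin; rewrite -leqNgt.
set Q := drop_poly i P in PE.
have Q0 : Q`_0 = P`_i by rewrite coef_drop_poly add0n.
pose q := nc Q`_0; have q0 : 0 < q by rewrite nc_gt0 Q0.
have [d [B [d0 B0 hP]]] := h.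
have q2 : 0 < q / 2 by rewrite divr_gt0.
have [d' d'0 hQ] := approx_small (approxP Q 1) isT q2.
apply/cvgryPge => A.
(* With q the modulus of the lowest coefficient, the polynomial part keeps modulus q/2 and the error
   takes at most q/4 of it. Hence |u| |f| >= q/4, and the last bound on |u| turns this into |f| >=
   |A|. *)
pose e := Num.min (Num.min d d') (Num.min 1 (Num.min (q / (4 * (B + 1))) (q / (4 * (`|A| + 1))))).
have B1 : 0 < B + 1 by lra.
have A1 : 0 < `|A| + 1 by have := normr_ge0 A; lra.
apply: (@dnbhsC _ _ e).
  by rewrite /e !lt_min d0 d'0 ltr01 !divr_gt0// mulr_gt0.
move=> u; rewrite /e !lt_min => /and3P[u0 /andP[ud ud'] /and3P[u1 uB uA]].
have h1 := hP u; rewrite u0 ud in h1; have {}h1 := h1 isT.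
have h2 := hQ u; rewrite u0 ud' in h2; have {}h2 := h2 isT.
change (A <= nc (f (rho + u))).
set F := f (rho + u) in h1 *.
rewrite PE hornerM hornerXn in h1.
have ui0 : 0 < nc u ^+ i by rewrite exprn_gt0.
have h3 : q / 2 <= nc Q.[u].
  have := ncBl Q`_0 Q.[u]; rewrite ncBC => h3.
  by rewrite -/q in h3; lra.
have h4 : nc (u ^+ i * Q.[u]) - nc (u ^+ S * F) <= nc (u ^+ S * F - u ^+ i * Q.[u]).
  by rewrite [leRHS]ncBC; exact: ncBl.
have uS : nc u ^+ S.+1 <= nc u ^+ i * nc u.
  by rewrite -exprSr ler_wiXn2l ?nc_ge0 ?(ltW u1)// leqW.
have h5 : B * nc u ^+ S.+1 <= nc u ^+ i * (q / 4).
  apply: le_trans (_ : B * (nc u ^+ i * nc u) <= _); first by rewrite ler_wpM2l.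
  rewrite mulrCA ler_pM2l//.
  have := uB; rewrite ltr_pdivlMr ?mulr_gt0// => {}uB.
  by have := mulr_ge0 B0 (ltW u0); lra.
rewrite !ncM !ncX in h4 h1.
have h6 : nc u ^+ i * (q / 4) <= nc u ^+ S * nc F.
  have : nc u ^+ i * (q / 2) <= nc u ^+ i * nc Q.[u] by rewrite ler_pM2l.
  by lra.
have uS1 : nc u ^+ S <= nc u ^+ i * nc u.
  by rewrite -exprSr ler_wiXn2l ?nc_ge0 ?(ltW u1).
have h7 : nc u ^+ i * (q / 4) <= nc u ^+ i * (nc u * nc F).
  by apply: le_trans h6 _; rewrite mulrA ler_wpM2r ?nc_ge0.
rewrite ler_pM2l// in h7.
have h8 : `|A| * nc u <= q / 4.
  by have := uA; rewrite ltr_pdivlMr ?mulr_gt0//; lra.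
have h9 : nc u * `|A| <= nc u * nc F by lra.
rewrite ler_pM2l// in h9.
by apply: le_trans h9; exact: ler_norm.
Qed.

(** Always at 0, applied to translates; the value at 0 is excluded because it is meaningless at a
    pole. *)
Definition locally_bounded f := exists d B : R, 0 < d /\ forall u, 0 < nc u < d -> nc (f u) <= B.

Lemma eq_locally_bounded f g (d : R) : 0 < d -> (forall u, 0 < nc u < d -> f u = g u) ->
  locally_bounded f -> locally_bounded g.
Proof.
move=> d0 fg [d' [B [d'0 fB]]]; exists (Num.min d d'), B; split; first by rewrite lt_min d0.
by move=> u; rewrite lt_min => /and3P[u0 ud ud']; rewrite -fg ?fB ?u0.
Qed.

Lemma locally_bounded_cst c : locally_bounded (fun=> c).
Proof. by exists 1, (nc c). Qed.

Lemma locally_boundedD f g : locally_bounded f -> locally_bounded g ->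
  locally_bounded (fun u => f u + g u).
Proof.
move=> [d [B [d0 fB]]] [d' [B' [d'0 gB]]].
exists (Num.min d d'), (B + B'); split; first by rewrite lt_min d0.
move=> u; rewrite lt_min => /and3P[u0 ud ud'].
by apply: le_trans (ncD _ _) _; rewrite lerD ?fB ?gB ?u0.
Qed.

Lemma locally_boundedZ c f : locally_bounded f -> locally_bounded (fun u => c * f u).
Proof.
move=> [d [B [d0 fB]]]; exists d, (nc c * B); split => // u ud.
by rewrite ncM ler_wpM2l ?nc_ge0 ?fB.
Qed.

Lemma locally_bounded_sum (I : eqType) (s : seq I) (Pr : pred I) (F : I -> C -> C) :
  (forall i, i \in s -> Pr i -> locally_bounded (F i)) ->
  locally_bounded (fun u => \sum_(i <- s | Pr i) F i u).
Proof.
elim: s => [|i s IH] h.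
  by apply: eq_locally_bounded ltr01 _ (locally_bounded_cst 0) => u _; rewrite big_nil.
have {}IH : locally_bounded (fun u => \sum_(i <- s | Pr i) F i u).
  by apply: IH => j js; apply: h; rewrite inE js orbT.
have [Pi|Pi] := boolP (Pr i).
  have Fi := h i (mem_head _ _) Pi.
  by apply: eq_locally_bounded ltr01 _ (locally_boundedD Fi IH) => u _; rewrite big_cons Pi.
by apply: eq_locally_bounded ltr01 _ IH => u _; rewrite big_cons (negPf Pi).
Qed.

Lemma approx_locally_bounded f P M : approx f P M -> locally_bounded f.
Proof.
move=> [d [B [d0 B0 h]]]; pose b := \sum_(i < size P) nc P`_i.
exists (Num.min d 1), (B + b); split; first by rewrite lt_min d0 ltr01.
move=> u; rewrite lt_min => /and3P[u0 ud u1].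
rewrite -(subrK P.[u] (f u)); apply: le_trans (ncD _ _) _; apply: lerD.
  apply: le_trans (h u _) _; first by rewrite u0.
  by rewrite ler_piMr// exprn_ile1 ?nc_ge0// ltW.
by apply: nc_horner; exact: ltW.
Qed.

Lemma locally_bounded_of_approx f V S : approx (fun u => u ^+ S * f u) V S ->
  (forall i, (i < S)%N -> V`_i = 0) -> locally_bounded f.
Proof.
move=> [d [B [d0 B0 h]]] V0.
have VE : V = 'X^S * drop_poly S V.
  rewrite -[LHS](poly_take_drop S) [take_poly S V](_ : _ = 0) ?add0r 1?mulrC//.
  by apply/polyP => j; rewrite coef_take_poly coef0; case: ifP => // /V0.
set Q := drop_poly S V in VE; pose b := \sum_(i < size Q) nc Q`_i.
exists (Num.min d 1), (B + b); split; first by rewrite lt_min d0 ltr01.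
move=> u; rewrite lt_min => /and3P[u0 ud u1].
have h1 := h u; rewrite u0 ud in h1; have {}h1 := h1 isT.
rewrite VE hornerM hornerXn -mulrBr ncM ncX mulrC ler_pM2r ?exprn_gt0// in h1.
rewrite -(subrK Q.[u] (f u)); apply: le_trans (ncD _ _) _; apply: lerD => //.
by apply: nc_horner; exact: ltW.
Qed.

(** For either label the principal part of phi_n at 0 is u^-n alone, so below degree S only the
    coefficient of index S - n is nonzero, and principal parts can be matched one order at a
    time. *)
Lemma approx_phi_mulX J n S : (0 < n <= S)%N ->
  exists q : {poly C}, approx (fun u => u ^+ S * phi J n u) ('X^(S - n) + 'X^S * q) S.
Proof.
case: n => // n /andP[_ nS].
have h := approxW (leq_addr 1 S) (approx_mulX S (@tail_taylor R J n 0 _ (@away0 R))).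
eexists; apply: eq_approx ltr01 _ (approxD (approxP 'X^(S - n.+1) S) h) => u /andP[u0 _].
have un : u != 0 by rewrite -nc_gt0.
rewrite hornerXn add0r phiE mulrDr; congr (_ + _).
by rewrite -{2}(subnK nS) exprD mulfK// expf_neq0.
Qed.

End Local.

(** * The principal parts *)

Section PrincipalPart.
Variables (R : realType) (r : nat).
Local Notation C := (cplx R).
Variables (a m : 'I_r -> nat) (w : 'I_r -> C) (jI : nat).
Hypothesis a_gt0 : forall l, (0 < a l)%N.
Hypothesis m_gt0 : forall l, (0 < m l)%N.
Implicit Types (z u rho : C) (Lam : {set 'I_r}).

Local Notation lab l := (label_of jI l).

Definition weight : nat := \sum_(l < r) m l.

Definition principal_coef (n : nat) rho : C :=
  \sum_(Lam : {set 'I_r} | Lam \in Rset a w rho)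
    \sum_(nu \in Kminus m n Lam)
      (\prod_(l in Lam) sgnpow ((a l)%:R * rho - w l) (deltaII (lab l)))
      * (\prod_(u : {k : 'I_r | k \in ~: Lam})
           coefA (lab (val u)) (nu u) rho (a (val u)) (m (val u)) (w (val u))).

Definition local_factor rho (l : 'I_r) : {poly C} :=
  (polar (lab l) (a l) (w l) rho)%:P +
  'X^(m l) * \poly_(nu < weight.+1) coefA (lab l) nu rho (a l) (m l) (w l).

Definition local_poly rho : {poly C} := \prod_(l < r) local_factor rho l.

Lemma Phi_approx rho :
  approx (fun u => u ^+ weight * Phi a m w jI (rho + u)) (local_poly rho) weight.+1.
Proof.
have h := approx_prod (index_enum 'I_r) (fun l => factor_approx (lab l) (w l) rho weight (a_gt0 l) (m_gt0 l)).
apply: eq_approx ltr01 _ h => u _.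
by rewrite big_split/= -[X in X * _]expr_sum.
Qed.

(** Truncation of the series loses nothing: the equation bounds every nu i by N <= M, so its
    solutions, among all tuples of naturals, come from tuples of ordinals. *)
Lemma coef_prod_taylor (I : finType) (A : I -> nat -> C) (e : I -> nat) (M N : nat) (S : nat) :
  (N <= M)%N -> (N + \sum_(i : I) e i = S)%N -> forall n, (0 < n <= S)%N ->
  (\prod_(i : I) ('X^(e i) * \poly_(k < M.+1) A i k))`_(S - n) =
  \sum_(nu \in [set nu : {ffun I -> nat} | (n + \sum_i nu i = N)%N]) \prod_i A i (nu i).
Proof.
move=> NM NS n /andP[n0 nS].
rewrite big_split/= [X in X * _]prodrXr.
have -> : \prod_(i : I) \poly_(k < M.+1) A i k =
    \sum_(f : {ffun I -> 'I_M.+1}) (\prod_i A i (f i)) *: 'X^(\sum_i f i).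
  under eq_bigr do rewrite poly_def.
  rewrite bigA_distr_bigA/=; apply: eq_bigr => f _.
  by rewrite scaler_prod prodrXr.
rewrite coefXnM.
pose h (f : {ffun I -> 'I_M.+1}) : {ffun I -> nat} := [ffun i => f i : nat].
have hinj : injective h.
  move=> f g fg; apply/ffunP => i; apply: val_inj.
  by have := congr1 (fun k : {ffun I -> nat} => k i) fg; rewrite !ffunE.
pose s := [seq h f | f <- enum [pred f : {ffun I -> 'I_M.+1} | (n + \sum_i f i == N)%N]].
have us : uniq s by rewrite map_inj_uniq ?enum_uniq.
have sumh f : (\sum_i h f i = \sum_i f i)%N by apply: eq_bigr => i _; rewrite ffunE.
have -> : [set nu : {ffun I -> nat} | (n + \sum_i nu i = N)%N] = [set` s].
  apply/seteqP; split=> [nu /= nuN|nu /= /mapP[f]].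
    have nuM i : (nu i < M.+1)%N.
      rewrite ltnS (leq_trans _ NM)// -nuN; apply: leq_trans (leq_addl _ _).
      by rewrite (bigD1 i)//= leq_addr.
    apply/mapP; exists [ffun i => Ordinal (nuM i)]; last first.
      by apply/ffunP => i; rewrite !ffunE.
    rewrite mem_enum inE; apply/eqP; rewrite -nuN; congr (_ + _)%N.
    by apply: eq_bigr => i _; rewrite ffunE.
  by rewrite mem_enum inE => /eqP fN ->; rewrite /= sumh.
rewrite -fsbig_seq// big_map big_enum/=.
have term f : (n + \sum_i (f : {ffun I -> 'I_M.+1}) i == N)%N =
    (\sum_i e i + \sum_i f i == S - n)%N by apply/eqP/eqP; lia.
case: ifP => hlt.
  rewrite big1// => f; rewrite inE term => /eqP; lia.
rewrite coef_sum [RHS]big_mkcond/=; apply: eq_bigr => f _.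
rewrite coefZ coefXn inE term.
have -> : (S - n - \sum_i e i == \sum_i f i)%N = (\sum_i e i + \sum_i f i == S - n)%N.
  by apply/eqP/eqP; lia.
case: ifP => _; last by rewrite mulr0.
by rewrite mulr1; apply: eq_bigr => i _; rewrite ffunE.
Qed.

(** Identifies [principal_coef] as the coefficient of u^-n in the Laurent expansion at rho. Taking
    the polar term for l in Lam and u^(m_k + nu_k) elsewhere, the total degree is |m| - n exactly
    when the equation of [Kminus] holds. A set outside [Rset] contains an index whose polar term is
    0. *)
Lemma coef_local_poly rho n : (0 < n <= weight)%N ->
  (local_poly rho)`_(weight - n) = principal_coef n rho.
Proof.
move=> nW; rewrite /local_poly /local_factor /principal_coef bigA_distr coef_sum [RHS]big_mkcond.
apply: eq_big => [Lam|Lam _]; first by rewrite inE.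
case: ifPn => [/set_mem LR|LR]; last first.
  have [l lL li] : exists2 l, l \in Lam & ~ isint ((a l)%:R * rho - w l).
    apply: contrapT => h; move/negP: LR; apply; apply: mem_set => l lL.
    by apply: contrapT => li; apply: h; exists l.
  by rewrite (bigD1 l)//= lL /polar; case: asboolP => // _; rewrite polyC0 mul0r coef0.
rewrite (bigID (mem Lam))/=.
have -> : \prod_(i | i \in Lam) (if i \in Lam then (polar (lab i) (a i) (w i) rho)%:P
      else 'X^(m i) * \poly_(nu < weight.+1) coefA (lab i) nu rho (a i) (m i) (w i)) =
    (\prod_(l in Lam) sgnpow ((a l)%:R * rho - w l) (deltaII (lab l)))%:P.
  rewrite rmorph_prod; apply: eq_bigr => l lL; rewrite lL /polar.
  by case: asboolP => // h; case: h; exact: LR.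
have -> : \prod_(i | i \notin Lam) (if i \in Lam then (polar (lab i) (a i) (w i) rho)%:P
      else 'X^(m i) * \poly_(nu < weight.+1) coefA (lab i) nu rho (a i) (m i) (w i)) =
    \prod_(u : {k : 'I_r | k \in ~: Lam}) ('X^(m (val u)) *
      \poly_(nu < weight.+1) coefA (lab (val u)) nu rho (a (val u)) (m (val u)) (w (val u))).
  rewrite -(big_sub (~: Lam) (fun i => 'X^(m i) *
      \poly_(nu < weight.+1) coefA (lab i) nu rho (a i) (m i) (w i))).
  by apply: eq_big => [i|i /negPf ->//]; rewrite inE.
have WE : (\sum_(l in Lam) m l + \sum_(u : {k : 'I_r | k \in ~: Lam}) m (val u) = weight)%N.
  rewrite -(big_sub (~: Lam) m) /weight [RHS](bigID (mem Lam))/=; congr (_ + _)%N.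
  by apply: eq_bigl => i; rewrite inE.
have NW : (\sum_(l in Lam) m l <= weight)%N by rewrite -WE leq_addr.
rewrite coefCM (coef_prod_taylor (fun (u : {k : 'I_r | k \in ~: Lam}) nu =>
  coefA (lab (val u)) nu rho (a (val u)) (m (val u)) (w (val u))) NW WE nW).
rewrite mulrC mulr_fsuml; apply: eq_fsbigr => nu _; exact: mulrC.
Qed.

(** All polar terms vanish, so the local polynomial is divisible by X^|m|. *)
Lemma principal_coef_regular rho n : (0 < n <= weight)%N ->
  (forall l, ~ isint ((a l)%:R * rho - w l)) -> principal_coef n rho = 0.
Proof.
move=> nW reg; rewrite -coef_local_poly// /local_poly /local_factor.
have p0 l : polar (lab l) (a l) (w l) rho = 0 by rewrite /polar; case: asboolP => // /reg.
under eq_bigr do rewrite p0 polyC0 add0r.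
rewrite big_split/= prodrXr coefXnM -/weight; case: ifP => //.
by move/andP: nW; lia.
Qed.

(* A nonzero coefficient would force |Phi| to tend to infinity. *)
Lemma principal_coef_not_pole rho n : (0 < n <= weight)%N ->
  ~ is_pole (Phi a m w jI) rho -> principal_coef n rho = 0.
Proof.
move=> nW np; apply/eqP; apply: contrapT => /negP h; apply: np.
apply: (is_pole_of_coef (Phi_approx rho)); exists (weight - n)%N.
  by move/andP: nW; lia.
by rewrite coef_local_poly.
Qed.

Lemma principal_part_removed J rho : locally_bounded (fun u =>
  Phi a m w jI (rho + u) - \sum_(1 <= n < weight.+1) principal_coef n rho * phi J n u).
Proof.
have [q hq] : exists q : 'I_weight -> {poly C}, forall i : 'I_weight,
    approx (fun u => u ^+ weight * phi J i.+1 u) ('X^(weight - i.+1) + 'X^weight * q i) weight.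
  have hex (i : 'I_weight) := @approx_phi_mulX R J i.+1 weight (ltn_ord i).
  by exists (fun i => projT1 (cid (hex i))) => i; exact: projT2 (cid (hex i)).
have hS := approx_sum (index_enum 'I_weight)
  (fun i => approxZ (principal_coef i.+1 rho) (hq i)).
have h := approxB (approxW (leqnSn _) (Phi_approx rho)) hS.
apply: (@locally_bounded_of_approx _ _ _ weight).
  apply: eq_approx ltr01 _ h => u _.
  rewrite mulrBr big_add1/= big_mkord mulr_sumr; congr (_ - _).
  by apply: eq_bigr => i _; rewrite mulrCA.
move=> i iW; rewrite coefB coef_sum.
have W0 : (0 < weight)%N by apply: leq_ltn_trans iW.
(* Degree i is cancelled by the single term n = weight - i, whose ordinal index is n - 1. *)
have jW : (weight - i.+1 < weight)%N by rewrite ltn_subrL.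
rewrite (bigD1 (Ordinal jW))//= big1 ?addr0 => [|j jN].
  rewrite coefZ coefD coefXn coefXnM iW addr0.
  have e : (weight - i.+1).+1 = (weight - i)%N by rewrite subnSK.
  rewrite e subKn ?(ltnW iW)// eqxx mulr1 -coef_local_poly ?subKn ?subrr ?(ltnW iW)//.
  by rewrite subn_gt0 iW leq_subr.
rewrite coefZ coefD coefXn coefXnM iW addr0; case: eqP => [ij|_]; last by rewrite mulr0.
case/eqP: jN; apply: val_inj => /=; have := ltn_ord j.
by move=> jlt; rewrite ij subnSK// subKn// ltnW.
Qed.

Lemma finite_near (P : 'I_r -> C -> Prop) :
  (forall l, exists2 d : R, 0 < d & forall u, 0 < nc u < d -> P l u) ->
  exists2 d : R, 0 < d & forall u, 0 < nc u < d -> forall l, P l u.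
Proof.
move=> h; suff [d d0 H] : exists2 d : R, 0 < d &
    forall u, 0 < nc u < d -> forall l, l \in enum 'I_r -> P l u.
  by exists d => // u ud l; apply: H => //; rewrite mem_enum.
elim: (enum 'I_r) => [|l s [d d0 IH]]; first by exists 1.
have [d' d'0 H] := h l; exists (Num.min d d'); first by rewrite lt_min d0.
move=> u; rewrite lt_min => /and3P[u0 ud ud'] j; rewrite inE => /orP[/eqP->|js].
  by apply: H; rewrite u0.
by apply: IH => //; rewrite u0.
Qed.

Lemma Phi_dom_near rho : exists2 d : R, 0 < d &
  forall u, 0 < nc u < d -> Phi_dom a w (rho + u).
Proof.
apply: (@finite_near (fun l u => ~ isint ((a l)%:R * (rho + u) - w l))) => l.
have [d d0 H] := nonint_near ((a l)%:R * rho - w l).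
have na : 0 < nc ((a l)%:R : C) by rewrite nc_gt0 nat_neq0C.
exists (d / nc ((a l)%:R : C)); first by rewrite divr_gt0.
move=> u /andP[u0 ud].
have -> : (a l)%:R * (rho + u) - w l = (a l)%:R * rho - w l + (a l)%:R * u by ring.
by apply: H; rewrite ncM mulr_gt0//= mulrC -ltr_pdivlMr.
Qed.

Lemma Phi_dom_shiftN z : Phi_dom a w z -> Phi_dom a w (z - 1).
Proof.
move=> zd l; have -> : (a l)%:R * (z - 1) - w l = (a l)%:R * z - w l + - (a l)%:R by ring.
by rewrite isintDr; [exact: zd|apply: isintN; exact: isint_nat].
Qed.

(** A factor of label II picks up (-1)^(a_l), so the parity of the sum of these a_l decides between
    the cases J = I and J = II. *)
Lemma Phi_shift z : Phi_dom a w z ->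
  Phi a m w jI (z + 1) = (-1) ^+ (\sum_(l < r | (jI <= l)%N) a l) * Phi a m w jI z.
Proof.
move=> zd; have -> : (-1) ^+ (\sum_(l < r | (jI <= l)%N) a l) =
    \prod_(l < r) sg R (lab l) ^+ a l.
  rewrite expr_sum big_mkcond/=; apply: eq_bigr => l _.
  by rewrite /label_of /sg leqNgt; case: (l < jI)%N => /=; rewrite ?expr0 ?expr1n ?expr1.
rewrite /Phi -big_split/=; apply: eq_bigr => l _.
have -> : (a l)%:R * (z + 1) - w l = (a l)%:R * z - w l + (a l)%:R by ring.
have := m_gt0 l; case: (m l) => // n _.
by rewrite phi_shift_nat; [ring|exact: zd].
Qed.

Definition singular_points : seq C := undup
  [seq (w (lk : 'I_r * nat).1 + lk.2%:R) / (a lk.1)%:R |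
    lk <- [seq (l, k) | l <- enum 'I_r, k <- iota 0 (a l)]].

Hypothesis w_strip : forall l, strip R (w l).

(** If a rho - w = k with Re rho and Re w in [0, 1), then -1 < k < a, so the enumeration over 0 <= k
    < a is complete. *)
Lemma singular_pointsP rho : reflect
  (strip R rho /\ exists l, isint ((a l)%:R * rho - w l)) (rho \in singular_points).
Proof.
have aC l : ((a l)%:R : C) != 0 := nat_neq0C R (a_gt0 l).
have aR l : 0 < (a l)%:R :> R by rewrite ltr0n.
rewrite mem_undup; apply: (iffP mapP) => [[[l k] /allpairsPdep[l' [k' [_ + [ll kk]]]] ->]|].
  rewrite -{}ll -{}kk mem_iota add0n /= => kl {l' k'}; split.
    have /andP[w0 w1] := w_strip l.
    rewrite /strip /= Re_divn ReD Re_nat; apply/andP; split.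
      by rewrite divr_ge0// addr_ge0.
    rewrite ltr_pdivrMr// mul1r.
    have : k.+1%:R <= (a l)%:R :> R by rewrite ler_nat.
    by rewrite -natr1; lra.
  exists l; rewrite mulrC divfK// addrC addKr; exact: isint_nat.
move=> [/andP[r0 r1] [l [k kE]]].
have rE : rho = (w l + k%:~R) / (a l)%:R by rewrite -kE addrC subrK mulrC mulKf.
have /andP[w0 w1] := w_strip l.
have kR : k%:~R = (a l)%:R * complex.Re rho - complex.Re (w l) :> R.
  have := congr1 (@complex.Re R) kE; rewrite ReD ReN natC Re_ofRM => ->.
  by have -> : (k%:~R : C) = ofR k%:~R by rewrite /ofR rmorph_int.
have k1 : (-1)%:~R < k%:~R :> R.
  rewrite kR; have := mulr_ge0 (ltW (aR l)) r0; rewrite mulrNz; lra.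
have k2 : k%:~R < (a l)%:Z%:~R :> R.
  rewrite kR; have : (a l)%:R * complex.Re rho < (a l)%:R * 1 by rewrite ltr_pM2l.
  by rewrite -[(a l)%:Z%:~R]/((a l)%:R : R); lra.
rewrite !ltr_int in k1 k2.
case: k k1 k2 rE {kE kR} => // k _ ka rE.
exists (l, k); last by rewrite rE.
apply/allpairsPdep; exists l, k; split => //; first by rewrite mem_enum.
by rewrite mem_iota add0n.
Qed.

Lemma singular_points_diff rho rho' : strip R rho -> strip R rho' -> rho != rho' ->
  ~ isint (rho - rho').
Proof.
move=> /andP[r0 r1] /andP[s0 s1] rr [k kE].
have kR : k%:~R = complex.Re rho - complex.Re rho' :> R.
  have := congr1 (@complex.Re R) kE; rewrite ReD ReN => ->.
  by have -> : (k%:~R : C) = ofR k%:~R by rewrite /ofR rmorph_int.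
have k1 : (-1)%:~R < k%:~R :> R by rewrite kR mulrNz; lra.
have k2 : k%:~R < 1%:~R :> R by rewrite kR; lra.
rewrite !ltr_int in k1 k2; have k0 : k = 0 by lia.
by move: rr; rewrite -subr_eq0 kE k0 eqxx.
Qed.

Lemma nonint_sub_singular z rho : Phi_dom a w z -> rho \in singular_points -> ~ isint (z - rho).
Proof.
move=> zd /singular_pointsP[_ [l li]] zi; apply: (zd l).
have -> : (a l)%:R * z - w l = (a l)%:R * (z - rho) + ((a l)%:R * rho - w l) by ring.
by apply: isintD => //; apply: isintM => //; exact: isint_nat.
Qed.

Lemma principal_coef_out rho n : (0 < n <= weight)%N -> strip R rho ->
  rho \notin singular_points -> principal_coef n rho = 0.
Proof.
move=> nW rs; move/negP => rN; apply: principal_coef_regular => // l li.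
by apply: rN; apply/singular_pointsP; split => //; exists l.
Qed.

Variable J : label.

Definition remainder (K : C) z : C := Phi a m w jI z - K -
  \sum_(rho <- singular_points) \sum_(1 <= n < weight.+1) principal_coef n rho * phi J n (z - rho).

Lemma phi_locally_bounded n z : (0 < n)%N -> ~ isint z -> locally_bounded (fun u => phi J n (z + u)).
Proof. by case: n => // n _ zi; exact: approx_locally_bounded (@phi_taylor R J n 0 z zi). Qed.

Lemma remainder_strip_bounded K rho : strip R rho ->
  locally_bounded (fun u => remainder K (rho + u)).
Proof.
move=> rs; have h := principal_part_removed J rho.
have h2 : locally_bounded (fun u => \sum_(rho' <- singular_points | rho' != rho)
    \sum_(1 <= n < weight.+1) principal_coef n rho' * phi J n (rho + u - rho')).
  apply: locally_bounded_sum => rho' /singular_pointsP[rs' _] rr.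
  have ri := singular_points_diff rs rs' _; rewrite eq_sym in ri.
  apply: locally_bounded_sum => n; rewrite mem_index_iota => /andP[n0 _] _.
  apply: locally_boundedZ; have := phi_locally_bounded n0 (ri rr).
  by apply: eq_locally_bounded ltr01 _ => u _; rewrite addrAC.
have {h2} h2 := locally_boundedZ (-1) h2.
apply: eq_locally_bounded ltr01 _ (locally_boundedD (locally_boundedD h (locally_bounded_cst (- K))) h2) => u _.
rewrite /remainder [in RHS](bigID (fun rho' => rho' != rho))/= mulN1r.
(* When rho is not in the list the left sum is empty, and the right one vanishes with its
   coefficients. *)
have -> : \sum_(rho' <- singular_points | ~~ (rho' != rho))
    \sum_(1 <= n < weight.+1) principal_coef n rho' * phi J n (rho + u - rho') =
    \sum_(1 <= n < weight.+1) principal_coef n rho * phi J n u.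
  under eq_bigl do rewrite negbK.
  have [rin|rout] := boolP (rho \in singular_points).
    rewrite -big_filter (filter_pred1_uniq (undup_uniq _) rin) big_seq1.
    by rewrite [rho + u]addrC addrK.
  rewrite big_seq_cond big1 => [|rho' /andP[rin /eqP re]]; last by rewrite -re rin in rout.
  rewrite big_nat big1// => n nW.
  by rewrite principal_coef_out ?mul0r.
by ring.
Qed.

(** The condition [sg R J * K = K] lets the constant transform like the other terms; for J = II it
    says K = 0. *)
Lemma remainder_shift K z : Phi_dom a w z -> sg R J * K = K ->
  odd (\sum_(l < r | (jI <= l)%N) a l) = odd (deltaII J) ->
  remainder K (z + 1) = sg R J * remainder K z.
Proof.
move=> zd KJ par; rewrite /remainder Phi_shift// -signr_odd par signr_odd -/(sg R J).
rewrite !mulrBr KJ; congr (_ - _); rewrite mulr_sumr big_seq [RHS]big_seq.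
apply: eq_bigr => rho rs; rewrite mulr_sumr big_nat [RHS]big_nat.
apply: eq_bigr => n /andP[n0 _]; case: n n0 => // n _.
by rewrite addrAC phi_shift1; [rewrite mulrCA|exact: nonint_sub_singular].
Qed.

Lemma remainder_bounded K z0 : sg R J * K = K ->
  odd (\sum_(l < r | (jI <= l)%N) a l) = odd (deltaII J) ->
  locally_bounded (fun u => remainder K (z0 + u)).
Proof.
move=> KJ par.
have up z : locally_bounded (fun u => remainder K (z + u)) ->
    locally_bounded (fun u => remainder K (z + 1 + u)).
  move=> /(locally_boundedZ (sg R J)); have [d d0 Hd] := Phi_dom_near z.
  apply: (eq_locally_bounded d0) => u ud.
  by rewrite addrAC -remainder_shift//; exact: Hd.
have down z : locally_bounded (fun u => remainder K (z + u)) ->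
    locally_bounded (fun u => remainder K (z - 1 + u)).
  move=> /(locally_boundedZ (sg R J)); have [d d0 Hd] := Phi_dom_near z.
  apply: (eq_locally_bounded d0) => u ud.
  have zd := Phi_dom_shiftN (Hd u ud).
  have := remainder_shift zd KJ par; rewrite subrK addrAC => ->.
  by rewrite mulrA sgM mul1r addrAC.
have shift z (k : int) : locally_bounded (fun u => remainder K (z + u)) ->
    locally_bounded (fun u => remainder K (z + k%:~R + u)).
  move=> h; case: k => n.
    elim: n => [|n IH]; first by rewrite addr0.
    have -> : z + n.+1%:~R = z + n%:~R + 1 by rewrite -addrA -[n.+1%:~R]/(n.+1%:R) -natr1.
    exact: up.
  elim: n => [|n IH]; first exact: down.
  have -> : z + (Negz n.+1)%:~R = z + (Negz n)%:~R - 1.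
    by rewrite !NegzE !mulrNz -addrA -opprD -[n.+2%:~R]/(n.+2%:R) -natr1.
  exact: down.
pose k := Num.floor (complex.Re z0).
have h := shift (z0 - k%:~R) k; rewrite subrK in h; apply: h.
apply: remainder_strip_bounded.
have /andP[k1 k2] := floor_itv (complex.Re z0).
have kE : complex.Re (k%:~R : C) = k%:~R.
  by have -> : (k%:~R : C) = ofR k%:~R by rewrite /ofR rmorph_int.
rewrite intrD in k2.
by rewrite /strip /= ReD ReN kE; apply/andP; split; rewrite /k in k1 k2 *; lra.
Qed.

Lemma trig_rational_Phi : trig_rational (Phi_dom a w) (Phi a m w jI).
Proof.
apply: trig_rational_prod => l; apply: trig_rationalM; first exact: trig_rational_cst.
have := m_gt0 l; case: (m l) => // n _.
by apply: trig_rational_phi => // z zd; exact: zd.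
Qed.

Lemma trig_rational_remainder K : trig_rational (Phi_dom a w) (remainder K).
Proof.
have hS : trig_rational (Phi_dom a w) (fun z => \sum_(rho <- singular_points)
    \sum_(1 <= n < weight.+1) principal_coef n rho * phi J n (z - rho)).
  apply: trig_rational_sum => rho rs; apply: trig_rational_sum => n.
  rewrite mem_index_iota => /andP[n0 _]; case: n n0 => // n _.
  apply: trig_rationalM; first exact: trig_rational_cst.
  apply: eq_trig_rational (@trig_rational_phi R (Phi_dom a w) 1 rho isT _ J n) => z zd.
    by rewrite mul1r.
  by rewrite mul1r; exact: nonint_sub_singular.
have h := trig_rationalD (trig_rationalD trig_rational_Phi (trig_rational_cst _ (- K)))
  (trig_rationalM (trig_rational_cst _ (-1)) hS).
by apply: eq_trig_rational h => z _; rewrite /remainder mulN1r.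
Qed.

Definition Phi_end : C := \prod_(l < r) ((a l)%:R ^+ m l * phi_end R (lab l) (m l)).
Definition Phi_endN : C := \prod_(l < r) ((a l)%:R ^+ m l * - phi_end R (lab l) (m l)).
Definition sum_end : C := \sum_(rho <- singular_points) \sum_(1 <= n < weight.+1)
  principal_coef n rho * phi_end R J n.

Lemma remainder_limit K : remainder K (iy y) @[y --> +oo] --> Phi_end - K - sum_end.
Proof.
apply: cvgB.
  apply: cvgB; last exact: cvg_cst.
  apply: cvgC_prod => l; apply: cvgMl_tmp; have := m_gt0 l; case: (m l) => // n _.
  exact: phi_limit.
apply: cvgC_sum => rho; rewrite big_add1/= big_mkord.
under eq_fun do rewrite big_add1/= big_mkord.
apply: cvgC_sum => n; apply: cvgMl_tmp.
apply: (eq_cvgy _ (@phi_limit R J n 1 rho isT)); near=> y.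
by rewrite mul1r.
Unshelve. all: by end_near. Qed.

Lemma remainder_limitN K : remainder K (iy (- y)) @[y --> +oo] --> Phi_endN - K + sum_end.
Proof.
rewrite -[sum_end]opprK; apply: cvgB.
  apply: cvgB; last exact: cvg_cst.
  apply: cvgC_prod => l; apply: cvgMl_tmp; have := m_gt0 l; case: (m l) => // n _.
  exact: phi_limitN.
rewrite /sum_end -sumrN; apply: cvgC_sum => rho; rewrite -sumrN big_add1/= big_mkord.
under eq_fun do rewrite big_add1/= big_mkord.
apply: cvgC_sum => n; rewrite -mulrN; apply: cvgMl_tmp.
apply: (eq_cvgy _ (@phi_limitN R J n 1 rho isT)); near=> y.
by rewrite mul1r.
Unshelve. all: by end_near. Qed.

Lemma near_forall_ord (P : 'I_r -> R -> Prop) :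
  (forall l, \forall y \near +oo, P l y) -> \forall y \near +oo, forall l, P l y.
Proof. by move=> h; apply: filter_forall. Qed.

Lemma near_Phi_dom : \forall y \near +oo, Phi_dom a w (iy y) /\ Phi_dom a w (iy (- y)).
Proof.
apply: filterI; apply: near_forall_ord => l; first exact: near_nonint_iy.
near=> y; move=> /isintN; rewrite opprB addrC.
have -> : - ((a l)%:R * iy (- y)) + w l = (a l)%:R * iy y - - w l.
  by rewrite opprK -mulrN; congr (_ * _ + _); apply/eqP; rewrite eq_complex/= oppr0 opprK !eqxx.
by near: y; exact: near_nonint_iy.
Unshelve. all: by end_near. Qed.

(** The constant value k of the remainder equals both of its limits. In their sum the contributions
    [sum_end] cancel, so 2k = [Phi_end + Phi_endN - 2 * K] = 0. *)
Lemma remainder_eq0 K : sg R J * K = K ->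
  odd (\sum_(l < r | (jI <= l)%N) a l) = odd (deltaII J) ->
  Phi_end + Phi_endN = 2 * K -> forall z, Phi_dom a w z -> remainder K z = 0.
Proof.
move=> KJ par ends.
have [k kE] : exists k, forall z, Phi_dom a w z -> remainder K z = k.
  apply: (trig_rational_bounded_const (trig_rational_remainder K)).
    move=> z0; have [d [B [d0 HB]]] := remainder_bounded z0 KJ par.
    have [d' d'0 Hd'] := Phi_dom_near z0.
    exists (Num.min d d'), B; split; first by rewrite lt_min d0.
    move=> u; rewrite lt_min => /and3P[u0 ud ud'].
    by split; [apply: Hd'; rewrite u0|apply: HB; rewrite u0].
  have /cvgCP/(_ 1 ltr01) h1 := @remainder_limit K.
  have [y0 [_ Hy]] : \forall y \near +oo, Phi_dom a w (iy y) /\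
      nc (remainder K (iy y)) <= nc (Phi_end - K - sum_end) + 1.
    near=> y; split.
      by have [] : Phi_dom a w (iy y) /\ Phi_dom a w (iy (- y)) by near: y; exact: near_Phi_dom.
    rewrite -(subrK (Phi_end - K - sum_end) (remainder K (iy y))) addrC.
    apply: le_trans (ncD _ _) _; rewrite lerD2l; apply: ltW; near: y; exact: h1.
  exists (y0 + 1), (nc (Phi_end - K - sum_end) + 1) => y yy.
  by apply: Hy; rewrite (lt_le_trans _ yy)// ltrDl.
have c1 : (cst k : R -> C) y @[y --> +oo] --> Phi_end - K - sum_end.
  apply: (eq_cvgy _ (@remainder_limit K)); near=> y.
  have [d1 d2] : Phi_dom a w (iy y) /\ Phi_dom a w (iy (- y)) by near: y; exact: near_Phi_dom.
  exact: kE.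
have c2 : (cst k : R -> C) y @[y --> +oo] --> Phi_endN - K + sum_end.
  apply: (eq_cvgy _ (@remainder_limitN K)); near=> y.
  have [d1 d2] : Phi_dom a w (iy y) /\ Phi_dom a w (iy (- y)) by near: y; exact: near_Phi_dom.
  exact: kE.
have k1 : k = Phi_end - K - sum_end by apply: (cvg_unique (@norm_hausdorff _ _) (cvg_cst k) c1).
have k2 : k = Phi_endN - K + sum_end by apply: (cvg_unique (@norm_hausdorff _ _) (cvg_cst k) c2).
move=> z zd; rewrite kE//; apply: (@mulfI _ 2); first by rewrite pnatr_eq0.
have -> : 2 * k = k + k by ring.
rewrite {1}k1 k2 mulr0.
transitivity (Phi_end + Phi_endN - 2 * K); first by ring.
by rewrite ends subrr.
Unshelve. all: by end_near. Qed.

End PrincipalPart.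

(** * The constant term *)

Section Constant.
Variable R : realType.
Local Notation C := (cplx R).

Lemma pii_sqr : pii R ^+ 2 = - ofR (pi ^+ 2).
Proof.
rewrite expr2 /pii /ofR; apply/eqP; rewrite eq_complex/=.
by rewrite !mul0r !mulr0 addr0 oppr0 sub0r -expr2 !eqxx.
Qed.

Lemma ofRM (x y : R) : ofR (x * y) = ofR x * ofR y. Proof. by rewrite /ofR rmorphM. Qed.

(** Passing from r to r + 2 multiplies both sides by -pi^2, since the cosine changes sign; hence the
    induction carries two consecutive cases. *)
Lemma pii_pow r : (- pii R) ^+ r + pii R ^+ r =
  2 * ofR (cos (pi * r%:R / 2) * pi ^+ r).
Proof.
suff : (- pii R) ^+ r + pii R ^+ r = 2 * ofR (cos (pi * r%:R / 2) * pi ^+ r) /\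
  (- pii R) ^+ r.+1 + pii R ^+ r.+1 = 2 * ofR (cos (pi * r.+1%:R / 2) * pi ^+ r.+1) by case.
elim: r => [|r [IH1 IH2]]; split => //.
- by rewrite !expr0 mulr0 mul0r cos0 mulr1 /ofR rmorph1 mulr1.
- by rewrite !expr1 mulr1 cos_pihalf mul0r addNr /ofR rmorph0 mulr0.
have -> : pi * r.+2%:R / 2 = pi * r%:R / 2 + pi :> R by rewrite -!natr1; field.
rewrite cosDpi.
have e (x : C) : x ^+ r.+2 = x ^+ 2 * x ^+ r by rewrite -exprD.
rewrite !e sqrrN -mulrDr IH1 pii_sqr.
have -> : pi ^+ r.+2 = pi ^+ 2 * pi ^+ r :> R by rewrite -exprD.
have -> : - cos (pi * r%:R / 2) * (pi ^+ 2 * pi ^+ r) = - (pi ^+ 2 * (cos (pi * r%:R / 2) * pi ^+ r)) :> R by ring.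
have -> : ofR (- (pi ^+ 2 * (cos (pi * r%:R / 2) * pi ^+ r))) =
  - (ofR (pi ^+ 2) * ofR (cos (pi * r%:R / 2) * pi ^+ r)) :> C by rewrite -ofRM /ofR rmorphN.
by ring.
Qed.

End Constant.

Theorem theorem3p1 (R : realType) (r : nat) (hr : (2 <= r)%N)
  (a m : 'I_r -> nat) (w : 'I_r -> cplx R) (jI jII : nat)
  (ha : forall l, (1 <= a l)%N) (hm : forall l, (1 <= m l)%N)
  (hw : forall l, strip R (w l)) (hj : (jI + jII = r)%N)
  (J : label)
  (hJ : J = if (jII == 0)%N || ~~ odd (\sum_(l < r | (jI <= l)%N) a l)
            then LI else LII)
  (z : cplx R) (hz : Phi_dom a w z) :
  Phi a m w jI z =
    ofR (cos (pi * r%:R / 2) * pi ^+ r) * (jII == 0)%N%:R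
      * (\prod_(l < r) ((a l)%:R * (m l == 1)%N%:R))
    + \sum_(1 <= n < (\sum_(l < r) m l).+1)
        \sum_(rho \in Phi_poles a m w jI)
        \sum_(Lam : {set 'I_r} | Lam \in Rset a w rho)
        \sum_(nu \in Kminus m n Lam)
          (\prod_(l in Lam)
             sgnpow ((a l)%:R * rho - w l) (deltaII (label_of jI l)))
          * (\prod_(u : {k : 'I_r | k \in ~: Lam})
               coefA (label_of jI (val u)) (nu u) rho
                     (a (val u)) (m (val u)) (w (val u)))
          * phi J n (z - rho).
Proof.
set K := ofR _ * _ * _.
have noII : jII = 0%N -> forall l : 'I_r, (l < jI)%N.
  by move=> j0 l; rewrite -hj j0 addn0 in l *; exact: ltn_ord.
have parity : odd (\sum_(l < r | (jI <= l)%N) a l) = odd (deltaII J).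
  rewrite hJ; case: eqP => [j0|_] /=; last by case: odd.
  by rewrite big1// => l; rewrite leqNgt noII.
(* J = II occurs only for jII > 0, and there K contains the factor 0. *)
have KJ : sg R J * K = K.
  rewrite hJ; case: eqP => [j0|/eqP j0] /=; first by rewrite /sg expr0 mul1r.
  by rewrite /K (negPf j0) mulr0 !mul0r mulr0.
have ends : Phi_end R a m jI + Phi_endN R a m jI = 2 * K.
  (* If jII > 0, the index jI carries label II; its factor tends to 0 at both ends, so both products
     vanish together with K. *)
  rewrite /Phi_end /Phi_endN /K; have [j0|j0] := eqVneq jII 0%N; last first.
    have lr : (jI < r)%N by rewrite -hj -addn1 leq_add2l lt0n.
    have prod0 (F : 'I_r -> cplx R) : F (Ordinal lr) = 0 -> \prod_(l < r) F l = 0.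
      by move=> F0; rewrite (bigD1 (Ordinal lr))//= F0 mul0r.
    have e0 n : phi_end R (label_of jI (Ordinal lr)) n = 0 by rewrite /label_of /= ltnn.
    rewrite mulr0 mul0r mulr0.
    by rewrite prod0 ?add0r ?prod0// e0 ?oppr0 mulr0.
  pose A : cplx R := \prod_(l < r) ((a l)%:R * (m l == 1)%N%:R).
  have e (s : cplx R) l : (a l)%:R ^+ m l * (s * (m l == 1)%N%:R) = s * ((a l)%:R * (m l == 1)%N%:R).
    by have [->|_] := eqVneq (m l) 1%N; rewrite ?expr1 ?mulr0// !mulr1 mulrC.
  have -> : \prod_(l < r) ((a l)%:R ^+ m l * phi_end R (label_of jI l) (m l)) = (- pii R) ^+ r * A.
    rewrite -[in RHS](card_ord r) -prodr_const -big_split; apply: eq_bigr => l _ /=.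
    by rewrite /label_of noII// e.
  have -> : \prod_(l < r) ((a l)%:R ^+ m l * - phi_end R (label_of jI l) (m l)) = (pii R) ^+ r * A.
    rewrite -[in RHS](card_ord r) -prodr_const -big_split; apply: eq_bigr => l _ /=.
    by rewrite /label_of noII// -e /phi_end -mulNr opprK.
  by rewrite mulr1 -mulrDl pii_pow mulrA.
have := remainder_eq0 ha hm hw KJ parity ends hz.
rewrite /remainder exchange_big => /eqP; rewrite subr_eq0 => /eqP h.
rewrite -[LHS](subrK K) h addrC; congr (_ + _).
rewrite big_nat [RHS]big_nat; apply: eq_bigr => n; rewrite ltnS => nW.
pose G rho := principal_coef a m w jI n rho * phi J n (z - rho).
transitivity (\sum_(rho \in Phi_poles a m w jI) G rho); last first.
  apply: eq_fsbigr => rho _; rewrite /G /principal_coef mulr_suml; apply: eq_bigr => Lam _.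
  exact: mulr_fsuml.
rewrite (fsbig_seq _ G (undup_uniq _)).
(* Both sums are widened to the union, so that neither inclusion between the index sets is used. A
   pole outside the list has zero coefficients by [principal_coef_out], a listed point that is not a
   pole by [principal_coef_not_pole]. *)
pose U := Phi_poles a m w jI `|` [set` singular_points a w].
transitivity (\sum_(rho \in U) G rho).
  apply: fsbig_widen; first exact: subsetUr.
  move=> rho [[[rs _]|//] rout]; rewrite /= /G principal_coef_out ?mul0r//.
  exact/negP.
apply/esym/fsbig_widen; first exact: subsetUl.
move=> rho [[//|rin] rout]; rewrite /= /G principal_coef_not_pole ?mul0r// => pol.
by apply: rout; split => //; have /(singular_pointsP ha hw)[] := rin.
Qed.
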